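(* Let $A$ be the set of all $k=(k_1,\ldots,k_n)\in\mathbb Z^n$ with $k_i\ge 0$ of one and the same homogeneous degree $d=\sum_{i=1}^n k_i$, and for $a=(a_k)_{k\in A}\in\mathbb C^A$ let $P(a;x)=\sum_{k\in A}a_kx^k$, where $x^k=x_1^{k_1}\cdots x_n^{k_n}$. Let $$J_{n|d}(C;a)=\int_C e^{P(a;x)}\,dx$$ be the integral over an $n$-dimensional real contour $C\subset\mathbb C^n$ on which the function $e^{P(a;x)}$ rapidly decreases at infinity. Then the integral $\varphi(a)=J_{n|d}(C;a)$ is a $GL(n)$-hypergeometric function on the space $V^*=\mathbb C^A$.
   Context: Here $dx=dx_1\cdots dx_n$. Definition of $G$-hypergeometric function. Let $G$ be a complex Lie group with Lie algebra $\mathfrak g$, and let $V$ be a finite-dimensional representation of $G$ such that the unit operator on $V$ lies in the image of $\mathfrak g$ (otherwise $G$ is replaced by $G\times\mathbb C^*$). Let $W=\overline{G\cdot v}$ be the closure of the $G$-orbit of a nonzero vector $v\in V$, assumed to contain finitely many $G$-orbits. Let $V^*$ be the dual $G$-module, $\beta:\mathfrak g\to\mathbb C$ a character of the Lie algebra, and $(e_i)$ a basis of $\mathfrak g$. The $G$-hypergeometric system is the system of equations $$\square_j\,\varphi=0,\qquad (L_{e_i}+\beta(e_i)-\chi_0(e_i))\,\varphi=0$$ for a function $\varphi(w)$ on $V^*$, where $\square_j$ is the differential operator with constant coefficients corresponding to a polynomial equation of the variety $W$ under the Fourier transform (coordinates on $V$ become derivatives on $V^*$), $L_{e_i}$ is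 the Lie derivative, and $\chi_0(e_i)$ is the trace of the action of $e_i$ on $V$. The same name is used for the corresponding system on the variety of orbits $V^*/G_1$, where $G_1\subset G$ is the Lie group with Lie algebra $\mathrm{Ker}\,\beta$. Holomorphic solutions of the system on an open subset in $V^*$ or in $V^*/G_1$ are called $G$-hypergeometric functions. In the present case $G=GL(n)$ acts on $\mathbb C^A$, identified with the space of homogeneous polynomials $P(a;x)$ of degree $d$, by linear changes of the variables $x$; $V=(\mathbb C^A)^*$; and the vector used to define $W$ is $v=(1,1,\ldots,1)$. *)

(* Defs.v *)
(* The complex numbers are R[i], for an arbitrary R : realType. *)
From HB Require Import structures.
From mathcomp Require Import all_boot all_order all_algebra.
From mathcomp Require Import all_classical all_reals all_analysis.
From mathcomp Require Import complex.
From mathcomp Require Import -(notations) mpoly.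

Set Implicit Arguments.
Unset Strict Implicit.
Unset Printing Implicit Defensive.

Import Order.TTheory GRing.Theory Num.Theory.
Import numFieldNormedType.Exports.

Local Open Scope classical_set_scope.
Local Open Scope ring_scope.
Local Open Scope complex_scope.

(* The library puts a topology on R[i]^o only; let R[i] inherit it. *)
HB.instance Definition _ (R : rcfType) :=
  PseudoPointedMetric.copy (R[i]) (R[i])^o.

Section Hypergeometric.
Context {R : realType} {n N : nat}.
Local Notation C := (R[i]).

(* V = 'cV[C]_N and V^* = 'rV[C]_N, paired by the matrix product; a
   representation of GL(n) on V is given by rho : 'M[C]_n -> 'M[C]_N, of which
   only the values at invertible matrices are meaningful. *)
Implicit Types (rho : 'M[C]_n -> 'M[C]_N) (v : 'cV[C]_N).

Definition is_representation rho : Prop :=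
  [/\ rho 1%:M = 1%:M,
      forall g h, g \in unitmx -> h \in unitmx ->
        rho (g *m h) = rho g *m rho h
    & forall g : 'M[C]_n, g \in unitmx -> differentiable rho g].

Definition lie_action rho (e : 'M[C]_n) : 'M[C]_N := 'D_e rho (1%:M).

Definition orbit rho v : set 'cV[C]_N :=
  [set rho g *m v | g in [set g | g \in unitmx]].

Definition orbit_closure rho v : set 'cV[C]_N := closure (orbit rho v).

Definition hypergeometric_datum rho v : Prop :=
  [/\ is_representation rho,
      exists e, lie_action rho e = 1%:M,
      v != 0
    & finite_set [set orbit rho w | w in orbit_closure rho v]].

Definition lie_character (beta : {scalar 'M[C]_n}) : Prop :=
  forall e f, beta (e *m f - f *m e) = 0.

Definition pderiv (m : multinom N) (phi : 'rV[C]_N -> C^o) :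
    'rV[C]_N -> C^o :=
  foldr (fun (j : 'I_N) psi => iter (m j) (fun chi => 'D_(delta_mx 0 j) chi) psi)
    phi (enum 'I_N).

(* The operator f(d/dw_1, ..., d/dw_N). *)
Definition box (f : mpoly N C) (phi : 'rV[C]_N -> C^o) (w : 'rV[C]_N) : C :=
  \sum_(m <- msupp f) mcoeff m f * pderiv m phi w.

(* Derivative along the vector field w |-> e.w, the dual action of e on V^*
   being w |-> - (w *m lie_action rho e).  Under y_j |-> d/dw_j,
   d/dy_i |-> - w_i the field y |-> e.y on V becomes L_e - chi_0(e). *)
Definition lie_derivative rho (e : 'M[C]_n) (phi : 'rV[C]_N -> C^o)
    (w : 'rV[C]_N) : C :=
  'D_(- (w *m lie_action rho e)) phi w.

(* The equations of W are taken to be all polynomials vanishing on W, and e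
   runs over all of gl(n); the second equation being linear in e, this is the
   same as letting e run over a basis. *)
Definition hypergeometric_system rho v (beta : {scalar 'M[C]_n})
    (U : set 'rV[C]_N) (phi : 'rV[C]_N -> C^o) : Prop :=
  (forall f : mpoly N C,
     (forall y, orbit_closure rho v y -> meval (fun j => y j 0) f = 0) ->
     forall w, U w -> box f phi w = 0) /\
  (forall (e : 'M[C]_n) w, U w ->
     lie_derivative rho e phi w + (beta e - \tr (lie_action rho e)) * phi w = 0).

(* phi is a GL(n)-hypergeometric function on the open subset U of V^*. *)
Definition GL_hypergeometric rho v (U : set 'rV[C]_N)
    (phi : 'rV[C]_N -> C^o) : Prop :=
  [/\ hypergeometric_datum rho v,
      open U,
      forall w, U w -> differentiable phi w
    & exists2 beta : {scalar 'M[C]_n}, lie_character beta &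
        hypergeometric_system rho v beta U phi].

End Hypergeometric.

Section Contours.
Context {R : realType}.
Local Notation C := (R[i]).

Definition cube m : set 'rV[R]_m := [set t | forall j, 0 <= t 0 j <= 1].
Arguments cube : clear implicits.

Fixpoint cube_integral m : ('rV[R]_m -> R) -> R :=
  match m with
  | 0 => fun f => f 0
  | m'.+1 => fun f => \int[@lebesgue_measure R]_(t in `[0%R, 1%R])
                        cube_integral (fun s : 'rV_m' => f (row_mx t%:M s))
  end.

Definition cube_integralC m (f : 'rV[R]_m -> C) : C :=
  cube_integral (fun t => complex.Re (f t)) +i*
  cube_integral (fun t => complex.Im (f t)).

Fixpoint Ck m (k : nat) (f : 'rV[R]_m -> R^o) : Prop :=
  continuous f /\
  match k with
  | 0 => True
  | k'.+1 => forall j : 'I_m, (forall t, derivable f t (delta_mx 0 j)) /\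
                              Ck k' ('D_(delta_mx 0 j) f)
  end.

Definition re_coord m n (s : 'rV[R]_m -> 'rV[C]_n) (i : 'I_n) (t : 'rV[R]_m) :
  R^o := complex.Re (s t 0 i).
Definition im_coord m n (s : 'rV[R]_m -> 'rV[C]_n) (i : 'I_n) (t : 'rV[R]_m) :
  R^o := complex.Im (s t 0 i).

Definition smooth m n (s : 'rV[R]_m -> 'rV[C]_n) : Prop :=
  forall k i, Ck k (re_coord s i) /\ Ck k (im_coord s i).

Section Jacobians.
Context {n : nat} (s : 'rV[R]_n -> 'rV[C]_n) (t : 'rV[R]_n).

Definition re_jacobian : 'M[R]_n :=
  \matrix_(i, j) 'D_(delta_mx 0 j) (re_coord s i) t.
Definition im_jacobian : 'M[R]_n :=
  \matrix_(i, j) 'D_(delta_mx 0 j) (im_coord s i) t.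

(* The pull-back of dx_1 ... dx_n is jac_det dt_1 ... dt_n. *)
Definition jac_det : C :=
  \det (\matrix_(i, j) (re_jacobian i j +i* im_jacobian i j)).

(* Density of the n-dimensional Euclidean volume of C^n = R^(2n). *)
Definition volume_density : R :=
  let D := col_mx re_jacobian im_jacobian in Num.sqrt (\det (D^T *m D)).

End Jacobians.

Definition insert_coord n (i : 'I_n) (b : bool) (u : 'rV[R]_n.-1) : 'rV[R]_n :=
  \row_j (if unlift i j is Some j' then u 0 j' else b%:R).

Definition degenerate m n (tau : 'rV[R]_m -> 'rV[C]_n) : Prop :=
  exists j : 'I_m, forall u u', cube m u -> cube m u' ->
    (forall l, l != j -> u 0 l = u' 0 l) -> tau u = tau u'.

(* Coefficient of the singular (n-1)-cube tau in the boundary of the chain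
   \sum_k (mult k) (cell k).  The (finitely supported) sum runs over the faces
   (k, i, b), t_i = b, of the cells that coincide with tau. *)
Definition boundary_coef n (cell : nat -> 'rV[R]_n -> 'rV[C]_n)
    (mult : nat -> int) (tau : 'rV[R]_n.-1 -> 'rV[C]_n) : int :=
  \sum_(p \in [set p : nat * 'I_n * bool |
                forall u, cube n.-1 u ->
                  cell p.1.1 (insert_coord p.1.2 p.2 u) = tau u])
     (mult p.1.1 * (-1) ^+ (p.1.2 + p.2)%N).

(* An n-dimensional real contour in C^n: a locally finite (so possibly
   infinite, going off to infinity) integral chain of smooth singular n-cubes,
   without boundary modulo degenerate cubes. *)
Record contour n := Contour {
  cell : nat -> 'rV[R]_n -> 'rV[C]_n;
  mult : nat -> int;
  _ : forall k, smooth (cell k);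
  _ : forall r : R, finite_set [set k | mult k != 0 /\
        exists2 t, cube n t & `|cell k t| <= r%:C];
  _ : forall tau, ~ degenerate tau -> boundary_coef cell mult tau = 0
}.

Definition support n (c : contour n) : set 'rV[C]_n :=
  [set x | exists2 k, mult c k != 0 & exists2 t, cube n t & x = cell c k t].

Definition contour_integral n (c : contour n) (f : 'rV[C]_n -> C) : C :=
  limn (series (fun k => (mult c k)%:~R *
    cube_integralC (fun t => f (cell c k t) * jac_det (cell c k) t))).

Definition rapidly_decreasing n (c : contour n) (f : 'rV[C]_n -> C) : Prop :=
  forall p : nat, exists K : R, forall x, support c x ->
    `|x| ^+ p * `|f x| <= K%:C.

(* Absolute convergence of the integral of f over c, with respect to the
   n-dimensional volume of c. *)
Definition absolutely_integrable n (c : contour n) (f : 'rV[C]_n -> C) : Prop :=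
  cvgn (series (fun k => `|mult c k|%:~R *
    cube_integral (fun t => complex.Re `|f (cell c k t)| *
                            volume_density (cell c k) t))).

End Contours.
Arguments contour : clear implicits.

Section ExponentialIntegral.
Context {R : realType} (n d : nat).
Local Notation C := (R[i]).

Definition cexp (z : C) : C :=
  (expR (complex.Re z))%:C * (cos (complex.Im z) +i* sin (complex.Im z)).

Definition exponents : predArgType :=
  {k : bmultinom n d.+1 | mdeg (bmnm k) == d}.
HB.instance Definition _ := Finite.on exponents.

(* C^A is 'rV[C]_#|exponents|, through the enumeration of the exponents. *)
Definition expo (j : 'I_#|exponents|) : multinom n :=
  bmnm (val (enum_val j)).

Definition homogeneous_form (a : 'rV[C]_#|exponents|) (x : 'rV[C]_n) : C :=
  \sum_j a 0 j * \prod_i x 0 i ^+ expo j i.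

(* The row vector a *m subst_mx g lists the coefficients of P(a; g x), with x
   a column; hence g acts on C^A by a |-> a *m subst_mx g^-1, that is by
   P(a; x) |-> P(a; g^-1 x), and on V = (C^A)^* by subst_mx g. *)
Definition subst_mx (g : 'M[C]_n) : 'M[C]_#|exponents| :=
  \matrix_(j, l) mcoeff (expo l)
    (\prod_i (\sum_i' g i i' *: mpolyX C (mnm1 i')) ^+ expo j i).

Definition J (c : contour R n) (a : 'rV[C]_#|exponents|) : C :=
  contour_integral c (fun x => cexp (homogeneous_form a x)).

End ExponentialIntegral.

(* Main.v *)
(** Differentiating under the integral sign, d/da_j inserts the j-th monomial of
    degree d into the integral, so [box f J] is the integral of f evaluated at
    the vector of monomials of x.  That vector lies in W, hence the integral
    vanishes whenever f vanishes on W.  For the other equation, apply Stokes'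
    theorem to the contraction of e^P dx with the linear vector field x |-> e x:
    as the contour has no boundary, (tr e) J + (derivative of J along
    w |-> w rho'(e)) = 0, so beta e = tr rho'(e) - tr e.

    Absolute convergence on an open set improves itself: with M(x) the sum of
    the |x^k|, the function exp(delta M(x)) |e^P(a;x)| is bounded by the sum of
    the |e^P(b;x)| over the finitely many b = a + tau i^u e_j in U.  This
    dominates every polynomial factor and gives quadratic remainder estimates.

    The contour being an infinite chain, Stokes' theorem is applied after
    multiplication by a cutoff in eps |x|^2; only finitely many cells then
    contribute, their faces cancel in classes of faces that agree on the cube,
    and the cutoff costs an error of order eps.  Both the determinants
    defining the integrals and the error terms are bounded by the Euclidean
    volume density, by expanding Gram determinants over minors. *)
From HB Require Import structures.
Require Import Defs.
From mathcomp Require Import all_boot all_order fingroup perm all_algebra.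
From mathcomp Require Import all_classical all_reals all_analysis.
From mathcomp Require Import complex.
From mathcomp Require Import -(notations) mpoly.
From mathcomp Require Import ring lra.
Set Implicit Arguments.
Unset Strict Implicit.
Unset Printing Implicit Defensive.
Import Order.TTheory GRing.Theory Num.Theory.
Import numFieldNormedType.Exports.
Local Open Scope classical_set_scope.
Local Open Scope ring_scope.
Local Open Scope complex_scope.

Section ContinuousMatrices.
Context {R : realType}.

Lemma continuous_mx (X : topologicalType) m n (F : X -> 'M[R]_(m, n)) :
  (forall i j, continuous (fun x => F x i j : R)) -> continuous F.
Proof.
move=> cF x A [P HP PA].
have : \forall y \near x, forall i j, P i j (F y i j).
  apply: filter_forall => i; apply: filter_forall => j.
  exact: (cF i j x _ (HP i j)).
by apply: filterS => y Hy; apply: PA => i j; exact: Hy.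
Qed.

Lemma continuous_const (X : topologicalType) (a : R) : continuous (fun _ : X => a).
Proof. by move=> x; apply: (@cvg_cst R^o). Qed.

Lemma continuous_pairl (X Y : topologicalType) (x : X) :
  continuous (fun y : Y => (x, y)).
Proof.
move=> y; apply: (@cvg_pair _ _ _ (nbhs y) (nbhs x) (nbhs y) _ _ _ (fun=> x) id).
  exact: cvg_cst.
exact: cvg_id.
Qed.

Lemma row_mx0E m (t : R) (s : 'rV[R]_m) :
  (row_mx t%:M s : 'rV[R]_m.+1) 0 ord0 = t.
Proof. by rewrite -[ord0](lshift0 m 0) (@row_mxEl R 1 1 m) mxE eqxx. Qed.

Lemma row_mx_liftE m (t : R) (s : 'rV[R]_m) j :
  (row_mx t%:M s : 'rV[R]_m.+1) 0 (lift ord0 j) = s 0 j.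
Proof. by rewrite -(rshift1 j) (@row_mxEr R 1 1 m). Qed.

Lemma continuous_row_mx m :
  continuous (fun p : R * 'rV[R]_m => row_mx p.1%:M p.2 : 'rV[R]_m.+1).
Proof.
apply: continuous_mx => i j; rewrite ord1.
case: (unliftP ord0 j) => [j'|] ->.
- have -> : (fun x : R * 'rV[R]_m => (row_mx x.1%:M x.2 : 'rV[R]_m.+1) 0 (lift ord0 j'))
      = (fun x => x.2 0 j').
    by apply/funext => x; rewrite row_mx_liftE.
  move=> x; apply: (@continuous_comp _ _ _ snd (fun s : 'rV[R]_m => s 0 j')).
    exact: cvg_snd.
  exact: coord_continuous.
- have -> : (fun x : R * 'rV[R]_m => (row_mx x.1%:M x.2 : 'rV[R]_m.+1) 0 ord0)
      = fst.
    by apply/funext => x; rewrite row_mx0E.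
  by move=> x; exact: cvg_fst.
Qed.

Lemma compact_cube m : compact (@cube R m : set 'rV[R]_m).
Proof.
have -> : (@cube R m : set 'rV[R]_m) =
    [set v | forall i, `[0%R, 1%R]%classic (v ord0 i)].
  by apply/seteqP; split => v /= H i; move: (H i); rewrite /= in_itv.
by apply: (@rV_compact R m (fun=> `[0%R, 1%R]%classic)) => i; exact: segment_compact.
Qed.

Lemma tube (X : topologicalType) m (f : X -> 'rV[R]_m -> R) x0 (e : R) :
  continuous (fun p : X * 'rV[R]_m => f p.1 p.2) -> 0 < e ->
  \forall x \near x0, forall s, cube s -> `|f x s - f x0 s| < e.
Proof.
move=> cf e0; have e2 : 0 < e / 2 by rewrite divr_gt0.
have := (compact_near_coveringP (@cube R m)).1 (@compact_cube m) X (nbhs x0)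
  (fun x s => `|f x s - f x0 s| < e) _.
apply => s _.
have /cvgrPdist_lt H := cf (x0, s).
have {H}[[A B] /= [HA HB] AB] := H (e / 2) e2.
exists (B, A) => //= -[s' x] /= [Bs Ax].
have Ax0 := nbhs_singleton HA.
have h1 := AB (x, s') (conj Ax Bs); have h2 := AB (x0, s') (conj Ax0 Bs).
move: h1 h2 => /= h1 h2.
rewrite (_ : f x s' - f x0 s' = (f x0 s - f x0 s') - (f x0 s - f x s')); last by ring.
by apply: le_lt_trans (ler_normB _ _) _; lra.
Qed.

End ContinuousMatrices.

Section CubeIntegral.
Context {R : realType}.
Local Notation mu := (@lebesgue_measure R).

Lemma cube_row_mx m (t : R) (s : 'rV[R]_m) :
  0 <= t <= 1 -> cube s -> cube (row_mx t%:M s : 'rV[R]_m.+1).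
Proof.
move=> t01 cs j; case: (unliftP ord0 j) => [j'|] ->.
- by rewrite row_mx_liftE.
- by rewrite row_mx0E.
Qed.

Lemma eq_cube_integral m (f g : 'rV[R]_m -> R) :
  (forall t, cube t -> f t = g t) -> cube_integral f = cube_integral g.
Proof.
elim: m f g => [|m IH] f g fg /=; first by apply: fg => -[].
apply: eq_Rintegral => t; rewrite inE /= in_itv /= => t01.
by apply: IH => s cs; apply: fg; exact: cube_row_mx.
Qed.

Lemma integrable01 (f : R -> R) : continuous f ->
  mu.-integrable `[0%R, 1%R] (EFin \o f).
Proof.
move=> cf; apply: continuous_compact_integrable; first exact: segment_compact.
by move=> x; exact: continuous_in_subspaceT.
Qed.

Definition positive_linear m (I : ('rV[R]_m -> R) -> R) :=
  [/\ forall a (f g : 'rV[R]_m -> R), continuous f -> continuous g ->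
        I (fun t => a * f t + g t) = a * I f + I g,
      forall f : 'rV[R]_m -> R, continuous f -> (forall t, cube t -> 0 <= f t) -> 0 <= I f
    & I (cst 1) = 1].

Lemma continuous_linear_comb (X : topologicalType) (f g : X -> R) (a : R) :
  continuous f -> continuous g -> continuous (fun t => a * f t + g t).
Proof.
move=> cf cg x; apply: cvgD; last exact: cg.
by apply: cvgM; [exact: continuous_const|exact: cf].
Qed.

Lemma positive_linear_bound m (I : ('rV[R]_m -> R) -> R) (f g : 'rV[R]_m -> R) (e : R) :
  positive_linear I -> continuous f -> continuous g ->
  (forall t, cube t -> `|f t - g t| <= e) -> `|I f - I g| <= e.
Proof.
move=> [lin pos one] cf cg fg.
have c1 : continuous (cst 1 : 'rV[R]_m -> R) by exact: continuous_const.
have H (f' g' : 'rV[R]_m -> R) : continuous f' -> continuous g' ->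
    (forall t, cube t -> f' t - g' t <= e) -> I f' - I g' <= e.
  move=> cf' cg' h.
  have cd := continuous_linear_comb (a := -1) cf' cg'.
  have := pos _ (continuous_linear_comb (a := e) c1 cd).
  rewrite (lin _ _ _ c1 cd) (lin _ _ _ cf' cg') one => K.
  suff : 0 <= e * 1 + (-1 * I f' + I g') by lra.
  by apply: K => t ct /=; have := h t ct; lra.
have := H f g cf cg; have := H g f cg cf => h1 h2.
rewrite ler_norml; apply/andP; split; last first.
  by apply: h2 => t /fg; rewrite ler_norml => /andP[].
rewrite lerNl opprB; apply: h1 => t /fg.
by rewrite ler_norml => /andP[]; lra.
Qed.

Lemma positive_linear_continuous m (I : ('rV[R]_m -> R) -> R)
    (X : topologicalType) (f : X -> 'rV[R]_m -> R) :
  positive_linear I ->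
  continuous (fun p : X * 'rV[R]_m => f p.1 p.2) -> continuous (fun x => I (f x)).
Proof.
move=> pI cf x0; apply/cvgrPdist_le => e e0.
have cs x : continuous (f x).
  move=> s; apply: (@continuous_comp _ _ _ (fun s : 'rV[R]_m => (x, s)) (fun p : X * 'rV[R]_m => f p.1 p.2)).
    exact: continuous_pairl.
  exact: cf.
have := tube x0 cf e0; apply: filterS => x H.
apply: positive_linear_bound => // s cs'.
by rewrite distrC ltW // H.
Qed.

Lemma slice_continuous m (f : 'rV[R]_m.+1 -> R) : continuous f ->
  continuous (fun p : R * 'rV[R]_m => f (row_mx p.1%:M p.2)).
Proof.
move=> cf p; apply: (@continuous_comp _ _ _ (fun p : R * 'rV[R]_m => row_mx p.1%:M p.2 : 'rV[R]_m.+1) f).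
  exact: continuous_row_mx.
exact: cf.
Qed.

Lemma slice_continuous1 m (f : 'rV[R]_m.+1 -> R) (t : R) : continuous f ->
  continuous (fun s : 'rV[R]_m => f (row_mx t%:M s)).
Proof.
move=> /slice_continuous cf s.
apply: (@continuous_comp _ _ _ (fun s : 'rV[R]_m => (t, s)) (fun p : R * 'rV[R]_m => f (row_mx p.1%:M p.2))).
  exact: continuous_pairl.
exact: cf.
Qed.

Lemma cube_integral_positive_linear m : positive_linear (@cube_integral R m).
Proof.
elim: m => [|m IH]; first by split => //= f _ H; apply: H => -[].
have ci f : continuous f ->
    mu.-integrable `[0%R, 1%R]
      (EFin \o (fun t => cube_integral (fun s : 'rV_m => f (row_mx t%:M s)))).
  move=> cf; apply: integrable01; apply: (positive_linear_continuous IH).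
  exact: slice_continuous.
case: (IH) => lin pos one.
have c0' : continuous (cst 0 : 'rV[R]_m -> R) by exact: continuous_const.
have zero : cube_integral (cst 0 : 'rV[R]_m -> R) = 0.
  have := lin (-1) (cst 0) (cst 0) c0' c0'; rewrite mulN1r addNr => {2}<-.
  by congr cube_integral; apply/funext => s /=; rewrite mulN1r addNr.
split => /=.
- move=> a f g cf cg.
  rewrite -RintegralZl//; last exact: ci.
  rewrite -RintegralD//; last 2 first.
  + have c0 : continuous (cst 0 : 'rV[R]_m.+1 -> R) by exact: continuous_const.
    have := continuous_linear_comb (a := a) cf c0 => /ci.
    congr (mu.-integrable _ (_ \o _)).
    apply/funext => t.
    have := lin a (fun s => f (row_mx t%:M s)) (cst 0) (slice_continuous1 cf) c0'.
    by rewrite zero addr0.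
  + exact: ci.
  apply: eq_Rintegral => t _; rewrite lin //; exact: slice_continuous1.
- move=> f cf f0; apply: Rintegral_ge0 => t; rewrite /= in_itv /= => t01.
  apply: pos; first exact: slice_continuous1.
  by move=> s cs; apply: f0; exact: cube_row_mx.
- rewrite (_ : (fun t => _) = cst 1) ?Rintegral_cst//=; last first.
    by apply/funext => t; exact: one.
  by rewrite mul1r lebesgue_measure_itv /= lte_fin ltr01 /= subr0.
Qed.

End CubeIntegral.


Lemma is_derive_line {K : numFieldType} {V W : normedModType K} (g : V -> W)
    t v (h : K) l :
  is_derive (t + h *: v) v g l -> is_derive h (1 : K^o) (fun k : K^o => g (t + k *: v)) l.
Proof.
move=> [dg eg]; have E : (fun k : K => k^-1 *: (g (t + (k *: (1 : K^o) + h) *: v) - g (t + h *: v)))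
   = (fun k : K => k^-1 *: (g (k *: v + (t + h *: v)) - g (t + h *: v))).
  apply/funext => k; congr (_ *: (g _ - _)).
  rewrite (_ : k *: (1 : K^o) = k) ?scalerDl 1?addrCA //.
  by rewrite /GRing.scale /= mulr1.
split; first by rewrite /derivable /= E.
by rewrite /derive /= E.
Qed.

Lemma is_derive_line0 {K : numFieldType} {V W : normedModType K} (f : V -> W) t v l :
  is_derive (0 : K) (1 : K^o) (fun k : K^o => f (t + k *: v)) l -> is_derive t v f l.
Proof.
move=> [dg eg]; have E : (fun k : K => k^-1 *: (f (t + (k *: (1 : K^o) + 0) *: v) - f (t + (0 : K) *: v)))
   = (fun k : K => k^-1 *: (f (k *: v + t) - f t)).
  apply/funext => k; rewrite (_ : k *: (1 : K^o) = k).
    by rewrite addr0 scale0r addr0 (addrC t).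
  by rewrite /GRing.scale /= mulr1.
split; first by move: dg; rewrite /derivable /= E.
by move: eg; rewrite /derive /= E.
Qed.

Section CubeFTC.
Context {R : realType}.
Local Notation mu := (@lebesgue_measure R).

Definition has_partial m (j : 'I_m) (g g' : 'rV[R]_m -> R) : Prop :=
  [/\ continuous g, continuous g' &
      forall t, is_derive t (delta_mx 0 j) (g : 'rV[R]_m -> R^o) (g' t)].

Lemma positive_linear0 m (I : ('rV[R]_m -> R) -> R) :
  positive_linear I -> I (cst 0) = 0.
Proof.
move=> [lin _ _].
have c0 : continuous (cst 0 : 'rV[R]_m -> R) by exact: continuous_const.
have E : (fun t : 'rV[R]_m => -1 * cst 0 t + cst 0 t) = cst 0 :> ('rV[R]_m -> R).
  by apply/funext => t /=; rewrite mulN1r addNr.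
by have := lin (-1) _ _ c0 c0; rewrite E mulN1r addNr.
Qed.

Lemma MVT_centered (G G' : R -> R) (h : R) :
  (forall k : R, is_derive k (1 : R^o) (G : R^o -> R^o) (G' k)) ->
  exists2 c : R, `|c| <= `|h| & G h - G 0 = h * G' c.
Proof.
move=> dG.
have cG (A : set R) : {within A, continuous G}.
  apply: continuous_subspaceT => x; apply: differentiable_continuous.
  by apply/derivable1_diffP; have [] := dG x.
case: (leP 0 h) => h0.
- have [c] := MVT_segment h0 (fun x _ => dG x) (cG _).
  rewrite in_itv /= => /andP[c0 ch] ->; exists c.
    by rewrite !ger0_norm.
  by rewrite subr0 mulrC.
- have [c] := MVT_segment (ltW h0) (fun x _ => dG x) (cG _).
  rewrite in_itv /= => /andP[hc c0] E; exists c.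
    by rewrite (ler0_norm c0) (ler0_norm (ltW h0)) lerN2.
  by rewrite -[LHS]opprB E sub0r mulrN opprK mulrC.
Qed.

Lemma MVT_line m (g g' : 'rV[R]_m -> R) j t (h : R) : has_partial j g g' ->
  exists2 c : R, `|c| <= `|h| &
    g (t + h *: delta_mx 0 j) - g t = h * g' (t + c *: delta_mx 0 j).
Proof.
move=> [cg _ dg].
have [c ch E] := MVT_centered h
  (fun k => is_derive_line (dg (t + k *: delta_mx 0 j))).
by exists c => //; rewrite -E scale0r addr0.
Qed.

Lemma cube_integral_derive m (g g' : 'rV[R]_m.+1 -> R) (t0 : R) :
  has_partial 0 g g' ->
  is_derive t0 (1 : R^o)
    (fun t : R^o => cube_integral (fun s : 'rV_m => g (row_mx t%:M s)) : R^o)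
    (cube_integral (fun s : 'rV_m => g' (row_mx t0%:M s))).
Proof.
move=> hg; have [cg cg' dg] := hg.
have PI := @cube_integral_positive_linear R m; have [lin _ _] := PI.
set G := fun t : R^o => _; set l := cube_integral _.
have key : forall e : R, 0 < e -> \forall h \near (0 : R),
    `|G (t0 + h) - G t0 - h * l| <= `|h| * e.
  move=> e e0.
  have T := @tube R R m (fun t s => g' (row_mx t%:M s)) t0 e (slice_continuous cg') e0.
  have [d /= d0 Hd] := T.
  exists d => //= h; rewrite /ball_ /= sub0r normrN => hd.
  have c1 t := @slice_continuous1 R m g t cg.
  have c2 := @slice_continuous1 R m g' t0 cg'.
  have c0 : continuous (cst 0 : 'rV[R]_m -> R) by exact: continuous_const.
  have E1 : G (t0 + h) - G t0 = cube_integral (fun s : 'rV_m =>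
       -1 * g (row_mx t0%:M s) + g (row_mx (t0 + h)%:M s)).
    by rewrite (lin (-1) _ _ (c1 t0) (c1 (t0 + h))) mulN1r addrC.
  have E2 : h * l = cube_integral (fun s : 'rV_m =>
       h * g' (row_mx t0%:M s) + (cst 0 : 'rV[R]_m -> R) s).
    by rewrite (lin h _ _ c2 c0) (positive_linear0 PI) addr0.
  rewrite E1 E2; apply: positive_linear_bound => //.
  - exact: (continuous_linear_comb (a := -1) (c1 t0) (c1 (t0 + h))).
  - exact: (continuous_linear_comb (a := h) c2 c0).
  move=> s cs.
  have [c ch] := MVT_line (row_mx t0%:M s) h hg.
  have shift k : row_mx t0%:M s + k *: delta_mx 0 0 = row_mx (t0 + k)%:M s :> 'rV[R]_m.+1.
    apply/rowP => j; rewrite [LHS]mxE [X in _ + X]mxE [delta_mx _ _ _ _]mxE.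
    case: (unliftP ord0 j) => [j'|] ->.
      by rewrite !row_mx_liftE mulr0 addr0.
    by rewrite !row_mx0E mulr1.
  rewrite !shift => Ec; rewrite mulN1r /= addr0 [X in X - _]addrC Ec -mulrBr normrM.
  by rewrite ler_wpM2l // ltW // Hd //= opprD addNKr normrN (le_lt_trans ch).
suff H : (fun k : R => k^-1 *: (G (k *: (1 : R^o) + t0) - G t0)) @ 0^' --> l.
  split; first by apply/cvg_ex; exists l.
  exact: cvg_lim H.
apply/cvgrPdist_le => e e0; near=> k.
have k0 : k != 0 by near: k; exact: nbhs_dnbhs_neq.
have K : `|G (t0 + k) - G t0 - k * l| <= `|k| * e.
  by near: k; apply: nbhs_dnbhs; exact: key.
have -> : k *: (1 : R^o) + t0 = t0 + k by rewrite /GRing.scale /= mulr1 addrC.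
have kn : 0 < `|k| by rewrite normr_gt0.
rewrite distrC -(ler_pM2l kn).
rewrite -normrM mulrBr /GRing.scale /= mulVKf //.
Unshelve. all: by end_near. Qed.


Lemma insert_coord_continuous n (i : 'I_n) b :
  continuous (insert_coord i b : 'rV[R]_n.-1 -> 'rV[R]_n).
Proof.
apply: continuous_mx => a j; rewrite /insert_coord.
rewrite (_ : (fun _ => _) = fun u : 'rV[R]_n.-1 =>
  if unlift i j is Some j' then u 0 j' else b%:R); last first.
  by apply/funext => u; rewrite mxE.
case: (unlift i j) => [j'|]; last exact: continuous_const.
exact: coord_continuous.
Qed.

Lemma insert_coord_liftE n (i : 'I_n) b (u : 'rV[R]_n.-1) k :
  insert_coord i b u 0 (lift i k) = u 0 k.
Proof. by rewrite mxE liftK. Qed.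

Lemma insert_coordE n (i : 'I_n) b (u : 'rV[R]_n.-1) :
  insert_coord i b u 0 i = b%:R.
Proof. by rewrite mxE unlift_none. Qed.

Lemma insert_coord0 m b (u : 'rV[R]_m) :
  @insert_coord R m.+1 ord0 b u = row_mx b%:R%:M u.
Proof.
apply/rowP => j; case: (unliftP ord0 j) => [k|] ->.
  by rewrite row_mx_liftE (@insert_coord_liftE m.+1).
by rewrite row_mx0E insert_coordE.
Qed.

Lemma insert_coord_lift m (j : 'I_m.+1) b (t : R) (u : 'rV[R]_m) :
  @insert_coord R m.+2 (lift ord0 j) b (row_mx t%:M u) =
  row_mx t%:M (@insert_coord R m.+1 j b u).
Proof.
apply/rowP => k; case: (unliftP (lift ord0 j) k) => [l|] ->; last first.
  by rewrite insert_coordE row_mx_liftE insert_coordE.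
rewrite (@insert_coord_liftE m.+2); case: (unliftP ord0 l) => [a|] ->.
- have -> : lift (lift ord0 j) (lift ord0 a) = lift ord0 (lift j a).
    by apply: val_inj; rewrite /= /bump /= !add1n ltnS; case: leqP.
  by rewrite !row_mx_liftE (@insert_coord_liftE m.+1).
- have -> : lift (lift ord0 j) ord0 = ord0 by apply: val_inj.
  by rewrite !row_mx0E.
Qed.

Lemma cube_insert_coord n (i : 'I_n) b (u : 'rV[R]_n.-1) :
  cube u -> cube (insert_coord i b u).
Proof.
move=> cu j; rewrite mxE; case: (unlift i j) => [k|]; first exact: cu.
by case: b; rewrite ?lexx ?ler01.
Qed.

Lemma has_partial_slice m (j : 'I_m) (g g' : 'rV[R]_m.+1 -> R) (t : R) :
  has_partial (lift ord0 j) g g' ->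
  has_partial j (fun s => g (row_mx t%:M s)) (fun s => g' (row_mx t%:M s)).
Proof.
move=> [cg cg' dg]; split; [exact: slice_continuous1|exact: slice_continuous1|].
move=> s; have [D E] := dg (row_mx t%:M s).
have shift k : k *: delta_mx 0 (lift ord0 j) + row_mx t%:M s
    = row_mx t%:M (k *: delta_mx 0 j + s) :> 'rV[R]_m.+1.
  apply/rowP => l; rewrite [LHS]mxE [X in X + _]mxE [delta_mx _ _ _ _]mxE.
  case: (unliftP ord0 l) => [k'|] ->.
    rewrite !row_mx_liftE [RHS]mxE [X in _ = X + _]mxE [delta_mx _ _ _ _]mxE.
    by rewrite (inj_eq lift_inj).
  by rewrite !row_mx0E mulr0 add0r.
have EQ : (fun k : R => k^-1 *: (g (k *: delta_mx 0 (lift ord0 j) + row_mx t%:M s) - g (row_mx t%:M s)))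
   = (fun k : R => k^-1 *: (g (row_mx t%:M (k *: delta_mx 0 j + s)) - g (row_mx t%:M s))).
  by apply/funext => k; rewrite shift.
split; first by move: D; rewrite /derivable /= EQ.
by move: E; rewrite /derive /= EQ.
Qed.

Lemma cube_integralS m (f : 'rV[R]_m.+1 -> R) :
  cube_integral f = \int[mu]_(t in `[0%R, 1%R])
    cube_integral (fun s : 'rV_m => f (row_mx t%:M s)).
Proof. by []. Qed.

Lemma cube_integral_FTC0 m (g g' : 'rV[R]_m.+1 -> R) :
  has_partial ord0 g g' ->
  cube_integral g' =
  cube_integral (fun u => g (@insert_coord R m.+1 ord0 true u)) -
  cube_integral (fun u => g (@insert_coord R m.+1 ord0 false u)).
Proof.
move=> hg; have [cg cg' dg] := hg.
have PI := @cube_integral_positive_linear R m.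
pose G (t : R) : R := cube_integral (fun s : 'rV_m => g (row_mx t%:M s)).
have dG t := cube_integral_derive t hg.
have GE b : cube_integral (fun u => g (@insert_coord R m.+1 ord0 b u)) = G b%:R.
  by apply: eq_cube_integral => u _; rewrite insert_coord0.
have cL : continuous (fun t : R => cube_integral (fun s : 'rV_m => g' (row_mx t%:M s))).
  exact: (positive_linear_continuous PI (slice_continuous cg')).
have cG : continuous G.
  exact: (positive_linear_continuous PI (slice_continuous cg)).
rewrite !GE /= /Rintegral (@continuous_FTC2 _ _ G) //.
- by apply: continuous_subspaceT.
- split.
  + by move=> t _; have [] := dG t.
  + exact/cvg_at_right_filter/cG.
  + exact/cvg_at_left_filter/cG.
- by move=> t _; rewrite derive1E; have [] := dG t.
Qed.

Lemma cube_integral_FTC m (j : 'I_m.+1) (g g' : 'rV[R]_m.+1 -> R) :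
  has_partial j g g' ->
  cube_integral g' =
  cube_integral (fun u => g (@insert_coord R m.+1 j true u)) -
  cube_integral (fun u => g (@insert_coord R m.+1 j false u)).
Proof.
elim: m j g g' => [|m IH] j g g' hg; case: (unliftP ord0 j) => [j'|] Ej; subst j.
- by case: j' hg.
- exact: cube_integral_FTC0.
- have [cg cg' dg] := hg.
  have [lin _ _] := @cube_integral_positive_linear R m.+1.
  have [lin' _ _] := @cube_integral_positive_linear R m.
  have ci b : continuous (fun u => g (@insert_coord R m.+2 (lift ord0 j') b u)).
    move=> u; apply: (@continuous_comp _ _ _ (@insert_coord R m.+2 (lift ord0 j') b) g).
      exact: insert_coord_continuous.
    exact: cg.
  rewrite [RHS]addrC -mulN1r -(lin _ _ _ (ci false) (ci true)).
  rewrite [LHS]cube_integralS [RHS]cube_integralS.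
  apply: eq_Rintegral => t _; rewrite (IH _ _ _ (has_partial_slice t hg)).
  have cs b : continuous (fun u : 'rV[R]_m =>
      g (row_mx t%:M (@insert_coord R m.+1 j' b u))).
    have := slice_continuous1 (t := t) (ci b).
    by under eq_fun do rewrite insert_coord_lift.
  rewrite [LHS]addrC -[X in X + _]mulN1r -(lin' _ _ _ (cs false) (cs true)).
  by apply: eq_cube_integral => u _; rewrite !insert_coord_lift.
- exact: cube_integral_FTC0.
Qed.
End CubeFTC.


Section ComplexModulus.
Context {R : realType}.
Local Notation C := R[i].
Implicit Types (z w : C).

Definition cabs z : R := complex.Re `|z|.

Lemma cabsE z : `|z| = (cabs z)%:C.
Proof. by rewrite /cabs normc_def. Qed.

Lemma cabs_def z : cabs z = Num.sqrt (complex.Re z ^+ 2 + complex.Im z ^+ 2).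
Proof. by rewrite /cabs normc_def. Qed.

Lemma cabs_ge0 z : 0 <= cabs z.
Proof. by rewrite cabs_def sqrtr_ge0. Qed.

Lemma cabsM z w : cabs (z * w) = cabs z * cabs w.
Proof. by apply: complexI; rewrite rmorphM /= -!cabsE normrM. Qed.

Lemma cabsD z w : cabs (z + w) <= cabs z + cabs w.
Proof. by rewrite -lecR rmorphD /= -!cabsE ler_normD. Qed.

Lemma cabsN z : cabs (- z) = cabs z.
Proof. by apply: complexI; rewrite -!cabsE normrN. Qed.

Lemma cabsX z k : cabs (z ^+ k) = cabs z ^+ k.
Proof. by apply: complexI; rewrite rmorphXn /= -!cabsE normrX. Qed.

Lemma cabsR (x : R) : cabs x%:C = `|x|.
Proof. by rewrite cabs_def /= expr0n /= addr0 sqrtr_sqr. Qed.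

Lemma cabs0 : cabs 0 = 0.
Proof. by apply: complexI; rewrite -cabsE normr0. Qed.

Lemma cabs1 : cabs 1 = 1.
Proof. by apply: complexI; rewrite -cabsE normr1. Qed.

Lemma cabs_eq0 z : cabs z = 0 -> z = 0.
Proof. by move=> h; apply/eqP; rewrite -normr_eq0 cabsE h. Qed.

Lemma cabs_sum I (r : seq I) (P : pred I) (F : I -> C) :
  cabs (\sum_(i <- r | P i) F i) <= \sum_(i <- r | P i) cabs (F i).
Proof.
elim/big_rec2: _ => [|i y x _ h]; first by rewrite cabs0.
by rewrite (le_trans (cabsD _ _)) // lerD2l.
Qed.

Lemma cabs_prod I (r : seq I) (P : pred I) (F : I -> C) :
  cabs (\prod_(i <- r | P i) F i) = \prod_(i <- r | P i) cabs (F i).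
Proof. by elim/big_rec2: _ => [|i y x _ <-]; rewrite ?cabs1 ?cabsM. Qed.

Lemma ler_Re_cabs z : `|complex.Re z| <= cabs z.
Proof. by rewrite -lecR -cabsE normc_ge_Re. Qed.

Lemma ler_Im_cabs z : `|complex.Im z| <= cabs z.
Proof.
rewrite cabs_def -sqrtr_sqr ler_wsqrtr // lerDr; exact: sqr_ge0.
Qed.

Lemma cabs_le_ReIm z : cabs z <= `|complex.Re z| + `|complex.Im z|.
Proof.
have -> : z = (complex.Re z)%:C + (0 +i* 1) * (complex.Im z)%:C.
  by case: z => a b; apply/eqP; rewrite eq_complex /=; apply/andP; split; apply/eqP; ring.
apply: (le_trans (cabsD _ _)); rewrite cabsM !cabsR.
rewrite [X in _ + X * _]cabs_def /= expr0n expr1n add0r sqrtr1 mul1r.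
by case: z => a b /=; rewrite !(mul0r,mul1r,addr0,add0r,mulr0,subr0,oppr0).
Qed.

Lemma ReD z w : complex.Re (z + w) = complex.Re z + complex.Re w.
Proof. by case: z; case: w. Qed.

Lemma ImD z w : complex.Im (z + w) = complex.Im z + complex.Im w.
Proof. by case: z; case: w. Qed.

Lemma ReM z w : complex.Re (z * w) =
  complex.Re z * complex.Re w - complex.Im z * complex.Im w.
Proof. by case: z; case: w. Qed.

Lemma ImM z w : complex.Im (z * w) =
  complex.Re z * complex.Im w + complex.Im z * complex.Re w.
Proof. by case: z; case: w. Qed.

Lemma ReN z : complex.Re (- z) = - complex.Re z.
Proof. by case: z. Qed.

Lemma ImN z : complex.Im (- z) = - complex.Im z.
Proof. by case: z. Qed.

Lemma eq_ReIm z w : complex.Re z = complex.Re w -> complex.Im z = complex.Im w -> z = w.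
Proof. by move=> h1 h2; apply/eqP; rewrite eq_complex h1 h2 !eqxx. Qed.


End ComplexModulus.

Section ComplexContinuity.
Context {R : realType} {X : topologicalType}.
Local Notation C := R[i].
Implicit Types (f g : X -> C).

Definition ccont f : Prop :=
  continuous (fun x => complex.Re (f x) : R) /\
  continuous (fun x => complex.Im (f x) : R).

Lemma continuous_mul (f g : X -> R) :
  continuous f -> continuous g -> continuous (fun x => f x * g x).
Proof. by move=> cf cg x; apply: cvgM; [exact: cf|exact: cg]. Qed.

Lemma continuous_add (f g : X -> R) :
  continuous f -> continuous g -> continuous (fun x => f x + g x).
Proof. by move=> cf cg x; apply: cvgD; [exact: cf|exact: cg]. Qed.

Lemma continuous_opp (f : X -> R) : continuous f -> continuous (fun x => - f x).
Proof. by move=> cf x; apply: cvgN; exact: cf. Qed.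

Lemma continuous_sum I (r : seq I) (P : pred I) (F : I -> X -> R) :
  (forall i, continuous (F i)) -> continuous (fun x => \sum_(i <- r | P i) F i x).
Proof.
move=> h; elim: r => [|i r IH].
  by under eq_fun do rewrite big_nil; exact: continuous_const.
under eq_fun do rewrite big_cons; case: (P i) => //.
exact: continuous_add.
Qed.

Lemma continuous_prod I (r : seq I) (P : pred I) (F : I -> X -> R) :
  (forall i, continuous (F i)) -> continuous (fun x => \prod_(i <- r | P i) F i x).
Proof.
move=> h; elim: r => [|i r IH].
  by under eq_fun do rewrite big_nil; exact: continuous_const.
under eq_fun do rewrite big_cons; case: (P i) => //.
exact: continuous_mul.
Qed.

Lemma ccont_const (c : C) : ccont (fun _ : X => c).
Proof. by split; exact: continuous_const. Qed.

Lemma ccontD f g : ccont f -> ccont g -> ccont (fun x => f x + g x).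
Proof.
move=> [f1 f2] [g1 g2]; split.
  by under eq_fun do rewrite ReD; exact: continuous_add.
by under eq_fun do rewrite ImD; exact: continuous_add.
Qed.

Lemma ccontN f : ccont f -> ccont (fun x => - f x).
Proof.
move=> [f1 f2]; split.
  by under eq_fun do rewrite ReN; exact: continuous_opp.
by under eq_fun do rewrite ImN; exact: continuous_opp.
Qed.

Lemma ccontM f g : ccont f -> ccont g -> ccont (fun x => f x * g x).
Proof.
move=> [f1 f2] [g1 g2]; split.
  under eq_fun do rewrite ReM.
  by apply: continuous_add; [|apply: continuous_opp]; exact: continuous_mul.
under eq_fun do rewrite ImM.
by apply: continuous_add; exact: continuous_mul.
Qed.

Lemma ccont_sum I (r : seq I) (P : pred I) (F : I -> X -> C) :
  (forall i, ccont (F i)) -> ccont (fun x => \sum_(i <- r | P i) F i x).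
Proof.
move=> h; elim: r => [|i r IH].
  by under eq_fun do rewrite big_nil; exact: ccont_const.
under eq_fun do rewrite big_cons; case: (P i) => //.
exact: ccontD.
Qed.

Lemma ccont_prod I (r : seq I) (P : pred I) (F : I -> X -> C) :
  (forall i, ccont (F i)) -> ccont (fun x => \prod_(i <- r | P i) F i x).
Proof.
move=> h; elim: r => [|i r IH].
  by under eq_fun do rewrite big_nil; exact: ccont_const.
under eq_fun do rewrite big_cons; case: (P i) => //.
exact: ccontM.
Qed.

Lemma ccontX f k : ccont f -> ccont (fun x => f x ^+ k).
Proof.
move=> cf; elim: k => [|k IH]; first exact: ccont_const.
by under eq_fun do rewrite exprS; exact: ccontM.
Qed.

Lemma ccontR (f : X -> R) : continuous f -> ccont (fun x => (f x)%:C).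
Proof. by move=> cf; split => //=; exact: continuous_const. Qed.

Lemma continuous_sqrt (f : X -> R) :
  continuous f -> continuous (fun x => Num.sqrt (f x)).
Proof.
move=> cf x; apply: (@continuous_comp _ _ _ f Num.sqrt); first exact: cf.
exact: sqrt_continuous.
Qed.

Lemma ccont_cabs f : ccont f -> continuous (fun x => cabs (f x)).
Proof.
move=> [f1 f2]; under eq_fun do rewrite cabs_def !expr2.
by apply: continuous_sqrt; apply: continuous_add; exact: continuous_mul.
Qed.

Lemma ccont_cexp f : ccont f -> ccont (fun x => cexp (f x)).
Proof.
move=> [f1 f2]; rewrite /cexp; apply: ccontM.
  apply: ccontR => x.
  by apply: (@continuous_comp _ _ _ (fun x => complex.Re (f x) : R) expR); [exact: f1|exact: continuous_expR].
split => /= x.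
  by apply: (@continuous_comp _ _ _ (fun x => complex.Im (f x) : R) cos); [exact: f2|exact: continuous_cos].
by apply: (@continuous_comp _ _ _ (fun x => complex.Im (f x) : R) sin); [exact: f2|exact: continuous_sin].
Qed.

Lemma ccont_det n (A : X -> 'M[C]_n) :
  (forall i j, ccont (fun x => A x i j)) -> ccont (fun x => \det (A x)).
Proof.
move=> h; apply: ccont_sum => s; apply: ccontM; first exact: ccont_const.
by apply: ccont_prod => i.
Qed.

Lemma continuous_det n (A : X -> 'M[R]_n) :
  (forall i j, continuous (fun x => A x i j)) -> continuous (fun x => \det (A x)).
Proof.
move=> h; apply: continuous_sum => s; apply: continuous_mul; first exact: continuous_const.
by apply: continuous_prod => i.
Qed.

End ComplexContinuity.

Section ComplexExponential.
Context {R : realType}.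
Local Notation C := R[i].

Lemma cexpD (z w : C) : cexp (z + w) = cexp z * cexp w.
Proof.
case: z => a b; case: w => c e; rewrite /cexp /= expRD cosD sinD.
by apply: eq_ReIm => /=; ring.
Qed.

Lemma cabs_cexp (z : C) : cabs (cexp z) = expR (complex.Re z).
Proof.
rewrite /cexp cabsM cabsR gtr0_norm ?expR_gt0 // cabs_def /=.
by rewrite cos2Dsin2 sqrtr1 mulr1.
Qed.

End ComplexExponential.


Section PartialDerivatives.
Context {R : realType} {m : nat}.
Local Notation C := R[i].
Implicit Types (j : 'I_m) (f g : 'rV[R]_m -> R).

Lemma has_partial_const j (c : R) : has_partial j (fun _ => c) (fun _ => 0).
Proof.
split; [exact: continuous_const|exact: continuous_const|move=> t].
exact: is_derive_cst.
Qed.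

Lemma has_partialD j f g f' g' : has_partial j f f' -> has_partial j g g' ->
  has_partial j (fun t => f t + g t) (fun t => f' t + g' t).
Proof.
move=> [cf cf' df] [cg cg' dg]; split; [exact: continuous_add|exact: continuous_add|].
by move=> t; have := is_deriveD (df t) (dg t).
Qed.

Lemma has_partialN j f f' : has_partial j f f' ->
  has_partial j (fun t => - f t) (fun t => - f' t).
Proof.
move=> [cf cf' df]; split; [exact: continuous_opp|exact: continuous_opp|].
by move=> t; have := is_deriveN (df t).
Qed.

Lemma has_partialM j f g f' g' : has_partial j f f' -> has_partial j g g' ->
  has_partial j (fun t => f t * g t) (fun t => f' t * g t + f t * g' t).
Proof.
move=> [cf cf' df] [cg cg' dg]; split; first exact: continuous_mul.
  by apply: continuous_add; exact: continuous_mul.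
move=> t; have := is_deriveM (df t) (dg t).
by rewrite /GRing.scale /= addrC (mulrC (g t)).
Qed.

Lemma has_partial_comp j f f' (phi phi' : R -> R) :
  continuous phi' ->
  (forall x, is_derive x (1 : R^o) (phi : R^o -> R^o) (phi' x)) ->
  has_partial j f f' ->
  has_partial j (fun t => phi (f t)) (fun t => phi' (f t) * f' t).
Proof.
move=> cphi' dphi [cf cf' df].
have cphi : continuous phi.
  move=> x; apply: differentiable_continuous; apply/derivable1_diffP.
  by have [] := dphi x.
split.
- by move=> t; apply: (@continuous_comp _ _ _ f phi); [exact: cf|exact: cphi].
- apply: continuous_mul => // t.
  by apply: (@continuous_comp _ _ _ f phi'); [exact: cf|exact: cphi'].
move=> t; apply: is_derive_line0.
have d0 : is_derive (0 : R) (1 : R^o) (fun k : R^o => f (t + k *: delta_mx 0 j) : R^o) (f' t).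
  apply: is_derive_line; rewrite scale0r addr0; exact: df.
have d1 := dphi (f (t + (0 : R) *: delta_mx 0 j)).
have := is_derive1_comp d1 d0.
by rewrite scale0r addr0 mulrC.
Qed.

Lemma has_partial_shift j f f' (v : 'rV[R]_m) : has_partial j f f' ->
  has_partial j (fun t => f (t + v)) (fun t => f' (t + v)).
Proof.
move=> [cf cf' df].
have cs : continuous (fun t : 'rV[R]_m => t + v).
  apply: continuous_mx => i k.
  under eq_fun do rewrite mxE.
  by apply: continuous_add; [exact: coord_continuous|exact: continuous_const].
split.
- by move=> t; apply: (@continuous_comp _ _ _ (fun t : 'rV[R]_m => t + v) f); [exact: cs|exact: cf].
- by move=> t; apply: (@continuous_comp _ _ _ (fun t : 'rV[R]_m => t + v) f'); [exact: cs|exact: cf'].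
move=> t; have [D E] := df (t + v); split.
  by move: D; rewrite /derivable /=; under eq_fun do rewrite addrA.
by move: E; rewrite /derive /=; under eq_fun do rewrite addrA.
Qed.

Lemma mixed_difference j l f fj fjl t (h : R) :
  has_partial j f fj -> has_partial l fj fjl ->
  exists p : R * R, [/\ `|p.1| <= `|h|, `|p.2| <= `|h| &
    f (t + h *: delta_mx 0 j + h *: delta_mx 0 l) - f (t + h *: delta_mx 0 j)
      - (f (t + h *: delta_mx 0 l) - f t)
    = h * (h * fjl (t + p.1 *: delta_mx 0 j + p.2 *: delta_mx 0 l))].
Proof.
move=> hf hfj.
have h1 := has_partialD (has_partial_shift (h *: delta_mx 0 l) hf) (has_partialN hf).
have [c ch Ec] := MVT_line t h h1.
have [c' ch' Ec'] := MVT_line (t + c *: delta_mx 0 j) h hfj.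
by exists (c, c'); split => //; rewrite -Ec' Ec.
Qed.

Lemma schwarz j l f fj fl fjl flj :
  has_partial j f fj -> has_partial l fj fjl ->
  has_partial l f fl -> has_partial j fl flj -> fjl =1 flj.
Proof.
move=> hj hjl hl hlj t; apply/eqP; rewrite eq_le; apply/andP.
suff H (u v : 'rV[R]_m -> R) (a b a' b' : 'rV[R]_m) : continuous u -> continuous v ->
    (forall h : R, h != 0 -> exists p : R * R, exists q : R * R,
       [/\ `|p.1| <= `|h|, `|p.2| <= `|h|, `|q.1| <= `|h|, `|q.2| <= `|h| &
         u (t + p.1 *: a + p.2 *: b) = v (t + q.1 *: a' + q.2 *: b')]) ->
    u t <= v t.
  have K (h : R) : h != 0 -> exists p : R * R, exists q : R * R,
       [/\ `|p.1| <= `|h|, `|p.2| <= `|h|, `|q.1| <= `|h|, `|q.2| <= `|h| &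
         fjl (t + p.1 *: delta_mx 0 j + p.2 *: delta_mx 0 l) =
         flj (t + q.1 *: delta_mx 0 l + q.2 *: delta_mx 0 j)].
    move=> h0; have [p [p1 p2 Ep]] := mixed_difference t h hj hjl.
    have [q [q1 q2 Eq]] := mixed_difference t h hl hlj.
    exists p, q; split => //; apply: (mulfI h0); apply: (mulfI h0).
    by rewrite -Ep -Eq -!(addrA t) (addrC (h *: delta_mx 0 j)); ring.
  have [_ c1 _] := hjl; have [_ c2 _] := hlj.
  split; first exact: (H _ _ _ _ _ _ c1 c2 K).
  apply: (H _ _ _ _ _ _ c2 c1) => h /K[p [q [? ? ? ? E]]]; exists q, p; split => //; exact: esym E.
move=> cu cv HH; apply/ler_addgt0Pr => e e0.
have lim (w : 'rV[R]_m -> R) c d : continuous w ->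
    \forall h \near (0 : R), forall x y : R, `|x| <= `|h| -> `|y| <= `|h| ->
      `|w (t + x *: c + y *: d) - w t| <= e / 2.
  move=> cw.
  have cq : continuous (fun p : R * R => w (t + p.1 *: c + p.2 *: d)).
    move=> p; apply: (@continuous_comp _ _ _ (fun p : R * R => t + p.1 *: c + p.2 *: d) w); last exact: cw.
    apply: continuous_mx => i k {}p.
    have -> : (fun x : R * R => (t + x.1 *: c + x.2 *: d) i k) =
              (fun x => t i k + x.1 * c i k + x.2 * d i k).
      by apply/funext => x; rewrite !mxE.
    apply: continuous_add; last by apply: continuous_mul; [move=> x; exact: cvg_snd|exact: continuous_const].
    apply: continuous_add; first exact: continuous_const.
    by apply: continuous_mul; [move=> x; exact: cvg_fst|exact: continuous_const].
  have e2 : 0 < e / 2 by rewrite divr_gt0.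
  have /cvgrPdist_le/(_ _ e2) := cq (0, 0).
  rewrite /= !scale0r !addr0 => -[[A B]] /= [[r1 /= a0 Ha] [r2 /= b0 Hb]] AB.
  exists (Num.min r1 r2); first by rewrite /= lt_min a0.
  move=> h; rewrite /ball_ /= sub0r normrN lt_min => /andP[ha hb] x y xh yh.
  rewrite distrC; apply: (AB (x, y)); split => /=.
    by apply: Ha; rewrite /ball_ /= sub0r normrN (le_lt_trans xh).
  by apply: Hb; rewrite /ball_ /= sub0r normrN (le_lt_trans yh).
have L1 := lim u a b cu; have L2 := lim v a' b' cv.
have : \forall h \near (0 : R)^', u t <= v t + e.
  near=> h.
  have h0 : h != 0 by near: h; exact: nbhs_dnbhs_neq.
  have N1 : forall x y : R, `|x| <= `|h| -> `|y| <= `|h| ->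
      `|u (t + x *: a + y *: b) - u t| <= e / 2.
    by near: h; apply: nbhs_dnbhs; exact: L1.
  have N2 : forall x y : R, `|x| <= `|h| -> `|y| <= `|h| ->
      `|v (t + x *: a' + y *: b') - v t| <= e / 2.
    by near: h; apply: nbhs_dnbhs; exact: L2.
  have [p [q [p1 p2 q1 q2 E]]] := HH h h0.
  move: (N1 _ _ p1 p2) (N2 _ _ q1 q2).
  rewrite E !ler_norml => /andP[x1 x2] /andP[x3 x4]; lra.
by case/filter_ex.
Unshelve. all: by end_near. Qed.

End PartialDerivatives.


Section Derivations.
Context {X : Type} {A : comNzRingType} (D : (X -> A) -> (X -> A) -> Prop).
Hypothesis D1 : D (fun=> 1) (fun=> 0).
Hypothesis DM : forall f g f' g', D f f' -> D g g' ->
  D (fun x => f x * g x) (fun x => f' x * g x + f x * g' x).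

Lemma derivation_prod_seq (I : eqType) (r : seq I) (P : pred I) (F F' : I -> X -> A) :
  uniq r -> (forall i, P i -> D (F i) (F' i)) ->
  D (fun t => \prod_(i <- r | P i) F i t)
    (fun t => \sum_(i <- r | P i) F' i t * \prod_(k <- r | P k && (k != i)) F k t).
Proof.
have Deq f g f' g' : D f f' -> f =1 g -> f' =1 g' -> D g g'.
  by move=> h /funext <- /funext <-.
move=> + h; elim: r => [_|i r IH /=/andP[ir ur]].
  by apply: (Deq _ _ _ _ D1) => t; rewrite big_nil.
move/(_ ur): IH => IH.
have E (k : I) t : k \in r ->
    \prod_(k' <- i :: r | P k' && (k' != k)) F k' t =
    (if P i then F i t else 1) * \prod_(k' <- r | P k' && (k' != k)) F k' t.
  move=> kr; have ik : i != k by apply: contraNneq ir => ->.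
  by rewrite big_cons ik andbT; case: (P i); rewrite ?mul1r.
case Pi: (P i); last first.
  apply: (Deq _ _ _ _ IH) => t; rewrite big_cons Pi //.
  rewrite [LHS]big_seq_cond [RHS]big_seq_cond; apply: eq_bigr => k /andP[kr _].
  by rewrite E // Pi mul1r.
apply: (Deq _ _ _ _ (DM (h i Pi) IH)) => t; rewrite big_cons Pi //.
congr (_ * _ + _).
  rewrite big_cons eqxx andbF [LHS]big_seq_cond [RHS]big_seq_cond.
  apply: eq_bigl => k; case kr: (k \in r) => //=; rewrite andbC.
  by have -> : k != i by apply: contraNneq ir => <-.
rewrite big_distrr [LHS]big_seq_cond [RHS]big_seq_cond /=.
by apply: eq_bigr => k /andP[kr _]; rewrite E // Pi mulrCA.
Qed.

Lemma derivation_prod (I : finType) (P : pred I) (F F' : I -> X -> A) :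
  (forall i, P i -> D (F i) (F' i)) ->
  D (fun t => \prod_(i | P i) F i t)
    (fun t => \sum_(i | P i) F' i t * \prod_(k | P k && (k != i)) F k t).
Proof. by apply: derivation_prod_seq; rewrite index_enum_uniq. Qed.

Lemma derivation_exp f f' k : D f f' ->
  D (fun t => f t ^+ k) (fun t => k%:R * f t ^+ k.-1 * f' t).
Proof.
move=> h; elim: k => [|k IH].
  rewrite (_ : (fun t => 0%:R * _ * _) = fun=> 0) //.
  by apply/funext => t; rewrite !mul0r.
rewrite (_ : (fun t => f t ^+ k.+1) = fun t => f t * f t ^+ k); last first.
  by apply/funext => t; rewrite exprS.
rewrite (_ : (fun t => k.+1%:R * _ * _) =
  fun t => f' t * f t ^+ k + f t * (k%:R * f t ^+ k.-1 * f' t)); first exact: DM.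
apply/funext => t /=; rewrite -natr1; case: k {IH} => [|k] /=.
  by rewrite !expr0; ring.
by rewrite exprS; ring.
Qed.

End Derivations.

Section ComplexPartialDerivatives.
Context {R : realType} {m : nat}.
Local Notation C := R[i].
Implicit Types (j : 'I_m) (f g : 'rV[R]_m -> C).

Definition cpartial j f f' : Prop :=
  has_partial j (fun t => complex.Re (f t)) (fun t => complex.Re (f' t)) /\
  has_partial j (fun t => complex.Im (f t)) (fun t => complex.Im (f' t)).

Lemma cpartial_ccont j f f' : cpartial j f f' -> ccont f.
Proof. by move=> [[? _ _] [? _ _]]. Qed.

Lemma cpartial_ccont' j f f' : cpartial j f f' -> ccont f'.
Proof. by move=> [[_ ? _] [_ ? _]]. Qed.

Lemma cpartial_eq j f g f' g' : cpartial j f f' -> f =1 g -> f' =1 g' ->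
  cpartial j g g'.
Proof. by move=> h /funext <- /funext <-. Qed.

Lemma cpartial_const j (c : C) : cpartial j (fun _ => c) (fun _ => 0).
Proof. by split; exact: has_partial_const. Qed.

Lemma cpartialR j (f f' : 'rV[R]_m -> R) : has_partial j f f' ->
  cpartial j (fun t => (f t)%:C) (fun t => (f' t)%:C).
Proof. by move=> h; split => //=; exact: has_partial_const. Qed.

Lemma cpartialD j f g f' g' : cpartial j f f' -> cpartial j g g' ->
  cpartial j (fun t => f t + g t) (fun t => f' t + g' t).
Proof.
move=> [f1 f2] [g1 g2]; split.
  under eq_fun do rewrite ReD; under [X in has_partial _ _ X]eq_fun do rewrite ReD.
  exact: has_partialD.
under eq_fun do rewrite ImD; under [X in has_partial _ _ X]eq_fun do rewrite ImD.
exact: has_partialD.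
Qed.

Lemma cpartialM j f g f' g' : cpartial j f f' -> cpartial j g g' ->
  cpartial j (fun t => f t * g t) (fun t => f' t * g t + f t * g' t).
Proof.
move=> [f1 f2] [g1 g2]; split.
  under eq_fun do rewrite ReM.
  have := has_partialD (has_partialM f1 g1) (has_partialN (has_partialM f2 g2)).
  by congr has_partial; apply/funext => t; rewrite ReD !ReM; ring.
under eq_fun do rewrite ImM.
have := has_partialD (has_partialM f1 g2) (has_partialM f2 g1).
by congr has_partial; apply/funext => t; rewrite ImD !ImM; ring.
Qed.

Lemma cpartial_sum I (r : seq I) (P : pred I) j (F F' : I -> 'rV[R]_m -> C) :
  (forall i, P i -> cpartial j (F i) (F' i)) ->
  cpartial j (fun t => \sum_(i <- r | P i) F i t) (fun t => \sum_(i <- r | P i) F' i t).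
Proof.
move=> h; elim: r => [|i r IH].
  by apply: (cpartial_eq (cpartial_const j 0)) => t; rewrite big_nil.
case Pi: (P i); last first.
  by apply: (cpartial_eq IH) => t; rewrite big_cons Pi.
by apply: (cpartial_eq (cpartialD (h i Pi) IH)) => t; rewrite big_cons Pi.
Qed.

Lemma cpartial_prod (I : finType) (P : pred I) j (F F' : I -> 'rV[R]_m -> C) :
  (forall i, P i -> cpartial j (F i) (F' i)) ->
  cpartial j (fun t => \prod_(i | P i) F i t)
    (fun t => \sum_(i | P i) F' i t * \prod_(k | P k && (k != i)) F k t).
Proof.
apply: derivation_prod; [exact: (cpartial_const j 1)|exact: cpartialM].
Qed.

Lemma cpartial_cexp j f f' : cpartial j f f' ->
  cpartial j (fun t => cexp (f t)) (fun t => f' t * cexp (f t)).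
Proof.
move=> [f1 f2].
have he := has_partial_comp (@continuous_expR R) (@is_derive_expR R) f1.
have hc := has_partial_comp (continuous_opp (@continuous_sin R)) (@is_derive_cos R) f2.
have hs := has_partial_comp (@continuous_cos R) (@is_derive_sin R) f2.
split.
- have := has_partialM he hc; congr has_partial; apply/funext => t.
    by rewrite /cexp ReM /= mul0r subr0.
  by rewrite /cexp !ReM !ImM /=; ring.
- have := has_partialM he hs; congr has_partial; apply/funext => t.
    by rewrite /cexp ImM /= mul0r addr0.
  by rewrite /cexp !ImM !ReM /=; ring.
Qed.

End ComplexPartialDerivatives.

Section CofactorDerivatives.
Context {R : realType} {m n : nat}.
Local Notation C := R[i].
Variables (M : 'I_n -> 'I_n -> 'rV[R]_m -> C) (H : 'I_n -> 'I_n -> 'I_m -> 'rV[R]_m -> C).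
Hypothesis dM : forall i k l, cpartial l (M i k) (H i k l).

Let Mt t := \matrix_(i, k) M i k t.

Definition cofactor_partial (i j : 'I_n) (l : 'I_m) (t : 'rV[R]_m) : C :=
  \sum_(s : 'S_n | s i == j) (-1) ^+ s *
     \sum_(k | i != k) H k (s k) l t * \prod_(k' | (i != k') && (k' != k)) M k' (s k') t.

Lemma cpartial_cofactor i j l :
  cpartial l (fun t => cofactor (Mt t) i j) (cofactor_partial i j l).
Proof.
have h : cpartial l
    (fun t => \sum_(s : 'S_n | s i == j) (-1) ^+ s * \prod_(k | i != k) M k (s k) t)
    (cofactor_partial i j l).
  apply: cpartial_sum => s _.
  have := cpartialM (cpartial_const l ((-1) ^+ s))
    (cpartial_prod (P := fun k => i != k) (fun k _ => dM k (s k) l)).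
  by move=> /cpartial_eq; apply => t //=; rewrite mul0r add0r.
apply: (cpartial_eq h) => t //=; rewrite expand_cofactor.
apply: eq_bigr => s _; congr (_ * _).
by apply: eq_bigr => k _; rewrite mxE.
Qed.

End CofactorDerivatives.

Lemma piola {R : realType} n (M : 'I_n -> 'I_n -> 'rV[R]_n -> R[i])
    (H : 'I_n -> 'I_n -> 'I_n -> 'rV[R]_n -> R[i]) i t :
  (forall i k l, H i k l t = H i l k t) ->
  \sum_j cofactor_partial M H i j j t = 0.
Proof.
move=> symH; rewrite /cofactor_partial.
pose T (s : 'S_n) (k : 'I_n) := (-1) ^+ s * (H k (s k) (s i) t *
   \prod_(k' | (i != k') && (k' != k)) M k' (s k') t).
transitivity (\sum_(s : 'S_n) \sum_(k | i != k) T s k).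
  rewrite [RHS](partition_big (fun s : 'S_n => s i) predT) //=.
  apply: eq_bigr => j _; apply: eq_bigr => s /eqP <-.
  by rewrite big_distrr.
rewrite exchange_big /= big1 // => k ik.
set S := \sum_s _; suff : S = - S.
  by move=> /eqP; rewrite -addr_eq0 -mulr2n mulrn_eq0 => /eqP.
rewrite {1}/S (reindex_inj (mulgI (tperm i k))) /= -sumrN.
apply: eq_bigr => s _; rewrite /T odd_permM odd_tperm ik /= signrN.
rewrite mulNr !permM tpermL tpermR symH; congr (- (_ * (_ * _))).
by apply: eq_bigr => k' /andP[ik' kk']; rewrite permM tpermD // eq_sym.
Qed.


Section ComplexCubeIntegral.
Context {R : realType} {m : nat}.
Local Notation C := R[i].
Implicit Types (f g : 'rV[R]_m -> C).

Lemma cube_integral_lin (a : R) (f g : 'rV[R]_m -> R) :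
  continuous f -> continuous g ->
  cube_integral (fun t => a * f t + g t) = a * cube_integral f + cube_integral g.
Proof. by have [lin _ _] := @cube_integral_positive_linear R m; exact: lin. Qed.

Lemma cube_integralD (f g : 'rV[R]_m -> R) :
  continuous f -> continuous g ->
  cube_integral (fun t => f t + g t) = cube_integral f + cube_integral g.
Proof.
move=> cf cg; rewrite -[X in _ = X + _]mul1r -cube_integral_lin //.
by apply: eq_cube_integral => t _; rewrite mul1r.
Qed.

Lemma cube_integral0 : cube_integral (fun _ : 'rV[R]_m => 0 : R) = 0.
Proof. exact: (positive_linear0 (@cube_integral_positive_linear R m)). Qed.

Lemma cube_integralZ (a : R) (f : 'rV[R]_m -> R) :
  continuous f -> cube_integral (fun t => a * f t) = a * cube_integral f.
Proof.
move=> cf; rewrite -[RHS]addr0 -cube_integral0 -cube_integral_lin //.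
  by apply: eq_cube_integral => t _; rewrite addr0.
exact: continuous_const.
Qed.

Lemma cube_integral_ge0 (f : 'rV[R]_m -> R) :
  continuous f -> (forall t, cube t -> 0 <= f t) -> 0 <= cube_integral f.
Proof. by have [_ pos _] := @cube_integral_positive_linear R m; exact: pos. Qed.

Lemma le_cube_integral (f g : 'rV[R]_m -> R) :
  continuous f -> continuous g -> (forall t, cube t -> f t <= g t) ->
  cube_integral f <= cube_integral g.
Proof.
move=> cf cg fg; rewrite -subr_ge0 addrC -mulN1r -cube_integral_lin //.
apply: cube_integral_ge0; first exact: (continuous_linear_comb (a := -1) cf cg).
by move=> t /fg; lra.
Qed.

Lemma ler_norm_cube_integral (f g : 'rV[R]_m -> R) :
  continuous f -> continuous g -> (forall t, cube t -> `|f t| <= g t) ->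
  `|cube_integral f| <= cube_integral g.
Proof.
move=> cf cg fg; rewrite ler_norml; apply/andP; split; last first.
  by apply: le_cube_integral => // t /fg; rewrite ler_norml => /andP[].
rewrite -mulN1r -cube_integralZ //; apply: le_cube_integral => //.
  by apply: continuous_mul => //; exact: continuous_const.
by move=> t /fg; rewrite ler_norml => /andP[]; lra.
Qed.

Lemma eq_cube_integralC f g : (forall t, cube t -> f t = g t) ->
  cube_integralC f = cube_integralC g.
Proof.
by move=> fg; congr (_ +i* _); apply: eq_cube_integral => t ct; rewrite fg.
Qed.

Lemma cube_integralCD f g : ccont f -> ccont g ->
  cube_integralC (fun t => f t + g t) = cube_integralC f + cube_integralC g.
Proof.
move=> [f1 f2] [g1 g2]; apply: eq_ReIm.
  rewrite ReD /= -cube_integralD //.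
  by apply: eq_cube_integral => t _; rewrite ReD.
rewrite ImD /= -cube_integralD //.
by apply: eq_cube_integral => t _; rewrite ImD.
Qed.

Lemma cube_integralCZ (a : C) f : ccont f ->
  cube_integralC (fun t => a * f t) = a * cube_integralC f.
Proof.
move=> [f1 f2].
have cM (c : R) (h : 'rV[R]_m -> R) : continuous h -> continuous (fun t => c * h t).
  by move=> ch; apply: continuous_mul => //; exact: continuous_const.
apply: eq_ReIm.
  rewrite ReM /= -!cube_integralZ // -mulN1r -cube_integralZ; last exact: cM.
  rewrite -cube_integralD; [|exact: cM|by apply: (cM); exact: cM].
  by apply: eq_cube_integral => t _; rewrite ReM mulN1r.
rewrite ImM /= -!cube_integralZ //.
rewrite -cube_integralD; [|exact: cM|exact: cM].
by apply: eq_cube_integral => t _; rewrite ImM.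
Qed.

Lemma cube_integralC0 : cube_integralC (fun _ : 'rV[R]_m => 0 : C) = 0.
Proof. by apply: eq_ReIm; exact: cube_integral0. Qed.

Lemma cube_integralC_sum I (r : seq I) (P : pred I) (F : I -> 'rV[R]_m -> C) :
  (forall i, ccont (F i)) ->
  cube_integralC (fun t => \sum_(i <- r | P i) F i t) =
  \sum_(i <- r | P i) cube_integralC (F i).
Proof.
move=> h; elim: r => [|i r IH].
  rewrite big_nil -[RHS]cube_integralC0.
  by apply: eq_cube_integralC => t _; rewrite big_nil.
rewrite big_cons -IH; case: (P i) (fun t => big_cons 0 +%R i r P (fun i => F i t)) => E.
  rewrite -cube_integralCD //; last exact: ccont_sum.
  by apply: eq_cube_integralC => t _; rewrite E.
by apply: eq_cube_integralC => t _; rewrite E.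
Qed.

(* The factor 2 avoids rotating the integral onto the real axis. *)
Lemma cabs_cube_integralC f (h : 'rV[R]_m -> R) :
  ccont f -> continuous h -> (forall t, cube t -> cabs (f t) <= h t) ->
  cabs (cube_integralC f) <= 2 * cube_integral h.
Proof.
move=> [f1 f2] ch fh; apply: (le_trans (cabs_le_ReIm _)).
rewrite mulr2n mulrDl !mul1r; apply: lerD; apply: ler_norm_cube_integral => // t ct.
  by apply: (le_trans (ler_Re_cabs _)); exact: fh.
by apply: (le_trans (ler_Im_cabs _)); exact: fh.
Qed.

End ComplexCubeIntegral.

Lemma ccont_insert {R : realType} n (f : 'rV[R]_n -> R[i]) (j : 'I_n) b :
  ccont f -> ccont (fun u => f (insert_coord j b u)).
Proof.
move=> [f1 f2]; split => u.
  apply: (@continuous_comp _ _ _ (@insert_coord R n j b) (fun t => complex.Re (f t) : R)).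
    exact: insert_coord_continuous.
  exact: f1.
apply: (@continuous_comp _ _ _ (@insert_coord R n j b) (fun t => complex.Im (f t) : R)).
  exact: insert_coord_continuous.
exact: f2.
Qed.

Lemma cube_integralC_FTC {R : realType} n (j : 'I_n) (f f' : 'rV[R]_n -> R[i]) :
  cpartial j f f' ->
  cube_integralC f' =
  cube_integralC (fun u => f (insert_coord j true u)) -
  cube_integralC (fun u => f (insert_coord j false u)).
Proof.
case: n j f f' => [[] //|n] j f f' [h1 h2]; apply: eq_ReIm.
  by rewrite ReD ReN; exact: cube_integral_FTC h1.
by rewrite ImD ImN; exact: cube_integral_FTC h2.
Qed.

Definition replace_row {A : Type} n (i : 'I_n) (v : 'I_n -> A) (M : 'I_n -> 'I_n -> A)
    : 'M[A]_n :=
  \matrix_(a, b) if a == i then v b else M a b.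

Lemma det_replace_row {A : comNzRingType} n (i : 'I_n) (v : 'I_n -> A) M :
  \det (replace_row i v M) = \sum_j v j * cofactor (\matrix_(a, b) M a b) i j.
Proof.
rewrite (expand_det_row _ i); apply: eq_bigr => j _; rewrite mxE eqxx.
congr (_ * _); rewrite /cofactor; congr (_ * \det _).
by apply/matrixP => a b; rewrite !mxE eq_sym (negPf (neq_lift i a)).
Qed.

Lemma cube_stokes {R : realType} n (M : 'I_n -> 'I_n -> 'rV[R]_n -> R[i])
    (H : 'I_n -> 'I_n -> 'I_n -> 'rV[R]_n -> R[i])
    (G : 'rV[R]_n -> R[i]) (dG : 'I_n -> 'rV[R]_n -> R[i]) i :
  (forall i k l, cpartial l (M i k) (H i k l)) ->
  (forall i k l t, H i k l t = H i l k t) ->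
  (forall j, cpartial j G (dG j)) ->
  let face j b u := let t := insert_coord j b u in
    G t * cofactor (\matrix_(a, c) M a c t) i j in
  cube_integralC (fun t => \det (replace_row i (dG^~ t) (fun a b => M a b t))) =
  \sum_j (cube_integralC (face j true) - cube_integralC (face j false)).
Proof.
move=> dM symH hG face.
pose cof j (t : 'rV[R]_n) := cofactor (\matrix_(a, c) M a c t) i j.
pose D j t := dG j t * cof j t + G t * cofactor_partial M H i j j t.
have hD j : cpartial j (fun t => G t * cof j t) (D j).
  exact: cpartialM (hG j) (cpartial_cofactor dM i j j).
transitivity (cube_integralC (fun t => \sum_j D j t)).
  apply: eq_cube_integralC => t _; rewrite det_replace_row /D big_split /=.
  by rewrite -mulr_sumr piola ?mulr0 ?addr0.
rewrite cube_integralC_sum; last by move=> j; exact: cpartial_ccont' (hD j).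
by apply: eq_bigr => j _; rewrite (cube_integralC_FTC (hD j)).
Qed.


Section Cells.
Context {R : realType} {m n : nat}.
Local Notation C := R[i].
Implicit Types (s : 'rV[R]_m -> 'rV[C]_n).

Definition cell_jac s (i : 'I_n) (j : 'I_m) (t : 'rV[R]_m) : C :=
  ('D_(delta_mx 0 j) (re_coord s i) t) +i* ('D_(delta_mx 0 j) (im_coord s i) t).

Definition cell_hess s (i : 'I_n) (k l : 'I_m) (t : 'rV[R]_m) : C :=
  ('D_(delta_mx 0 l) ('D_(delta_mx 0 k) (re_coord s i)) t) +i*
  ('D_(delta_mx 0 l) ('D_(delta_mx 0 k) (im_coord s i)) t).

Lemma Ck_has_partial (f : 'rV[R]_m -> R^o) k j : Ck k.+1 f ->
  has_partial j f ('D_(delta_mx 0 j) f) /\ Ck k ('D_(delta_mx 0 j) f).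
Proof.
move=> [cf /(_ j) [df cf']]; split => //; split => //.
  by case: k cf' => [|k] [].
Qed.

Lemma smooth_cpartial s i j : smooth s ->
  cpartial j (fun t => s t 0 i) (cell_jac s i j).
Proof.
move=> /(_ 1%N i) [h1 h2]; split.
  by have [] := Ck_has_partial j h1.
by have [] := Ck_has_partial j h2.
Qed.

Lemma smooth_cpartial2 s i k l : smooth s ->
  cpartial l (cell_jac s i k) (cell_hess s i k l).
Proof.
move=> /(_ 2%N i) [h1 h2]; split.
  have [_ h] := Ck_has_partial k h1; by have [] := Ck_has_partial l h.
have [_ h] := Ck_has_partial k h2; by have [] := Ck_has_partial l h.
Qed.

Lemma cell_hess_sym s i k l t : smooth s -> cell_hess s i k l t = cell_hess s i l k t.
Proof.
move=> sm; have [a1 a2] := smooth_cpartial i k sm; have [b1 b2] := smooth_cpartial i l sm.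
have [c1 c2] := smooth_cpartial2 i k l sm; have [d1 d2] := smooth_cpartial2 i l k sm.
apply: eq_ReIm; first exact: (schwarz a1 c1 b1 d1 t).
exact: (schwarz a2 c2 b2 d2 t).
Qed.

End Cells.

Lemma jac_detE {R : realType} n (s : 'rV[R]_n -> 'rV[R[i]]_n) t :
  jac_det s t = \det (\matrix_(i, j) cell_jac s i j t).
Proof. by congr (\det _); apply/matrixP => i j; rewrite !mxE. Qed.

Section FaceForms.
Context {R : realType} {m : nat}.
Local Notation C := R[i].

Lemma eq_derive_on_cube (f g : 'rV[R]_m -> R^o) j u : cube u ->
  derivable f u (delta_mx 0 j) -> derivable g u (delta_mx 0 j) ->
  (forall k : R, cube (u + k *: delta_mx 0 j) ->
     f (u + k *: delta_mx 0 j) = g (u + k *: delta_mx 0 j)) ->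
  'D_(delta_mx 0 j) f u = 'D_(delta_mx 0 j) g u.
Proof.
set v := delta_mx 0 j => cu df dg fg.
apply/eqP; rewrite -subr_eq0 -normr_eq0 eq_le normr_ge0 andbT.
apply/ler_addgt0Pr => e e0; rewrite add0r.
have e2 : 0 < e / 2 by rewrite divr_gt0.
have fu : f u = g u by have := fg 0; rewrite scale0r addr0; exact.
have /cvgrPdist_le/(_ _ e2) [r1 /= r10 H1] := df.
have /cvgrPdist_le/(_ _ e2) [r2 /= r20 H2] := dg.
pose h0 : R := Num.min (Num.min (r1 / 2) (r2 / 2)) (1 / 2).
have h00 : 0 < h0 by rewrite !lt_min !divr_gt0.
have [h01 h02 h03] : [/\ h0 <= r1 / 2, h0 <= r2 / 2 & h0 <= 1 / 2].
  by rewrite /h0 !ge_min !lexx !orbT.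
have [k [k0 kh ck]] : exists k : R, [/\ k != 0, `|k| = h0 & cube (u + k *: v)].
  have [uj0 uj1] := andP (cu j).
  have [uj|uj] := leP (u 0 j) (1 / 2); [exists h0|exists (- h0)];
    rewrite ?normrN ?oppr_eq0 gtr0_norm ?gt_eqF //; split => // l;
    have /andP[? ?] := cu l; rewrite !mxE /=; case: eqP => [->|_] /=;
    rewrite ?mulr0 ?addr0 ?mulr1; try (by apply/andP); apply/andP; split; lra.
have B1 := H1 k; have B2 := H2 k.
have E : f (k *: v + u) = g (k *: v + u) by rewrite addrC fg.
have {}B1 : `|'D_v f u - k^-1 *: (f (k *: v + u) - f u)| <= e / 2.
  by apply: B1 => //; rewrite /ball_ /= sub0r normrN kh; lra.
have {}B2 : `|'D_v g u - k^-1 *: (f (k *: v + u) - f u)| <= e / 2.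
  by rewrite E fu; apply: B2 => //; rewrite /ball_ /= sub0r normrN kh; lra.
have := ler_normB ('D_v f u - k^-1 *: (f (k *: v + u) - f u))
   ('D_v g u - k^-1 *: (f (k *: v + u) - f u)).
rewrite opprB addrA subrK => /le_trans; apply; lra.
Qed.

Context {n : nat}.

Definition coord_derivable (tau : 'rV[R]_m -> 'rV[C]_n) : Prop :=
  forall k j u, derivable (re_coord tau k) u (delta_mx 0 j) /\
                derivable (im_coord tau k) u (delta_mx 0 j).

Lemma eq_cell_jac (tau tau' : 'rV[R]_m -> 'rV[C]_n) k j u :
  coord_derivable tau -> coord_derivable tau' ->
  (forall u, cube u -> tau u = tau' u) -> cube u ->
  cell_jac tau k j u = cell_jac tau' k j u.
Proof.
move=> dt dt' E cu; have [d1 d2] := dt k j u; have [d3 d4] := dt' k j u.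
by congr (_ +i* _); apply: eq_derive_on_cube => // c cc; rewrite /re_coord /im_coord E.
Qed.

Lemma degenerate_cell_jac (tau : 'rV[R]_m -> 'rV[C]_n) :
  coord_derivable tau -> degenerate tau ->
  exists j, forall k u, cube u -> cell_jac tau k j u = 0.
Proof.
move=> dt [j Hj]; exists j => k u cu; have [d1 d2] := dt k j u.
have E c : cube (u + c *: delta_mx 0 j) -> tau (u + c *: delta_mx 0 j) = tau u.
  move=> cc; apply: Hj => // l lj; rewrite !mxE (negPf lj) andbF mulr0 addr0 //.
rewrite /cell_jac.
rewrite (@eq_derive_on_cube (re_coord tau k) (cst (re_coord tau k u)) j u cu d1).
- rewrite (@eq_derive_on_cube (im_coord tau k) (cst (im_coord tau k u)) j u cu d2).
  + by rewrite !derive_cst.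
  + exact: derivable_cst.
  + by move=> c cc; rewrite /im_coord E.
- exact: derivable_cst.
- by move=> c cc; rewrite /re_coord E.
Qed.

End FaceForms.

Section FaceIntegrals.
Context {R : realType} {n : nat}.
Local Notation C := R[i].
Implicit Types (s : 'rV[R]_n -> 'rV[C]_n) (tau : 'rV[R]_n.-1 -> 'rV[C]_n).

(* The integral over tau of G times the product of the dx_k with k != i. *)
Definition face_integral (G : 'rV[C]_n -> C) (i : 'I_n) tau : C :=
  cube_integralC (fun u => G (tau u) *
    \det (\matrix_(a, b) cell_jac tau (lift i a) b u)).

Lemma eq_face_integral G i tau tau' :
  coord_derivable tau -> coord_derivable tau' ->
  (forall u, cube u -> tau u = tau' u) -> face_integral G i tau = face_integral G i tau'.
Proof.
move=> dt dt' E; apply: eq_cube_integralC => u cu; rewrite E //.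
by congr (_ * \det _); apply/matrixP => a b; rewrite !mxE; exact: eq_cell_jac.
Qed.

Lemma degenerate_face_integral G i tau :
  coord_derivable tau -> degenerate tau -> face_integral G i tau = 0.
Proof.
move=> dt /(degenerate_cell_jac dt)[j Hj]; rewrite -[RHS](@cube_integralC0 R n.-1).
apply: eq_cube_integralC => u cu; rewrite (expand_det_col _ j) big1 ?mulr0 // => a _.
by rewrite mxE Hj // mul0r.
Qed.

Lemma insert_coord_line (j : 'I_n) b (u : 'rV[R]_n.-1) (l : 'I_n.-1) k :
  insert_coord j b (k *: delta_mx 0 l + u) =
  k *: delta_mx 0 (lift j l) + insert_coord j b u.
Proof.
apply/rowP => i; rewrite [RHS]mxE [X in _ = X + _]mxE [delta_mx _ _ _ _]mxE.
case: (unliftP j i) => [a|] ->.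
  by rewrite !insert_coord_liftE !mxE (inj_eq lift_inj).
by rewrite !insert_coordE eq_liftF andbF mulr0 add0r.
Qed.

Lemma is_derive_insert (f : 'rV[R]_n -> R^o) (j : 'I_n) b (u : 'rV[R]_n.-1) l df :
  is_derive (insert_coord j b u) (delta_mx 0 (lift j l)) f df ->
  is_derive u (delta_mx 0 l) (fun u => f (insert_coord j b u) : R^o) df.
Proof.
move=> [D E].
have EQ : (fun k : R => k^-1 *: (f (insert_coord j b (k *: delta_mx 0 l + u)) - f (insert_coord j b u)))
  = (fun k : R => k^-1 *: (f (k *: delta_mx 0 (lift j l) + insert_coord j b u) - f (insert_coord j b u))).
  by apply/funext => k; rewrite insert_coord_line.
split; first by move: D; rewrite /derivable /= EQ.
by move: E; rewrite /derive /= EQ.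
Qed.

Lemma cell_jac_insert s j b k l u : smooth s ->
  cell_jac (fun u => s (insert_coord j b u)) k l u =
  cell_jac s k (lift j l) (insert_coord j b u).
Proof.
move=> /smooth_cpartial sm; have [[_ _ h1] [_ _ h2]] := sm k (lift j l).
have [_ e1] := is_derive_insert (h1 (insert_coord j b u)).
have [_ e2] := is_derive_insert (h2 (insert_coord j b u)).
exact: eq_ReIm.
Qed.

Lemma coord_derivable_face s j b : smooth s ->
  coord_derivable (fun u => s (insert_coord j b u)).
Proof.
move=> /smooth_cpartial sm k l u; have [[_ _ h1] [_ _ h2]] := sm k (lift j l).
have [d1 _] := is_derive_insert (h1 (insert_coord j b u)).
have [d2 _] := is_derive_insert (h2 (insert_coord j b u)).
by split.
Qed.

Lemma face_integralE G i j b s : smooth s ->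
  cube_integralC (fun u => let t := insert_coord j b u in
    G (s t) * cofactor (\matrix_(a, c) cell_jac s a c t) i j) =
  cube_integralC (fun u => (-1) ^+ (i + j) * (G (s (insert_coord j b u)) *
    \det (\matrix_(a, l) cell_jac (fun u => s (insert_coord j b u)) (lift i a) l u))).
Proof.
move=> sm; apply: eq_cube_integralC => u _ /=; rewrite /cofactor mulrCA.
by congr (_ * (_ * \det _)); apply/matrixP => a l; rewrite !mxE cell_jac_insert.
Qed.

End FaceIntegrals.


Lemma sum_over_classes {A : comNzRingType} (T : finType) (e : rel T) (w Phi : T -> A) :
  equivalence_rel e ->
  (forall p q, e p q -> Phi p = Phi q) ->
  (forall p, Phi p = 0 \/ \sum_(q | e p q) w q = 0) ->
  \sum_p w p * Phi p = 0.
Proof.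
move=> eqe ePhi H.
rewrite (partition_big (fun p => [set q | e p q]%SET) predT) //= big1 // => B _.
have [p /eqP pB|noB] := pickP (fun p => [set q | e p q]%SET == B); last first.
  by rewrite big_pred0 // => p; exact: noB.
rewrite (eq_bigl (e p)) => [|q]; last first.
  rewrite -pB; apply/eqP/idP => [/setP/(_ q)|epq].
    by rewrite !inE => <-; have [] := eqe q q q.
  by apply/setP => z; rewrite !inE; have [_ ->] := eqe p q z.
rewrite (eq_bigr (fun q => w q * Phi p)) => [|q /ePhi -> //].
by rewrite -big_distrl /=; case: (H p) => ->; rewrite ?mulr0 ?mul0r.
Qed.

Section CellStokes.
Context {R : realType} {n : nat}.
Local Notation C := R[i].

Lemma cell_stokes (s : 'rV[R]_n -> 'rV[C]_n) (G : 'rV[C]_n -> C)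
    (dG : 'I_n -> 'rV[R]_n -> C) i :
  smooth s -> (forall j, cpartial j (fun t => G (s t)) (dG j)) ->
  cube_integralC (fun t => \det (replace_row i (dG^~ t) (fun a b => cell_jac s a b t))) =
  - (-1) ^+ i * \sum_(q : 'I_n * bool) (-1) ^+ (q.1 + q.2)%N *
      face_integral G i (fun u => s (insert_coord q.1 q.2 u)).
Proof.
move=> sm hG.
rewrite (cube_stokes i (fun a k l => smooth_cpartial2 a k l sm)
   (fun a k l t => cell_hess_sym a k l t sm) hG) /=.
pose f := fun (j : 'I_n) (b : bool) => (-1) ^+ (j + b)%N *
   face_integral G i (fun u => s (insert_coord j b u)).
rewrite -(pair_bigA _ f) /= big_distrr /=; apply: eq_bigr => j _.
have cG : ccont (fun t => G (s t)) by exact: cpartial_ccont (hG j).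
have fE b : cube_integralC (fun u => G (s (insert_coord j b u)) *
    cofactor (\matrix_(a, c) cell_jac s a c (insert_coord j b u)) i j) =
    (-1) ^+ (i + j) * face_integral G i (fun u => s (insert_coord j b u)).
  rewrite face_integralE // cube_integralCZ //.
  apply: ccontM; first exact: ccont_insert cG.
  apply: ccont_det => a l; under eq_fun do rewrite mxE cell_jac_insert //.
  by apply: ccont_insert; exact: cpartial_ccont (smooth_cpartial2 (lift i a) (lift j l) (lift j l) sm).
rewrite !fE big_bool /f /= addn0 addn1 exprS exprD.
by move: (face_integral _ _ _) (face_integral _ _ _) => x y; ring.
Qed.

End CellStokes.

Section ChainStokes.
Context {R : realType} {n : nat}.
Local Notation C := R[i].

Lemma finite_set_nat_bound (A : set nat) : finite_set A ->
  exists M, forall k, A k -> (k < M)%N.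
Proof.
move=> /finite_seqP[r ->]; exists (\max_(k <- r) k).+1 => k /= kr.
by rewrite ltnS; apply: (leq_bigmax_seq (F := id)).
Qed.

Lemma chain_stokes (c : contour R n) (G : 'rV[C]_n -> C)
    (dG : nat -> 'I_n -> 'rV[R]_n -> C) i (r : R) :
  (forall k j, cpartial j (fun t => G (cell c k t)) (dG k j)) ->
  (forall x, ~ (`|x| <= r%:C) -> G x = 0) ->
  exists M0, forall M, (M0 <= M)%N -> \sum_(0 <= k < M) (mult c k)%:~R *
    cube_integralC (fun t => \det (replace_row i ((dG k)^~ t)
       (fun a b => cell_jac (cell c k) a b t))) = 0.
Proof.
case: c => cell mult sm lf bd /= hG G0.
have [M0 HM] := finite_set_nat_bound (lf r); exists M0 => M MM.
pose T := ('I_M * ('I_n * bool))%type.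
pose face (p : T) u := cell p.1 (insert_coord p.2.1 p.2.2 u).
pose w (p : T) : C := (mult p.1 * (-1) ^+ (p.2.1 + p.2.2)%N)%:~R.
transitivity (- (-1) ^+ i * \sum_(p : T) w p * face_integral G i (face p)).
  rewrite big_mkord -(pair_bigA _ (fun k q => w (k, q) * face_integral G i (face (k, q)))) /=.
  rewrite big_distrr /=; apply: eq_bigr => k _; rewrite (cell_stokes (G := G) i (sm k) (hG k)) mulrCA.
  congr (_ * _); rewrite big_distrr /=; apply: eq_bigr => q _.
  by rewrite mulrA /w /= intrM rmorphXn /= mulrN1z.
pose e := fun p q : T => `[< forall u, cube u -> face p u = face q u >].
rewrite (@sum_over_classes _ T e w) ?mulr0 //.
- move=> p q z; split; first by apply/asboolP.
  move=> /asboolP pq; apply/asboolP/asboolP => h u cu; first by rewrite -pq // h.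
  by rewrite pq // h.
- move=> p q /asboolP pq; apply: eq_face_integral => //; exact: coord_derivable_face.
move=> p; have [deg|ndeg] := pselect (degenerate (face p)).
  by left; apply: degenerate_face_integral => //; exact: coord_derivable_face.
have [[u0 [cu0 u0r]]|far] := pselect (exists u, cube u /\ `|face p u| <= r%:C); last first.
  left; rewrite /face_integral -[RHS](@cube_integralC0 R n.-1).
  apply: eq_cube_integralC => u cu; rewrite G0 ?mul0r // => h; apply: far; by exists u.
right; rewrite -(rmorph_sum (intmul 1)) /=.
rewrite (_ : \sum_(_ | _) _ = 0) //.
rewrite -[RHS](bd _ ndeg) /boundary_coef.
pose emb (q : T) : nat * 'I_n * bool := (val q.1, q.2.1, q.2.2).
pose P (q : nat * 'I_n * bool) := `[< forall u, cube u ->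
   cell q.1.1 (insert_coord q.1.2 q.2 u) = face p u >].
have -> : [set q : nat * 'I_n * bool | forall u, cube u ->
   cell q.1.1 (insert_coord q.1.2 q.2 u) = face p u] = [set` P].
  by apply/seteqP; split => q /= h; [apply/asboolP|apply/asboolP].
rewrite -(@bigfs _ _ _ _ [seq emb q | q <- index_enum T]).
- rewrite big_map; apply: eq_bigl => q; by apply/asboolP/asboolP => h u cu; apply: esym; exact: (h u cu).
- rewrite map_inj_uniq ?index_enum_uniq //.
  by move=> [a [b x]] [a' [b' x']] [/val_inj -> -> ->].
- move=> [[k j] b] /asboolP /= h; have [->|mk] := eqVneq (mult k) 0; first by rewrite mul0r.
  have kM : (k < M)%N.
    apply: leq_trans MM; apply: HM; split => //.
    exists (insert_coord j b u0); first exact: cube_insert_coord.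
    by rewrite h.
  by move=> /mapP[]; exists (Ordinal kM, (j, b)); rewrite ?mem_index_enum.
Qed.

End ChainStokes.


Section GramDeterminant.

Lemma det_mulmx_rows {A : comNzRingType} n p (B : 'M[A]_(n, p)) (D : 'M[A]_(p, n)) :
  \det (B *m D) = \sum_(f : {ffun 'I_n -> 'I_p}) (\prod_i B i (f i)) * \det (rowsub f D).
Proof.
transitivity (\sum_(s : 'S_n) \sum_(f : {ffun 'I_n -> 'I_p})
    (-1) ^+ s * \prod_i (B i (f i) * D (f i) (s i))).
  apply: eq_bigr => s _; rewrite -big_distrr /=; congr (_ * _).
  rewrite -(bigA_distr_bigA (fun i j => B i j * D j (s i))) /=.
  by apply: eq_bigr => i _; rewrite mxE.
rewrite exchange_big /=; apply: eq_bigr => f _.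
rewrite big_distrr /=; apply: eq_bigr => s _.
rewrite big_split /= mulrCA; congr (_ * (_ * _)).
by apply: eq_bigr => i _; rewrite mxE.
Qed.

Lemma det_gram {A : comNzRingType} n p (D : 'M[A]_(p, n)) :
  (n`!)%:R * \det (D^T *m D) =
  \sum_(f : {ffun 'I_n -> 'I_p}) \det (rowsub f D) ^+ 2.
Proof.
transitivity (\sum_(s : 'S_n) \det (D^T *m D)).
  by rewrite sumr_const card_Sn mulr_natl.
transitivity (\sum_(s : 'S_n) \sum_(f : {ffun 'I_n -> 'I_p})
    (\prod_i D (f (s i)) i) * ((-1) ^+ s * \det (rowsub f D))).
  apply: eq_bigr => s _; rewrite det_mulmx_rows.
  rewrite (reindex (fun f : {ffun 'I_n -> 'I_p} => [ffun i => f (s i)])) /=; last first.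
    exists (fun f : {ffun 'I_n -> 'I_p} => [ffun i => f ((s^-1)%g i)]) => f _;
      by apply/ffunP => i; rewrite !ffunE ?permK ?permKV.
  apply: eq_bigr => f _; congr (_ * _).
    by apply: eq_bigr => i _; rewrite mxE ffunE.
  have -> : rowsub [ffun i => f (s i)] D = row_perm s (rowsub f D).
    by apply/matrixP => i j; rewrite !mxE ffunE.
  by rewrite row_permE det_mulmx det_perm.
rewrite exchange_big /=; apply: eq_bigr => f _.
rewrite expr2 -[X in _ = X * _]det_tr big_distrl /=.
apply: eq_bigr => s _; rewrite mulrA; congr (_ * _); rewrite mulrC.
by congr (_ * _); apply: eq_bigr => i _; rewrite !mxE.
Qed.

Context {R : realType}.
Local Notation C := R[i].

Lemma det_rowsub_le_gram n p (D : 'M[R]_(p, n)) (f : {ffun 'I_n -> 'I_p}) :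
  `|\det (rowsub f D)| <= Num.sqrt (n`!)%:R * Num.sqrt (\det (D^T *m D)).
Proof.
rewrite -sqrtrM ?ler0n // det_gram -sqrtr_sqr ler_wsqrtr // (bigD1 f) //=.
by rewrite lerDl sumr_ge0 // => g _; exact: sqr_ge0.
Qed.

Definition gram_const n p : R := (p ^ n)%:R * Num.sqrt (n`!)%:R.

Lemma cabs_det_mulmx n p (B : 'M[C]_(n, p)) (D : 'M[R]_(p, n)) :
  (forall i j, cabs (B i j) <= 1) ->
  cabs (\det (B *m map_mx (real_complex R) D)) <=
  gram_const n p * Num.sqrt (\det (D^T *m D)).
Proof.
move=> B1; rewrite det_mulmx_rows; apply: (le_trans (cabs_sum _ _ _)).
have -> : gram_const n p * Num.sqrt (\det (D^T *m D)) =
   \sum_(f : {ffun 'I_n -> 'I_p}) Num.sqrt (n`!)%:R * Num.sqrt (\det (D^T *m D)).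
  by rewrite sumr_const card_ffun !card_ord /gram_const -mulrA mulr_natl.
apply: ler_sum => f _; rewrite cabsM -[leRHS]mul1r; apply: ler_pM; try exact: cabs_ge0.
  rewrite cabs_prod; apply: prodr_ile1 => i _; by rewrite cabs_ge0 B1.
have -> : rowsub f (map_mx (real_complex R) D) = map_mx (real_complex R) (rowsub f D).
  by apply/matrixP => i j; rewrite !mxE.
by rewrite det_map_mx cabsR; exact: det_rowsub_le_gram.
Qed.

End GramDeterminant.

Section VolumeDensity.
Context {R : realType} {n : nat}.
Local Notation C := R[i].
Implicit Types (s : 'rV[R]_n -> 'rV[C]_n).

Definition vol_const : R := gram_const n (n + n).

Lemma vol_const_ge0 : 0 <= vol_const.
Proof. by rewrite /vol_const /gram_const mulr_ge0 // ?ler0n ?sqrtr_ge0. Qed.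

Lemma volume_density_ge0 s t : 0 <= volume_density s t.
Proof. exact: sqrtr_ge0. Qed.

Lemma continuous_volume_density s : smooth s -> continuous (volume_density s).
Proof.
move=> sm; apply: continuous_sqrt; apply: continuous_det => i j.
under eq_fun do rewrite mxE; apply: continuous_sum => k.
have H l : continuous (fun t => col_mx (re_jacobian s t) (im_jacobian s t) k l : R).
  case: (split_ordP k) => a ->.
    under eq_fun do rewrite col_mxEu mxE.
    by have [[_ ? _] _] := smooth_cpartial a l sm.
  under eq_fun do rewrite col_mxEd mxE.
  by have [_ [_ ? _]] := smooth_cpartial a l sm.
apply: continuous_mul; last exact: H.
by under eq_fun do rewrite mxE; exact: H.
Qed.

Lemma cabs_det_vol s t (B1 B2 : 'M[C]_n) (A : 'M[C]_n) :
  (forall i j, cabs (B1 i j) <= 1) -> (forall i j, cabs (B2 i j) <= 1) ->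
  A = B1 *m map_mx (real_complex R) (re_jacobian s t) +
      B2 *m map_mx (real_complex R) (im_jacobian s t) ->
  cabs (\det A) <= vol_const * volume_density s t.
Proof.
move=> b1 b2 ->; rewrite -mul_row_col -map_col_mx.
apply: cabs_det_mulmx => i j.
by case: (split_ordP j) => k ->; rewrite ?row_mxEl ?row_mxEr.
Qed.

Lemma cabs_bool (b : bool) : cabs (b%:R : C) <= 1.
Proof. by case: b; rewrite ?cabs1 ?cabs0 ?ler01. Qed.

Lemma cabs_bool_i (b : bool) : cabs ((b%:R : C) * (0 +i* 1)) <= 1.
Proof.
rewrite cabsM [X in _ * X]cabs_def /= expr0n expr1n add0r sqrtr1 mulr1.
exact: cabs_bool.
Qed.

Lemma cell_jacE s i j t : cell_jac s i j t =
  (re_jacobian s t i j)%:C + (0 +i* 1) * (im_jacobian s t i j)%:C.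
Proof. by rewrite !mxE; apply: eq_ReIm; rewrite /= ?ReD ?ImD ?ReM ?ImM /=; ring. Qed.

Lemma sum_delta (F : 'I_n -> C) i (c : C) :
  \sum_k ((i == k)%:R * c) * F k = c * F i.
Proof.
rewrite (bigD1 i) //= eqxx mul1r big1 ?addr0 // => k ki.
by rewrite eq_sym (negPf ki) !mul0r.
Qed.

Lemma cabs_jac_det s t : cabs (jac_det s t) <= vol_const * volume_density s t.
Proof.
apply: (@cabs_det_vol s t (\matrix_(i, j) (i == j)%:R)
  (\matrix_(i, j) ((i == j)%:R * (0 +i* 1)))).
- by move=> i j; rewrite mxE cabs_bool.
- by move=> i j; rewrite mxE cabs_bool_i.
apply/matrixP => i j; rewrite !mxE -/(re_coord _ _) -/(im_coord _ _).
transitivity (cell_jac s i j t); first by [].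
rewrite cell_jacE -[X in X + _]mul1r -(sum_delta (fun k => (re_jacobian s t k j)%:C) i 1)
  -(sum_delta (fun k => (im_jacobian s t k j)%:C) i (0 +i* 1)).
by congr (_ + _); apply: eq_bigr => k _; rewrite !mxE ?mulr1.
Qed.

Lemma cabs_det_row_re s t i l :
  cabs (\det (replace_row i (fun j => (re_jacobian s t l j)%:C)
    (fun a b => cell_jac s a b t))) <= vol_const * volume_density s t.
Proof.
apply: (@cabs_det_vol s t (\matrix_(a, k) ((if a == i then l else a) == k)%:R)
  (\matrix_(a, k) (((a != i) && (a == k))%:R * (0 +i* 1)))).
- by move=> a k; rewrite mxE cabs_bool.
- by move=> a k; rewrite mxE cabs_bool_i.
apply/matrixP => a b; rewrite [LHS]mxE [RHS]mxE ![in RHS]mxE.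
have E (x : 'I_n) : \sum_k (x == k)%:R * (re_jacobian s t k b)%:C = (re_jacobian s t x b)%:C.
  by rewrite -[RHS]mul1r -(sum_delta (fun k => (re_jacobian s t k b)%:C) x 1); apply: eq_bigr => k _; rewrite mulr1.
rewrite [X in _ = X + _](_ : _ = (re_jacobian s t (if a == i then l else a) b)%:C); last first.
  by rewrite -E; apply: eq_bigr => k _; rewrite !mxE.
case: (altP eqP) => [->|ai].
  by rewrite big1 ?addr0 // => k _; rewrite !mxE eqxx !mul0r.
rewrite cell_jacE -(sum_delta (fun k => (im_jacobian s t k b)%:C) a (0 +i* 1)); congr (_ + _).
by apply: eq_bigr => k _; rewrite !mxE ai.
Qed.

Lemma cabs_det_row_im s t i l :
  cabs (\det (replace_row i (fun j => (im_jacobian s t l j)%:C)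
    (fun a b => cell_jac s a b t))) <= vol_const * volume_density s t.
Proof.
apply: (@cabs_det_vol s t (\matrix_(a, k) ((a != i) && (a == k))%:R)
  (\matrix_(a, k) (if a == i then (l == k)%:R else (a == k)%:R * (0 +i* 1)))).
- by move=> a k; rewrite mxE cabs_bool.
- by move=> a k; rewrite mxE; case: ifP; rewrite ?cabs_bool ?cabs_bool_i.
apply/matrixP => a b; rewrite [LHS]mxE [RHS]mxE ![in RHS]mxE.
case: (altP eqP) => [->|ai].
  rewrite big1 ?add0r => [|k _]; last by rewrite !mxE eqxx !mul0r.
  rewrite -[LHS]mul1r -(sum_delta (fun k => (im_jacobian s t k b)%:C) l 1).
  by apply: eq_bigr => k _; rewrite !mxE eqxx mulr1.
rewrite cell_jacE -[X in X + _]mul1r.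
rewrite -(sum_delta (fun k => (re_jacobian s t k b)%:C) a 1) -(sum_delta (fun k => (im_jacobian s t k b)%:C) a (0 +i* 1)).
by congr (_ + _); apply: eq_bigr => k _; rewrite !mxE ?ai ?(negPf ai) ?mulr1.
Qed.

End VolumeDensity.
Arguments vol_const {R} n.


Section ComplexSeries.
Context {R : realType}.
Local Notation C := R[i].
Implicit Types (u v : nat -> C) (L : C).

Definition csum u L : Prop :=
  series (fun k => complex.Re (u k)) @ \oo --> complex.Re L /\
  series (fun k => complex.Im (u k)) @ \oo --> complex.Im L.

Lemma eq_cvgn (u v : nat -> R) (l : R) : u @ \oo --> l -> u =1 v -> v @ \oo --> l.
Proof. by move=> h /funext <-. Qed.

Lemma Re_sum I (r : seq I) (P : pred I) (F : I -> C) :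
  complex.Re (\sum_(i <- r | P i) F i) = \sum_(i <- r | P i) complex.Re (F i).
Proof. by elim/big_rec2: _ => [//|i y x _ <-]; rewrite ReD. Qed.

Lemma Im_sum I (r : seq I) (P : pred I) (F : I -> C) :
  complex.Im (\sum_(i <- r | P i) F i) = \sum_(i <- r | P i) complex.Im (F i).
Proof. by elim/big_rec2: _ => [//|i y x _ <-]; rewrite ImD. Qed.

Lemma csum_lim u L : csum u L -> limn (series u) = L.
Proof.
move=> [h1 h2].
have H : (series u : nat -> C^o) @ \oo --> (L : C^o).
  apply/cvgrPdist_le => e e0.
  have [er Ee] : exists er : R, e = er%:C.
    by exists (complex.Re e); apply: eq_ReIm => //=; rewrite ger0_Im // ltW.
  have {}e0 : 0 < er.
    by move: e0; rewrite Ee ltcE => /andP[].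
  have e2 : 0 < er / 2 by rewrite divr_gt0.
  move/cvgrPdist_le/(_ _ e2) in h1; move/cvgrPdist_le/(_ _ e2) in h2.
  rewrite Ee; near=> k.
  have b1 : `|complex.Re L - series (fun k => complex.Re (u k)) k| <= er / 2 by near: k.
  have b2 : `|complex.Im L - series (fun k => complex.Im (u k)) k| <= er / 2 by near: k.
  change (`|L - series u k| <= er%:C :> C).
  rewrite cabsE lecR (le_trans (cabs_le_ReIm _)) // ReD ImD ReN ImN.
  rewrite /series /= Re_sum Im_sum.
  move: b1 b2; rewrite /series /=; lra.
exact: (@cvg_lim C^o _ _ _ _ _ _ H).
Unshelve. all: by end_near. Qed.

Lemma csumD u v L L' : csum u L -> csum v L' -> csum (fun k => u k + v k) (L + L').
Proof.
move=> [h1 h2] [h3 h4]; split.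
  rewrite ReD; apply: (eq_cvgn (cvgD h1 h3)) => N.
  by rewrite fctE /series /= -big_split /=; apply: eq_bigr => k _; rewrite ReD.
rewrite ImD; apply: (eq_cvgn (cvgD h2 h4)) => N.
by rewrite fctE /series /= -big_split /=; apply: eq_bigr => k _; rewrite ImD.
Qed.

Lemma csumZ (a : C) u L : csum u L -> csum (fun k => a * u k) (a * L).
Proof.
move=> [h1 h2]; split.
  rewrite ReM.
  apply: (eq_cvgn (cvgB (cvgM (cvg_cst _) h1) (cvgM (cvg_cst _) h2))) => N.
  rewrite !fctE /= /series /= !big_distrr /= -sumrB.
  by apply: eq_bigr => k _; rewrite ReM.
rewrite ImM.
apply: (eq_cvgn (cvgD (cvgM (cvg_cst _) h2) (cvgM (cvg_cst _) h1))) => N.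
rewrite !fctE /= /series /= !big_distrr /= -big_split.
by apply: eq_bigr => k _; rewrite ImM.
Qed.

Lemma csum_unique u L L' : csum u L -> csum u L' -> L = L'.
Proof. by move=> /csum_lim <- /csum_lim. Qed.

Lemma dominated_series (u v : nat -> R) : (forall k, `|u k| <= v k) -> cvgn (series v) ->
  cvgn (series u) /\ `|limn (series u)| <= limn (series v).
Proof.
move=> uv cv.
have ca : cvgn [normed series u].
  have v0 k : 0 <= v k by exact: le_trans (normr_ge0 _) (uv k).
  by apply: (@series_le_cvg _ (fun k => `|u k|) v).
split; first exact: normed_cvg.
apply: (le_trans (lim_series_norm ca)).
exact: lim_series_le.
Qed.

Lemma dominated_csum u (v : nat -> R) : (forall k, cabs (u k) <= v k) ->
  cvgn (series v) -> exists2 L, csum u L & cabs L <= 2 * limn (series v).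
Proof.
move=> uv cv.
have [c1 b1] := dominated_series (fun k => le_trans (ler_Re_cabs _) (uv k)) cv.
have [c2 b2] := dominated_series (fun k => le_trans (ler_Im_cabs _) (uv k)) cv.
exists (limn (series (fun k => complex.Re (u k))) +i*
        limn (series (fun k => complex.Im (u k)))); first by split.
by rewrite (le_trans (cabs_le_ReIm _)) //= mulr2n mulrDl !mul1r lerD.
Qed.

End ComplexSeries.

Section Totals.
Context {R : realType} {n : nat}.
Variable mult : nat -> int.
Local Notation C := R[i].
Implicit Types (g : nat -> 'rV[R]_n -> C) (h : nat -> 'rV[R]_n -> R) (K : R).

Definition admissible h : Prop :=
  [/\ forall k, continuous (h k), forall k t, 0 <= h k t &
      cvgn (series (fun k => `|mult k|%:~R * cube_integral (h k)))].

Definition dominated h K g : Prop :=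
  forall k, ccont (g k) /\ forall t, cube t -> cabs (g k t) <= K * h k t.

Definition total_is g (L : C) : Prop :=
  csum (fun k => (mult k)%:~R * cube_integralC (g k)) L.

Definition mass h : R := limn (series (fun k => `|mult k|%:~R * cube_integral (h k))).

Lemma cabs_int (z : int) : cabs (z%:~R : C) = `|z|%:~R.
Proof. by apply: complexI; rewrite -cabsE rmorph_int intr_norm. Qed.

Lemma total_exists h K g : admissible h -> dominated h K g ->
  exists2 L, total_is g L & cabs L <= 4 * K * mass h.
Proof.
move=> [ch h0 sh] dg.
pose v k := (2 * K) * (`|mult k|%:~R * cube_integral (h k)).
have uv k : cabs ((mult k)%:~R * cube_integralC (g k)) <= v k.
  have [cg bg] := dg k.
  rewrite cabsM cabs_int /v mulrCA ler_wpM2l ?ler0z //.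
  rewrite -mulrA -cube_integralZ //; apply: cabs_cube_integralC => //.
  by apply: continuous_mul => //; exact: continuous_const.
have [] := dominated_csum uv.
  exact: is_cvg_seriesZ.
move=> L hL bL; exists L => //; apply: (le_trans bL).
have -> : 4 * K * mass h = 2 * ((2 * K) * mass h) by ring.
by rewrite -[v]/((2 * K) *: (fun k => `|mult k|%:~R * cube_integral (h k) : R^o)) lim_seriesZ.
Qed.

Lemma mass_ge0 h : admissible h -> 0 <= mass h.
Proof.
move=> [ch h0 sh]; apply: limr_ge => //; apply: nearW => N.
rewrite /series /=; apply: sumr_ge0 => k _; apply: mulr_ge0; first by rewrite ler0z.
by apply: cube_integral_ge0.
Qed.

Lemma total_eq g g' L : total_is g L -> (forall k t, cube t -> g k t = g' k t) ->
  total_is g' L.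
Proof.
move=> gL gg'; have E : (fun k => (mult k)%:~R * cube_integralC (g k)) =
   (fun k => (mult k)%:~R * cube_integralC (g' k)).
  by apply/funext => k; congr (_ * _); apply: eq_cube_integralC => t; exact: gg'.
by rewrite /total_is -E.
Qed.

Lemma totalD g g' L L' : (forall k, ccont (g k)) -> (forall k, ccont (g' k)) ->
  total_is g L -> total_is g' L' -> total_is (fun k t => g k t + g' k t) (L + L').
Proof.
move=> cg cg' h h'; have := csumD h h'; congr csum; apply/funext => k.
by rewrite cube_integralCD // mulrDr.
Qed.

Lemma totalZ (a : C) g L : (forall k, ccont (g k)) ->
  total_is g L -> total_is (fun k t => a * g k t) (a * L).
Proof.
move=> cg h; have := csumZ a h; congr csum; apply/funext => k.
by rewrite cube_integralCZ // mulrCA.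
Qed.

End Totals.


Section ExponentialBounds.
Context {R : realType}.
Local Notation C := R[i].

Lemma norm_expR_sub1 (a : R) : `|expR a - 1| <= `|a| * expR `|a|.
Proof.
have [c ca] := MVT_centered a (@is_derive_expR R).
rewrite expR0 => ->; rewrite normrM (gtr0_norm (expR_gt0 c)) ler_wpM2l //.
by rewrite ler_expR (le_trans (ler_norm c)).
Qed.

Lemma norm_sin_le (b : R) : `|sin b| <= `|b|.
Proof.
have [c _] := MVT_centered b (@is_derive_sin R).
rewrite sin0 subr0 => ->; rewrite normrM ler_piMr // ler_norml.
by rewrite cos_geN1 cos_le1.
Qed.

Lemma norm_cos_sub1 (b : R) : `|cos b - 1| <= b ^+ 2.
Proof.
have [c cb] := MVT_centered b (@is_derive_cos R).
rewrite cos0 => ->; rewrite normrM normrN -real_normK ?num_real // expr2 ler_pM //.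
by rewrite (le_trans (norm_sin_le c)).
Qed.

Lemma norm_sin_sub (b : R) : `|sin b - b| <= b ^+ 2.
Proof.
have [c cb] := MVT_centered b (@is_derive_sin R).
rewrite sin0 subr0 => ->.
have [c' cc] := MVT_centered c (@is_derive_cos R).
rewrite cos0 => E; rewrite -[X in _ - X]mulr1 -mulrBr E normrM -real_normK ?num_real // expr2.
rewrite ler_wpM2l // normrM normrN (le_trans _ cb) // ler_piMr // ler_norml.
by rewrite sin_geN1 sin_le1.
Qed.

Lemma norm_expR_sub1D (a : R) : `|expR a - 1 - a| <= a ^+ 2 * expR `|a|.
Proof.
have [c ca] := MVT_centered a (@is_derive_expR R).
rewrite expR0 => ->; rewrite -[X in _ - X]mulr1 -mulrBr normrM -real_normK ?num_real // expr2 -mulrA.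
rewrite ler_wpM2l // (le_trans (norm_expR_sub1 c)) //.
by rewrite ler_pM ?expR_ge0 // ler_expR.
Qed.

Lemma cabs_cexp_sub1D (z : C) :
  cabs (cexp z - 1 - z) <= 3 * (cabs z ^+ 2 * expR (cabs z)).
Proof.
apply: (le_trans (cabs_le_ReIm _)).
have ra := ler_Re_cabs z; have ib := ler_Im_cabs z.
move: ra ib; set Z := cabs z; case: z @Z => a b Z; rewrite [complex.Re _]/= [complex.Im _]/= => ra ib.
have Z0 : 0 <= Z by exact: cabs_ge0.
have eZ : expR `|a| <= expR Z by rewrite ler_expR.
have a2 : a ^+ 2 <= Z ^+ 2 by rewrite -[a ^+ 2]real_normK ?num_real // lerXn2r ?nnegrE.
have b2 : b ^+ 2 <= Z ^+ 2 by rewrite -[b ^+ 2]real_normK ?num_real // lerXn2r ?nnegrE.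
have ea : expR a <= expR Z by rewrite ler_expR (le_trans (ler_norm a)).
have e0 := expR_ge0 a.
have H1 : `|expR a - 1 - a| <= Z ^+ 2 * expR Z.
  by apply: (le_trans (norm_expR_sub1D a)); rewrite ler_pM ?sqr_ge0 ?expR_ge0.
have ab2 : a ^+ 2 + b ^+ 2 = Z ^+ 2.
  by rewrite /Z cabs_def sqr_sqrtr //= addr_ge0 ?sqr_ge0.
have H2 : `|expR a * (cos b - 1)| <= b ^+ 2 * expR Z.
  rewrite normrM (ger0_norm e0) mulrC ler_pM //; exact: norm_cos_sub1.
have H3 : `|expR a * (sin b - b)| <= b ^+ 2 * expR Z.
  rewrite normrM (ger0_norm e0) mulrC ler_pM //; exact: norm_sin_sub.
have H4 : `|(expR a - 1) * b| <= `|a| * `|b| * expR Z.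
  rewrite normrM mulrAC ler_wpM2r // (le_trans (norm_expR_sub1 a)) //.
  by rewrite ler_wpM2l.
have H1' : `|expR a - 1 - a| <= a ^+ 2 * expR Z.
  by apply: (le_trans (norm_expR_sub1D a)); rewrite ler_wpM2l ?sqr_ge0.
have ab : `|a| * `|b| <= Z ^+ 2.
  by rewrite expr2 ler_pM.
have E1 : complex.Re (cexp (a +i* b) - 1 - (a +i* b)) =
    (expR a - 1 - a) + expR a * (cos b - 1).
  by rewrite /cexp !ReD !ReN ReM /=; ring.
have E2 : complex.Im (cexp (a +i* b) - 1 - (a +i* b)) = expR a * (sin b - b) + (expR a - 1) * b.
  by rewrite /cexp !ImD !ImN ImM /=; ring.
rewrite E1 E2.
have T1 := ler_normD (expR a - 1 - a) (expR a * (cos b - 1)).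
have T2 := ler_normD (expR a * (sin b - b)) ((expR a - 1) * b).
have P1 : `|a| * `|b| * expR Z <= Z ^+ 2 * expR Z by rewrite ler_wpM2r ?expR_ge0.
have P2 : b ^+ 2 * expR Z <= Z ^+ 2 * expR Z by rewrite ler_wpM2r ?expR_ge0.
have P3 : a ^+ 2 * expR Z + b ^+ 2 * expR Z = Z ^+ 2 * expR Z by rewrite -mulrDl ab2.
lra.
Qed.

Lemma exp_dominates_power p (eta : R) : 0 < eta ->
  exists2 K : R, 0 <= K & forall y, 0 <= y -> (1 + y) ^+ p <= K * expR (eta * y).
Proof.
move=> eta0; pose e := Num.min 1 (eta / p.+1%:R).
have e0 : 0 < e by rewrite lt_min ltr01 divr_gt0.
have e1 : e <= 1 by rewrite ge_min lexx.
have ep : e * p%:R <= eta.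
  apply: (@le_trans _ _ (eta / p.+1%:R * p%:R)).
    by rewrite ler_wpM2r // ge_min lexx orbT.
  rewrite mulrAC ler_pdivrMr // ler_wpM2l ?ler_nat // ltW //.
exists (e^-1 ^+ p); first by rewrite exprn_ge0 // invr_ge0 ltW.
move=> y y0.
have h : 1 + y <= e^-1 * expR (e * y).
  rewrite -(ler_pM2l e0) mulrA mulfV ?gt_eqF // mul1r.
  apply: le_trans (expR_ge1Dx _); rewrite mulrDr mulr1 lerD2r //.
apply: (@le_trans _ _ ((e^-1 * expR (e * y)) ^+ p)).
  by rewrite lerXn2r // ?nnegrE ?mulr_ge0 ?invr_ge0 ?expR_ge0 ?addr_ge0 // ltW.
rewrite exprMn ler_wpM2l ?exprn_ge0 ?invr_ge0 ?(ltW e0) //.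
rewrite -expRM_natl ler_expR mulrA ler_wpM2r //.
by rewrite mulrC.
Qed.

Lemma quarter_turn (z : C) :
  exists u : 'I_4, cabs z <= 2 * complex.Re ((0 +i* 1) ^+ u * z).
Proof.
have i1 : ((0 : R) +i* 1) ^+ @Ordinal 4 1 isT = 0 +i* 1 by rewrite expr1.
have i2 : ((0 : R) +i* 1) ^+ @Ordinal 4 2 isT = (-1) +i* 0.
  by rewrite [LHS]sqr_i; apply: eq_ReIm; rewrite /= ?oppr0.
have i3 : ((0 : R) +i* 1) ^+ @Ordinal 4 3 isT = 0 +i* (-1).
  by rewrite [LHS]exprS [X in _ * X]i2; apply: eq_ReIm; rewrite ?ReM ?ImM /=; ring.
have i0 : ((0 : R) +i* 1) ^+ @Ordinal 4 0 isT = 1 +i* 0 by rewrite [LHS]expr0.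
have := cabs_le_ReIm z; case: z => a b; rewrite [complex.Re _]/= [complex.Im _]/= => h.
have [ab|ab] := leP `|b| `|a|.
- have [a0|a0] := leP 0 a.
    by exists (@Ordinal 4 0 isT); rewrite i0 ReM /=; move: h ab; rewrite (ger0_norm a0); lra.
  by exists (@Ordinal 4 2 isT); rewrite i2 ReM /=; move: h ab; rewrite (ltr0_norm a0); lra.
- have [b0|b0] := leP 0 b.
    by exists (@Ordinal 4 3 isT); rewrite i3 ReM /=; move: h ab; rewrite (ger0_norm b0); lra.
  by exists (@Ordinal 4 1 isT); rewrite i1 ReM /=; move: h ab; rewrite (ltr0_norm b0); lra.
Qed.

End ExponentialBounds.


Section Tempered.
Context {R : realType} {n d : nat}.
Local Notation C := R[i].
Local Notation N := #|exponents n d|.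
Implicit Types (a : 'rV[C]_N) (x : 'rV[C]_n).

Definition monomials (j : 'I_N) x : C := \prod_i x 0 i ^+ expo j i.

Lemma homogeneous_formE a x : homogeneous_form a x = \sum_j a 0 j * monomials j x.
Proof. by []. Qed.

Lemma homogeneous_formD a b x :
  homogeneous_form (a + b) x = homogeneous_form a x + homogeneous_form b x.
Proof.
by rewrite !homogeneous_formE -big_split; apply: eq_bigr => j _; rewrite mxE mulrDl.
Qed.

Lemma homogeneous_form_delta (z : C) j x :
  homogeneous_form (z *: delta_mx 0 j) x = z * monomials j x.
Proof.
rewrite homogeneous_formE (bigD1 j) //= big1 ?addr0 ?mxE ?eqxx ?mulr1 // => l lj.
by rewrite !mxE (negPf lj) andbF mulr0 mul0r.
Qed.

Definition monomial_norm x : R := \sum_j cabs (monomials j x).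

Lemma monomial_norm_ge0 x : 0 <= monomial_norm x.
Proof. by apply: sumr_ge0 => j _; exact: cabs_ge0. Qed.

Lemma cabs_monomials j x : cabs (monomials j x) <= monomial_norm x.
Proof.
rewrite /monomial_norm (bigD1 j) //= lerDl; apply: sumr_ge0 => l _; exact: cabs_ge0.
Qed.

Definition pulls_back_continuously (q : 'rV[C]_n -> C) : Prop :=
  forall m (s : 'rV[R]_m -> 'rV[C]_n),
    (forall i, ccont (fun t => s t 0 i)) -> ccont (fun t => q (s t)).

Definition tempered (q : 'rV[C]_n -> C) : Prop :=
  pulls_back_continuously q /\
  exists K p, 0 <= K /\ forall x, cabs (q x) <= K * (1 + monomial_norm x) ^+ p.

Lemma tempered_const (z : C) : tempered (fun _ => z).
Proof.
split; first by move=> m s _; exact: ccont_const.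
by exists (cabs z), 0%N; split; [exact: cabs_ge0|move=> x; rewrite expr0 mulr1].
Qed.

Lemma one_le_norm x : 1 <= 1 + monomial_norm x.
Proof. by rewrite lerDl monomial_norm_ge0. Qed.

Lemma temperedM q q' : tempered q -> tempered q' -> tempered (fun x => q x * q' x).
Proof.
move=> [cq [K [p [K0 hq]]]] [cq' [K' [p' [K0' hq']]]]; split.
  by move=> m s cs; apply: ccontM; [exact: cq|exact: cq'].
exists (K * K'), (p + p')%N; split; first exact: mulr_ge0.
by move=> x; rewrite cabsM exprD mulrACA ler_pM ?cabs_ge0.
Qed.

Lemma temperedD q q' : tempered q -> tempered q' -> tempered (fun x => q x + q' x).
Proof.
move=> [cq [K [p [K0 hq]]]] [cq' [K' [p' [K0' hq']]]]; split.
  by move=> m s cs; apply: ccontD; [exact: cq|exact: cq'].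
exists (K + K'), (p + p')%N; split; first exact: addr_ge0.
move=> x; apply: (le_trans (cabsD _ _)); rewrite mulrDl; apply: lerD.
  apply: (le_trans (hq x)); rewrite ler_wpM2l // ler_weXn2l ?one_le_norm //.
  exact: leq_addr.
apply: (le_trans (hq' x)); rewrite ler_wpM2l // ler_weXn2l ?one_le_norm //.
exact: leq_addl.
Qed.

Lemma tempered_sum I (r : seq I) (P : pred I) (q : I -> 'rV[C]_n -> C) :
  (forall i, tempered (q i)) -> tempered (fun x => \sum_(i <- r | P i) q i x).
Proof.
move=> h; elim: r => [|i r IH].
  by under eq_fun do rewrite big_nil; exact: tempered_const.
under eq_fun do rewrite big_cons; case: (P i) => //.
exact: temperedD.
Qed.

Lemma tempered_exp q k : tempered q -> tempered (fun x => q x ^+ k).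
Proof.
move=> tq; elim: k => [|k IH]; first exact: (tempered_const 1).
by under eq_fun do rewrite exprS; exact: temperedM.
Qed.

Lemma tempered_prod I (r : seq I) (P : pred I) (q : I -> 'rV[C]_n -> C) :
  (forall i, tempered (q i)) -> tempered (fun x => \prod_(i <- r | P i) q i x).
Proof.
move=> h; elim: r => [|i r IH].
  by under eq_fun do rewrite big_nil; exact: tempered_const.
under eq_fun do rewrite big_cons; case: (P i) => //.
exact: temperedM.
Qed.

Lemma tempered_monomials j : tempered (monomials j).
Proof.
split; first by move=> m s cs; apply: ccont_prod => i; exact: ccontX.
exists 1, 1%N; split => // x; rewrite mul1r expr1.
by rewrite (le_trans (cabs_monomials j x)) // lerDr.
Qed.

Lemma tempered_form a : tempered (homogeneous_form a).
Proof.
apply: tempered_sum => j; apply: temperedM; first exact: tempered_const.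
exact: tempered_monomials.
Qed.

Lemma tempered_exp_bound q (eta : R) : 0 < eta -> tempered q ->
  exists2 K : R, 0 <= K & forall x, cabs (q x) <= K * expR (eta * monomial_norm x).
Proof.
move=> eta0 [_ [K [p [K0 hq]]]].
have [K' K'0 H] := exp_dominates_power p eta0.
exists (K * K'); first exact: mulr_ge0.
move=> x; apply: (le_trans (hq x)); rewrite -mulrA ler_wpM2l //.
exact/H/monomial_norm_ge0.
Qed.

Lemma expo_surj (m : multinom n) : mdeg m = d -> exists j : 'I_N, expo j = m.
Proof.
move=> md; have mb : (mdeg m < d.+1)%N by rewrite md.
have mx : mdeg (bmnm (BMultinom mb)) == d by rewrite /= md.
exists (enum_rank (exist _ (BMultinom mb) mx : exponents n d)).
by rewrite /expo enum_rankK.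
Qed.

Lemma pure_power_expo (i : 'I_n) :
  exists j : 'I_N, forall l, expo j l = (if l == i then d else 0)%N.
Proof.
have [|j ej] := @expo_surj (mnm_muln (mnm1 i) d); first by rewrite mdegMn mdeg1 mul1n.
exists j => l; rewrite ej mulmnE mnm1E eq_sym.
by case: eqP => _; rewrite ?mul1n ?mul0n.
Qed.

Lemma cabs_coord_le (hd : (0 < d)%N) x i : cabs (x 0 i) <= 1 + monomial_norm x.
Proof.
have [j hj] := pure_power_expo i.
have E : cabs (monomials j x) = cabs (x 0 i) ^+ d.
  rewrite /monomials cabs_prod (bigD1 i) //= hj eqxx cabsX big1 ?mulr1 // => l li.
  by rewrite hj (negPf li) expr0 cabs1.
have [h|h] := leP (cabs (x 0 i)) 1; first exact: le_trans h (one_le_norm x).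
apply: (@le_trans _ _ (cabs (monomials j x))).
  by rewrite E -[X in X <= _]expr1 ler_weXn2l // ltW.
by rewrite (le_trans (cabs_monomials j x)) // lerDr.
Qed.

Lemma tempered_coord (hd : (0 < d)%N) i : tempered (fun x => x 0 i).
Proof.
split; first by move=> m s; exact.
by exists 1, 1%N; split => // x; rewrite mul1r expr1 cabs_coord_le.
Qed.

End Tempered.
Arguments monomial_norm {R n} d x.
Arguments tempered {R n} d q.

Lemma nbhs_coordwise {R : realType} {N : nat} (U : set 'rV[R[i]]_N) (a : 'rV[R[i]]_N) :
  nbhs a U ->
  exists2 e : R, 0 < e & forall y : 'rV[R[i]]_N, (forall j, cabs (y 0 j - a 0 j) < e) -> U y.
Proof.
move=> /nbhs_ballP[e /= e0 He].
move: (e0); rewrite ltcE => /andP[/eqP Ie Re]; exists (complex.Re e) => //.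
have Ee : e = (complex.Re e)%:C by apply: eq_ReIm.
move=> y Hy; apply: He; split => // i j; rewrite ord1.
change (`|a 0 j - y 0 j| < e :> R[i]).
by rewrite Ee cabsE ltcR -cabsN opprB.
Qed.

Section Weights.
Context {R : realType} {n d : nat} (c : contour R n).
Local Notation C := R[i].
Local Notation N := #|exponents n d|.
Implicit Types (a : 'rV[C]_N).

Lemma cell_smooth k : smooth (cell c k).
Proof. by case: c. Qed.

Lemma cell_ccont k i : ccont (fun t => cell c k t 0 i).
Proof.
split; first by have [] := (cell_smooth k 0%N i).1.
by have [] := (cell_smooth k 0%N i).2.
Qed.

Definition weight (del : R) a (k : nat) (t : 'rV[R]_n) : R :=
  expR (del * @monomial_norm R n d (cell c k t)) *
  cabs (cexp (homogeneous_form a (cell c k t))) * volume_density (cell c k) t.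

Lemma weight_ge0 del a k t : 0 <= weight del a k t.
Proof. by rewrite /weight !mulr_ge0 ?expR_ge0 ?cabs_ge0 // volume_density_ge0. Qed.

Lemma continuous_weight del a k : continuous (weight del a k).
Proof.
apply: continuous_mul; last by apply: continuous_volume_density; exact: cell_smooth.
apply: continuous_mul.
  move=> t; apply: (@continuous_comp _ _ _ (fun t => del * @monomial_norm R n d (cell c k t)) expR).
    apply: continuous_mul; first exact: continuous_const.
    apply: continuous_sum => j; apply: ccont_cabs.
    by have [h _] := @tempered_monomials R n d j; apply: h; exact: cell_ccont.
  exact: continuous_expR.
apply: ccont_cabs; apply: ccont_cexp.
by have [h _] := tempered_form a; apply: h; exact: cell_ccont.
Qed.

Lemma admissible_sum (I : finType) (h : I -> nat -> 'rV[R]_n -> R) :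
  (forall i, admissible (mult c) (h i)) ->
  admissible (mult c) (fun k t => \sum_i h i k t).
Proof.
move=> H; split.
- by move=> k; apply: continuous_sum => i; have [ch _ _] := H i; exact: ch.
- by move=> k t; apply: sumr_ge0 => i _; have [_ h0 _] := H i; exact: h0.
pose u i k : R^o := `|mult c k|%:~R * cube_integral (h i k).
have E : (fun k => `|mult c k|%:~R * cube_integral (fun t => \sum_i h i k t)) =
         (fun k => \sum_i u i k).
  apply/funext => k; rewrite /u -big_distrr /=; congr (_ * _).
  elim: (index_enum I) => [|i r IH].
    by rewrite big_nil -[RHS](@cube_integral0 R n); apply: eq_cube_integral => t _; rewrite big_nil.
  rewrite big_cons -IH -cube_integralD.
  - by apply: eq_cube_integral => t _; rewrite big_cons.
  - by have [ch _ _] := H i; exact: ch.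
  - by apply: continuous_sum => i'; have [ch _ _] := H i'; exact: ch.
rewrite E; elim: (index_enum I) => [|i r IH].
  under eq_fun do rewrite big_nil.
  by apply: (is_cvg_near_cst 0); apply: nearW => k; rewrite /series /= big1.
under eq_fun do rewrite big_cons.
by apply: is_cvg_seriesD => //; have [] := H i.
Qed.

Lemma weight0E a : (forall k t, weight 0 a k t =
  complex.Re `|cexp (homogeneous_form a (cell c k t))| * volume_density (cell c k) t).
Proof. by move=> k t; rewrite /weight mul0r expR0 mul1r. Qed.

Lemma exists_large_monomial (hN : (0 < N)%N) (x : 'rV[C]_n) :
  exists j : 'I_N, @monomial_norm R n d x <= N%:R * cabs (monomials j x).
Proof.
apply: contrapT => /forallNP h.
have : \sum_(j < N) N%:R * cabs (monomials j x) < \sum_(j < N) @monomial_norm R n d x.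
  apply: ltr_sum; last by move=> j _; move/negP: (h j); rewrite -ltNge.
  by apply/hasP; exists (Ordinal hN); rewrite ?mem_index_enum.
by rewrite sumr_const card_ord -big_distrr /= mulr_natl ltxx.
Qed.

Lemma admissible_weight (hN : (0 < N)%N) (U : set 'rV[C]_N) a : open U -> U a ->
  (forall a, U a -> absolutely_integrable c (fun x => cexp (homogeneous_form a x))) ->
  exists2 del : R, 0 < del & admissible (mult c) (weight del a).
Proof.
move=> oU Ua hint.
have [tau tau0 Htau] : exists2 tau : R, 0 < tau & forall (p : 'I_N * 'I_4),
    U (a + (tau%:C * (0 +i* 1) ^+ p.2) *: delta_mx 0 p.1).
  have [e e0 He] := nbhs_coordwise (open_nbhs_nbhs (conj oU Ua)).
  have e2 : 0 < e / 2 by rewrite divr_gt0.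
  exists (e / 2) => // p; apply: He => j; rewrite !mxE addrAC subrr add0r !cabsM.
  have -> : cabs ((0 +i* 1 : C) ^+ p.2) = 1.
    by rewrite cabsX cabs_def /= expr0n expr1n add0r sqrtr1 expr1n.
  rewrite cabsR mulr1 gtr0_norm //.
  apply: (@le_lt_trans _ _ (e / 2)); last lra.
  by rewrite ler_piMr ?(ltW e2) ?cabs_bool.
pose b (p : 'I_N * 'I_4) := a + (tau%:C * (0 +i* 1) ^+ p.2) *: delta_mx 0 p.1.
have NR : 0 < (N%:R : R) by rewrite ltr0n.
pose del := tau / (2 * N%:R).
have del0 : 0 < del by rewrite divr_gt0 // mulr_gt0.
exists del => //.
have adm : admissible (mult c) (fun k t => \sum_p weight 0 (b p) k t).
  apply: admissible_sum => p; split; [exact: continuous_weight|exact: weight_ge0|].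
  have := hint _ (Htau p); rewrite /absolutely_integrable.
  by under eq_fun do under eq_fun do rewrite -weight0E.
have [cb b0 sb] := adm.
split; [exact: continuous_weight|exact: weight_ge0|].
have I0 k (h : 'rV[R]_n -> R) : continuous h -> (forall t, 0 <= h t) -> 0 <= (`|mult c k|%:~R : R) * @cube_integral R n h.
  by move=> ch h0; rewrite mulr_ge0 // ?ler0z // cube_integral_ge0.
apply: (@series_le_cvg _ _ (fun k => `|mult c k|%:~R * cube_integral (fun t => \sum_p weight 0 (b p) k t))) => //.
- by move=> k; apply: I0; [exact: continuous_weight|exact: weight_ge0].
- by move=> k; apply: I0.
move=> k; rewrite ler_wpM2l ?ler0z //; apply: le_cube_integral => //.
  exact: continuous_weight.
move=> t _; set x := cell c k t.
have [j hj] := exists_large_monomial hN x.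
have [u hu] := quarter_turn (monomials j x).
rewrite (bigD1 (j, u)) //= -[leLHS]addr0; apply: lerD; last first.
  by apply: sumr_ge0 => p _; exact: weight_ge0.
rewrite /weight mul0r expR0 mul1r -/x ler_wpM2r ?volume_density_ge0 //.
rewrite /b homogeneous_formD homogeneous_form_delta !cabs_cexp -expRD ler_expR addrC ReD lerD2l.
rewrite -mulrA ReM /= mul0r subr0 /del mulrAC ler_pdivrMr ?mulr_gt0 //.
rewrite -mulrA (ler_wpM2l (ltW tau0)) // (le_trans hj) // mulrA mulrC.
by rewrite (ler_wpM2r (ltW NR)) // mulrC.
Qed.

End Weights.


Section ComplexDifferentials.
Context {R : realType} {N : nat}.
Local Notation C := R[i].

Lemma mx_norm_R (h : 'rV[C]_N) : `|h| = (complex.Re `|h|)%:C.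
Proof. by apply: eq_ReIm => //=; rewrite ger0_Im. Qed.

Lemma cabs_le_mx_norm (h : 'rV[C]_N) j : cabs (h 0 j) <= complex.Re `|h|.
Proof.
apply/ler_addgt0Pr => e e0.
have : ball (0 : 'rV[C]_N) ((complex.Re `|h| + e)%:C) h.
  rewrite mx_norm_ball /ball_ /= sub0r normrN mx_norm_R ltcR; lra.
move=> [_ /(_ 0 j)] H.
have : `|(0 : 'rV[C]_N) 0 j - h 0 j| < (complex.Re `|h| + e)%:C by exact: H.
by rewrite mxE sub0r normrN cabsE ltcR => /ltW.
Qed.

Definition dot_form (l : 'I_N -> C) (h : 'rV[C]_N) : C^o := \sum_j h 0 j * l j.

Lemma dot_form_linear l : linear (dot_form l).
Proof.
move=> z u v; rewrite /dot_form scaler_sumr -big_split /=.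
by apply: eq_bigr => j _; rewrite !mxE mulrDl /GRing.scale /= mulrA.
Qed.

HB.instance Definition _ l :=
  GRing.isLinear.Build C 'rV[C]_N C^o _ (dot_form l) (dot_form_linear l).

Lemma dot_form_continuous l : continuous (dot_form l).
Proof.
suff H (r : seq 'I_N) : continuous (fun h : 'rV[C]_N => (\sum_(j <- r) h 0 j * l j) : C^o).
  exact: H.
elim: r => [|j r IH].
  have -> : (fun h : 'rV[C]_N => (\sum_(j <- [::]) h 0 j * l j) : C^o) = fun=> 0.
    by apply/funext => h; rewrite big_nil.
  by move=> h; exact: cst_continuous.
have -> : (fun h : 'rV[C]_N => (\sum_(i <- j :: r) h 0 i * l i) : C^o) =
    fun h : 'rV[C]_N => (h 0 j * l j : C^o) + (\sum_(i <- r) h 0 i * l i : C^o).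
  by apply/funext => h; rewrite big_cons.
move=> h.
have h1 : (fun h : 'rV[C]_N => (h 0 j * l j : C^o)) x @[x --> h] --> (h 0 j * l j : C^o).
  apply: (@cvgM C _ (nbhs h) _ (fun x : 'rV[C]_N => x 0 j : C^o) (cst (l j : C^o))).
    exact: coord_continuous.
  exact: cst_continuous.
exact: (cvgD h1 (IH h)).
Qed.

Lemma quadratic_remainder_differentiable (f : 'rV[C]_N -> C^o) (l : 'I_N -> C)
    (a : 'rV[C]_N) (K e : R) : 0 < e -> 0 <= K ->
  (forall (h : 'rV[C]_N) (r : R), 0 <= r <= e -> (forall j, cabs (h 0 j) <= r) ->
     cabs (f (a + h) - f a - dot_form l h) <= K * r ^+ 2) ->
  differentiable f a /\ forall v, 'D_v f a = dot_form l v.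
Proof.
move=> e0 K0 H.
have E : f \o shift a = cst (f a) + dot_form l +o_ (0 : 'rV[C]_N) id.
  apply/eqaddoP => eps eps0.
  move: (eps0); rewrite ltcE => /andP[/eqP Ie Re].
  have Ee : eps = (complex.Re eps)%:C by apply: eq_ReIm.
  pose r0 := Num.min e (complex.Re eps / (K + 1)).
  have K1 : 0 < K + 1 by lra.
  have r00 : 0 < r0 by rewrite lt_min e0 divr_gt0.
  apply/nbhs_ballP; exists r0%:C; first by rewrite /= ltcR.
  move=> h; rewrite mx_norm_ball /ball_ /= sub0r normrN mx_norm_R ltcR => hr.
  have hr0 : 0 <= complex.Re `|h| by rewrite -lecR -mx_norm_R normr_ge0.
  move: hr; rewrite lt_min => /andP[he hq].
  have -> : (f \o shift a - (cst (f a) + dot_form l)) h = f (a + h) - f a - dot_form l h.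
    have E : shift a h = a + h by rewrite /shift addrC.
    by rewrite -E -addrA -opprD.
  change (`|f (a + h) - f a - dot_form l h : C| <= eps * (complex.Re `|h|)%:C :> C).
  rewrite {1}Ee cabsE -rmorphM /= lecR.
  apply: (@le_trans _ _ (K * complex.Re `|h| ^+ 2)).
    by apply: H; [rewrite hr0 ltW|exact: cabs_le_mx_norm].
  rewrite expr2 mulrA ler_wpM2r //; move/ltW: hq; rewrite ler_pdivlMr // => hq.
  by apply: le_trans hq; rewrite mulrDr mulr1 mulrC lerDl.
have dE := diff_unique (@dot_form_continuous l) E.
have df : differentiable f a.
  apply/diff_locallyP; rewrite dE; split => //; exact: dot_form_continuous.
by split => // v; rewrite deriveE // dE.
Qed.

End ComplexDifferentials.


Section Moments.
Context {R : realType} {n d : nat} (c : contour R n).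
Local Notation C := R[i].
Local Notation N := #|exponents n d|.
Implicit Types (a h : 'rV[C]_N) (q : 'rV[C]_n -> C).

Definition moment q a : C :=
  contour_integral c (fun x => q x * cexp (homogeneous_form a x)).

Definition moment_integrand q a (k : nat) (t : 'rV[R]_n) : C :=
  q (cell c k t) * cexp (homogeneous_form a (cell c k t)) * jac_det (cell c k) t.

Lemma eq_moment q q' a : q =1 q' -> moment q a = moment q' a.
Proof. by move=> /funext ->. Qed.

Lemma ccont_jac_det k : ccont (jac_det (cell c k)).
Proof.
rewrite (funext (jac_detE (cell c k))); apply: ccont_det => i j.
under eq_fun do rewrite mxE.
exact: cpartial_ccont (smooth_cpartial2 i j j (cell_smooth c k)).
Qed.

Lemma ccont_pull q k : pulls_back_continuously q -> ccont (fun t => q (cell c k t)).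
Proof. by move=> cq; apply: cq; exact: cell_ccont. Qed.

Lemma pulls_back_cexp q : pulls_back_continuously q ->
  pulls_back_continuously (fun x => cexp (q x)).
Proof. by move=> cq m s cs; apply: ccont_cexp; exact: cq. Qed.

Lemma ccont_moment_integrand q a k : pulls_back_continuously q ->
  ccont (moment_integrand q a k).
Proof.
move=> cq; apply: ccontM; last exact: ccont_jac_det.
apply: ccontM; first exact: ccont_pull.
apply: (ccont_pull (q := fun x => cexp (homogeneous_form a x))).
by apply: pulls_back_cexp; have [] := tempered_form a.
Qed.

Lemma total_moment del a q (K : R) : admissible (mult c) (weight c del a) ->
  0 <= K -> pulls_back_continuously q ->
  (forall x, cabs (q x) <= K * expR (del * monomial_norm d x)) ->
  total_is (mult c) (moment_integrand q a) (moment q a) /\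
  cabs (moment q a) <= K * (4 * vol_const n * mass (mult c) (weight c del a)).
Proof.
move=> adm K0 cq qK.
have dom : dominated (weight c del a) (K * vol_const n) (moment_integrand q a).
  move=> k; split; first exact: ccont_moment_integrand.
  move=> t _; rewrite /moment_integrand 2!cabsM /weight.
  rewrite [leRHS](_ : _ = (K * expR (del * monomial_norm d (cell c k t)) *
     cabs (cexp (homogeneous_form a (cell c k t)))) * (vol_const n * volume_density (cell c k) t)); last by ring.
  apply: ler_pM; [|exact: cabs_ge0| |exact: cabs_jac_det].
    by apply: mulr_ge0; exact: cabs_ge0.
  by rewrite ler_wpM2r ?cabs_ge0.
have [L tL bL] := total_exists adm dom.
have -> : moment q a = L by exact: csum_lim tL.
by split => //; apply: (le_trans bL); rewrite le_eqVlt; apply/orP; left; apply/eqP; ring.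
Qed.

Lemma total_moment_tempered del a q : 0 < del ->
  admissible (mult c) (weight c del a) -> tempered d q ->
  total_is (mult c) (moment_integrand q a) (moment q a).
Proof.
move=> d0 adm tq; have [K K0 HK] := tempered_exp_bound d0 tq.
by have [] := total_moment adm K0 tq.1 HK.
Qed.

Lemma momentD del a q q' : 0 < del -> admissible (mult c) (weight c del a) ->
  tempered d q -> tempered d q' ->
  moment (fun x => q x + q' x) a = moment q a + moment q' a.
Proof.
move=> d0 adm tq tq'.
have t1 := total_moment_tempered d0 adm tq; have t2 := total_moment_tempered d0 adm tq'.
have t3 := total_moment_tempered d0 adm (temperedD tq tq').
apply: (csum_unique t3); apply: (total_eq (totalD _ _ t1 t2)).
- by move=> k; apply: ccont_moment_integrand; exact: tq.1.
- by move=> k; apply: ccont_moment_integrand; exact: tq'.1.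
by move=> k t _; rewrite /moment_integrand !mulrDl.
Qed.

Lemma momentZ del a (z : C) q : 0 < del -> admissible (mult c) (weight c del a) ->
  tempered d q -> moment (fun x => z * q x) a = z * moment q a.
Proof.
move=> d0 adm tq.
have t1 := total_moment_tempered d0 adm tq.
have t3 := total_moment_tempered d0 adm (temperedM (tempered_const z) tq).
apply: (csum_unique t3); apply: (total_eq (totalZ z _ t1)).
- by move=> k; apply: ccont_moment_integrand; exact: tq.1.
by move=> k t _; rewrite /moment_integrand !mulrA.
Qed.

Lemma moment0 a : moment (fun _ => 0) a = 0.
Proof.
rewrite /moment /contour_integral.
rewrite (_ : (fun _ => _) = fun _ => 0); last first.
  apply/funext => k; rewrite (_ : cube_integralC _ = 0) ?mulr0 //.
  by rewrite -[RHS](@cube_integralC0 R n); apply: eq_cube_integralC => t _; rewrite !mul0r.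
apply: csum_lim; split => /=; apply: (eq_cvgn (cvg_cst 0)) => k;
  by rewrite /series /= big1.
Qed.

Lemma moment_sum del a I (r : seq I) (q : I -> 'rV[C]_n -> C) : 0 < del ->
  admissible (mult c) (weight c del a) -> (forall i, tempered d (q i)) ->
  moment (fun x => \sum_(i <- r) q i x) a = \sum_(i <- r) moment (q i) a.
Proof.
move=> d0 adm tq; elim: r => [|i r IH].
  by rewrite [RHS]big_nil -[RHS](moment0 a); apply: eq_moment => x; rewrite big_nil.
rewrite big_cons -IH -(momentD d0 adm) //; last exact: tempered_sum.
by apply: eq_moment => x; rewrite big_cons.
Qed.

Lemma cabs_form_le h (r : R) x : (forall j, cabs (h 0 j) <= r) ->
  cabs (homogeneous_form h x) <= r * monomial_norm d x.
Proof.
move=> hr; rewrite homogeneous_formE; apply: (le_trans (cabs_sum _ _ _)).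
rewrite /monomial_norm big_distrr /=; apply: ler_sum => j _.
by rewrite cabsM ler_wpM2r ?cabs_ge0.
Qed.

Lemma moment_remainder del a q : 0 < del ->
  admissible (mult c) (weight c del a) -> tempered d q ->
  exists K e : R, [/\ 0 <= K, 0 < e & forall h (r : R), 0 <= r <= e ->
    (forall j, cabs (h 0 j) <= r) ->
    cabs (moment q (a + h) - moment q a -
      dot_form (fun j => moment (fun x => q x * monomials j x) a) h) <= K * r ^+ 2].
Proof.
move=> d0 adm tq.
pose eta := del / 4; have eta0 : 0 < eta by rewrite divr_gt0.
have [K1 K10 H1] := tempered_exp_bound eta0 tq.
have [K2 K20 H2] := exp_dominates_power 2 eta0.
pose B := 4 * vol_const n * mass (mult c) (weight c del a).
have B0 : 0 <= B by rewrite !mulr_ge0 ?vol_const_ge0 ?mass_ge0.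
exists (K1 * (3 * K2) * B), eta; split => //.
  by apply: mulr_ge0 => //; apply: mulr_ge0 => //; exact: mulr_ge0.
move=> h r /andP[r0 re] hr.
have Ph := cabs_form_le _ hr.
have E0 x := @monomial_norm_ge0 R n d x.
pose rem x := cexp (homogeneous_form h x) - 1 - homogeneous_form h x.
have tP := tempered_form h.
have remb x : cabs (q x * rem x) <= (K1 * (3 * K2) * r ^+ 2) * expR (del * monomial_norm d x).
  have b1 : cabs (rem x) <= 3 * ((r * monomial_norm d x) ^+ 2 * expR (r * monomial_norm d x)).
    apply: (le_trans (cabs_cexp_sub1D _)); rewrite ler_wpM2l //.
    apply: ler_pM; rewrite ?exprn_ge0 ?expR_ge0 ?cabs_ge0 ?ler_expR //.
    by rewrite lerXn2r ?nnegrE ?cabs_ge0 // mulr_ge0.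
  have b2 : (monomial_norm d x) ^+ 2 <= K2 * expR (eta * monomial_norm d x).
    apply: le_trans (H2 _ (E0 x)).
    by rewrite lerXn2r ?nnegrE ?addr_ge0 // lerDr.
  have b3 : expR (r * monomial_norm d x) <= expR (eta * monomial_norm d x).
    by rewrite ler_expR ler_wpM2r.
  have e3 : expR (eta * monomial_norm d x) ^+ 3 <= expR (del * monomial_norm d x).
    rewrite -expRM_natl ler_expR mulrA ler_wpM2r // /eta; lra.
  have e0 := expR_ge0 (eta * monomial_norm d x).
  rewrite cabsM.
  apply: (@le_trans _ _ ((K1 * expR (eta * monomial_norm d x)) *
    (3 * (r ^+ 2 * (K2 * expR (eta * monomial_norm d x)) * expR (eta * monomial_norm d x))))).
    apply: ler_pM; rewrite ?cabs_ge0 //; apply: (le_trans b1).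
    rewrite ler_wpM2l // exprMn; apply: ler_pM; rewrite ?mulr_ge0 ?exprn_ge0 ?expR_ge0 //.
    by rewrite ler_wpM2l ?exprn_ge0.
  rewrite [leLHS](_ : _ = (K1 * (3 * K2) * r ^+ 2) * expR (eta * monomial_norm d x) ^+ 3); last by ring.
  by rewrite ler_wpM2l // !mulr_ge0 ?exprn_ge0.
have cq := tq.1.
have crem : pulls_back_continuously rem.
  move=> m s cs; apply: ccontD; last by apply: ccontN; apply: tP.1.
  apply: ccontD; last by apply: ccontN; exact: ccont_const.
  by apply: pulls_back_cexp => //; exact: tP.1.
have cqr : pulls_back_continuously (fun x => q x * rem x).
  by move=> m s cs; apply: ccontM; [exact: cq|exact: crem].
have C0 : 0 <= K1 * (3 * K2) * r ^+ 2 by rewrite !mulr_ge0 ?exprn_ge0.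
have [tr br] := total_moment adm C0 cqr remb.
have -> : dot_form (fun j => moment (fun x => q x * monomials j x) a) h =
    moment (fun x => q x * homogeneous_form h x) a.
  rewrite /dot_form.
  transitivity (moment (fun x => \sum_j h 0 j * (q x * monomials j x)) a); last first.
    apply: eq_moment => x; rewrite homogeneous_formE big_distrr /=.
    by apply: eq_bigr => j _; rewrite mulrCA.
  have tm (j : 'I_N) : tempered d (fun x => q x * monomials j x).
    exact: (temperedM tq (tempered_monomials j)).
  rewrite (moment_sum _ d0 adm); last by move=> j; exact: (temperedM (tempered_const _) (tm j)).
  by apply: eq_bigr => j _; rewrite (momentZ _ d0 adm).
suff -> : moment q (a + h) = moment q a + moment (fun x => q x * homogeneous_form h x) a
    + moment (fun x => q x * rem x) a.
  rewrite (_ : _ + _ + _ - _ - _ = moment (fun x => q x * rem x) a); last by ring.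
  by apply: (le_trans br); rewrite le_eqVlt; apply/orP; left; apply/eqP; rewrite /B; ring.
have t1 := total_moment_tempered d0 adm tq.
have tqP := temperedM tq tP.
have t2 := total_moment_tempered d0 adm tqP.
apply: csum_lim.
have cc q' k : pulls_back_continuously q' -> ccont (moment_integrand q' a k).
  exact: ccont_moment_integrand.
have T := totalD _ _ (totalD _ _ t1 t2) tr.
apply: (@total_eq _ _ (mult c)
  (fun k t => moment_integrand q a k t + moment_integrand (fun x => q x * homogeneous_form h x) a k t
     + moment_integrand (fun x => q x * rem x) a k t)); last first.
  move=> k t _; rewrite /moment_integrand homogeneous_formD cexpD /rem; ring.
apply: T => k; [apply: ccontD| | |]; apply: cc => //; exact: tqP.1.
Qed.

End Moments.


Section MomentSystem.
Context {R : realType} {n d : nat} (c : contour R n).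
Local Notation C := R[i].
Local Notation N := #|exponents n d|.
Variable U : set 'rV[C]_N.
Hypothesis oU : open U.
Hypothesis admU : forall a, U a ->
  exists2 del : R, 0 < del & admissible (mult c) (weight c del a).
Implicit Types (q : 'rV[C]_n -> C) (psi : 'rV[C]_N -> C^o).

Lemma derive_eq_moment psi q : tempered d q -> (forall a, U a -> psi a = moment c q a) ->
  forall a, U a -> differentiable psi a /\
    forall v, 'D_v psi a = \sum_j v 0 j * moment c (fun x => q x * monomials j x) a.
Proof.
move=> tq E a Ua; have [del d0 adm] := admU Ua.
have [K [e [K0 e0 H]]] := moment_remainder d0 adm tq.
have [e' e'0 He'] := nbhs_coordwise (open_nbhs_nbhs (conj oU Ua)).
apply: (@quadratic_remainder_differentiable _ _ psi _ a K (Num.min e (e' / 2))) => //.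
  by rewrite lt_min e0 divr_gt0.
move=> h r /andP[r0]; rewrite le_min => /andP[re re'] hr.
rewrite !E //; first by apply: H => //; rewrite r0.
apply: He' => j; rewrite mxE addrAC subrr add0r; apply: (le_lt_trans (hr j)); lra.
Qed.

Lemma partial_eq_moment psi q j : tempered d q -> (forall a, U a -> psi a = moment c q a) ->
  forall a, U a -> 'D_(delta_mx 0 j) psi a = moment c (fun x => q x * monomials j x) a.
Proof.
move=> tq E a Ua; have [_ ->] := derive_eq_moment tq E Ua.
rewrite (bigD1 j) //= mxE !eqxx mul1r big1 ?addr0 // => l lj.
by rewrite mxE (negPf lj) andbF mul0r.
Qed.

Lemma pderiv_eq_moment psi q (m : multinom N) :
  tempered d q -> (forall a, U a -> psi a = moment c q a) ->
  forall a, U a ->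
    pderiv m psi a = moment c (fun x => q x * \prod_j monomials j x ^+ m j) a.
Proof.
move=> tq E.
suff H (s : seq 'I_N) : tempered d (fun x : 'rV[C]_n => \prod_(j <- s) monomials j x ^+ m j) /\
    forall a, U a -> foldr (fun (j : 'I_N) psi =>
       iter (m j) (fun chi : 'rV[C]_N -> C^o => 'D_(delta_mx 0 j) chi) psi) psi s a =
     moment c (fun x => q x * \prod_(j <- s) monomials j x ^+ m j) a.
  by move=> a Ua; rewrite /pderiv (H _).2 //; apply: eq_moment => x; rewrite big_enum.
elim: s => [|j s [ts IH]].
  split; first by under eq_fun do rewrite big_nil; exact: tempered_const.
  move=> a Ua /=; rewrite E //; apply: eq_moment => x.
  by rewrite big_nil mulr1.
have tjs k : tempered d (fun x : 'rV[C]_n => monomials j x ^+ k * \prod_(j <- s) monomials j x ^+ m j).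
  by apply: temperedM => //; apply: tempered_exp; exact: tempered_monomials.
split; first by under eq_fun do rewrite big_cons; exact: tjs.
move=> a Ua /=.
transitivity (moment c (fun x => q x *
    (monomials j x ^+ m j * \prod_(j <- s) monomials j x ^+ m j)) a); last first.
  by apply: eq_moment => x; rewrite big_cons.
elim: (m j) a Ua => [|k IHk] a Ua /=.
  by rewrite IH //; apply: eq_moment => x; rewrite mul1r.
rewrite (partial_eq_moment (q := fun x => q x * (monomials j x ^+ k * \prod_(j <- s) monomials j x ^+ m j))) //.
  by apply: eq_moment => x; rewrite exprS; ring.
exact: temperedM.
Qed.

Lemma box_eq0 psi q (f : mpoly N C) :
  tempered d q -> (forall a, U a -> psi a = moment c q a) ->
  (forall x, meval (fun j => monomials j x) f = 0) ->
  forall a, U a -> box f psi a = 0.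
Proof.
move=> tq E f0 a Ua; have [del d0 adm] := admU Ua.
have tX (m : multinom N) : tempered d (fun x : 'rV[C]_n => \prod_j monomials j x ^+ m j).
  by apply: tempered_prod => j; apply: tempered_exp; exact: tempered_monomials.
rewrite /box -[RHS](moment0 (d := d) c a).
transitivity (moment c (fun x => \sum_(m <- msupp f) mcoeff m f * (q x * \prod_j monomials j x ^+ m j)) a).
  rewrite (moment_sum _ d0 adm); last first.
    by move=> m; apply: temperedM; [exact: tempered_const|exact: temperedM].
  apply: eq_bigr => m _; rewrite (momentZ _ d0 adm); last exact: temperedM.
  by congr (_ * _); exact: pderiv_eq_moment.
apply: eq_moment => x.
transitivity (q x * meval (fun j => monomials j x) f); last by rewrite f0 mulr0.
rewrite mevalE big_distrr /=.
by apply: eq_bigr => m _; rewrite mulrCA.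
Qed.

End MomentSystem.


Section Substitution.
Context {R : realType} {n d : nat}.
Local Notation C := R[i].
Local Notation N := #|exponents n d|.

Lemma expo_inj : injective (@expo n d).
Proof.
move=> j l; rewrite /expo => /val_inj/val_inj h; exact: enum_val_inj.
Qed.

Lemma mdeg_expo (j : 'I_N) : mdeg (expo j) = d.
Proof. by rewrite /expo; case: (enum_val j) => m /= /eqP. Qed.

Lemma prod_exp_expo (z : C) (j : 'I_N) : \prod_i z ^+ expo j i = z ^+ d.
Proof.
transitivity (z ^+ mdeg (expo j)); last by rewrite mdeg_expo.
by rewrite mdegE (big_morph (GRing.exp z) (exprD z) (expr0 z)).
Qed.

Definition linear_form (g : 'M[C]_n) (i : 'I_n) : mpoly n C :=
  \sum_i' g i i' *: mpolyX C (mnm1 i').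

Definition subst_poly (g : 'M[C]_n) (m : multinom n) : mpoly n C :=
  \prod_i linear_form g i ^+ m i.

Lemma subst_mxE g (j l : 'I_N) : subst_mx d g j l = mcoeff (expo l) (subst_poly g (expo j)).
Proof. by rewrite mxE. Qed.

Lemma homog_subst_poly g m : subst_poly g m \is ishomog1 (mdeg m) mdeg.
Proof.
rewrite /subst_poly mdegE; elim: (index_enum _) => [|i r IH].
  by rewrite !big_nil dhomog1.
rewrite !big_cons; apply: dhomogM => //.
rewrite -[X in ishomog1 X]mul1n; apply: dhomogMn.
rewrite /linear_form; apply: rpred_sum => i' _; apply: dhomogZ.
by rewrite dhomogX /= mdeg1.
Qed.

Lemma homog_expand (p : mpoly n C) : p \is ishomog1 d mdeg ->
  p = \sum_(l < N) mcoeff (expo l) p *: mpolyX C (expo l).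
Proof.
move=> hp; apply/mpolyP => m; rewrite raddf_sum /=.
have [md|md] := eqVneq (mdeg m) d.
  have [l <-] := expo_surj md.
  rewrite (bigD1 l) //= mcoeffZ mcoeffX eqxx mulr1 big1 ?addr0 // => l' l'l.
  by rewrite mcoeffZ mcoeffX (inj_eq expo_inj) (negPf l'l) mulr0.
rewrite (dhomog_nemf_coeff hp md) big1 // => l _; rewrite mcoeffZ mcoeffX.
case: eqP => [E|]; last by rewrite mulr0.
by move: md; rewrite -E mdeg_expo eqxx.
Qed.

Lemma meval_linear_form g i (x : 'rV[C]_n) :
  meval (fun i => x 0 i) (linear_form g i) = (x *m g^T) 0 i.
Proof.
rewrite /linear_form raddf_sum mxE; apply: eq_bigr => k _.
by rewrite /= mevalZ mevalXU mxE mulrC.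
Qed.

Lemma meval_subst_poly g m (x : 'rV[C]_n) :
  meval (fun i => x 0 i) (subst_poly g m) = \prod_i (x *m g^T) 0 i ^+ m i.
Proof.
rewrite /subst_poly rmorph_prod; apply: eq_bigr => i _.
by rewrite rmorphXn /= meval_linear_form.
Qed.

Definition monomial_col (x : 'rV[C]_n) : 'cV[C]_N := \col_j monomials j x.

Lemma subst_mx_monomial_col g x : subst_mx d g *m monomial_col x = monomial_col (x *m g^T).
Proof.
apply/colP => j; rewrite !mxE.
transitivity (meval (fun i => x 0 i) (subst_poly g (expo j))); last exact: meval_subst_poly.
have hp : subst_poly g (expo j) \is ishomog1 d mdeg.
  by rewrite -{2}(mdeg_expo j) homog_subst_poly.
rewrite [in RHS](homog_expand hp) raddf_sum; apply: eq_bigr => l _.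
by rewrite /= mevalZ subst_mxE mxE mevalX.
Qed.

Lemma comp_linear_form g h i :
  comp_mpoly [tuple linear_form h k | k < n] (linear_form g i) = linear_form (g *m h) i.
Proof.
rewrite /linear_form raddf_sum /=.
transitivity (\sum_k g i k *: linear_form h k).
  apply: eq_bigr => k _; rewrite comp_mpolyZ comp_mpolyX; congr (_ *: _).
  rewrite (bigD1 k) //= tnth_mktuple mnm1E eqxx expr1 [X in _ * X]big1 ?mulr1 // => l lk.
  by rewrite mnm1E eq_sym (negPf lk) expr0.
transitivity (\sum_k \sum_l (g i k * h k l) *: mpolyX C (mnm1 l)).
  apply: eq_bigr => k _; rewrite /linear_form scaler_sumr.
  by apply: eq_bigr => l _; rewrite scalerA.
rewrite exchange_big /linear_form /=; apply: eq_bigr => l _.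
by rewrite mxE scaler_suml.
Qed.

Lemma subst_mxM g h : subst_mx d (g *m h) = subst_mx d g *m subst_mx d h :> 'M[C]_N.
Proof.
apply/matrixP => j l; rewrite subst_mxE mxE.
have hp : subst_poly g (expo j) \is ishomog1 d mdeg.
  by rewrite -{2}(mdeg_expo j) homog_subst_poly.
have E m : subst_poly (g *m h) m = comp_mpoly [tuple linear_form h k | k < n] (subst_poly g m).
  rewrite /subst_poly rmorph_prod; apply: eq_bigr => i _.
  by rewrite rmorphXn /= comp_linear_form.
rewrite E [in LHS](homog_expand hp) (raddf_sum (comp_mpoly _)) (raddf_sum (mcoeff _)).
apply: eq_bigr => k _.
rewrite /= comp_mpolyZ mcoeffZ !subst_mxE; congr (_ * _).
rewrite comp_mpolyX; congr mcoeff; apply: eq_bigr => i _.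
by rewrite tnth_mktuple.
Qed.

Lemma subst_mx1 : subst_mx d 1%:M = 1%:M :> 'M[C]_N.
Proof.
apply/matrixP => j l; rewrite subst_mxE mxE.
have -> : subst_poly 1%:M (expo j) = mpolyX C (expo j).
  rewrite mpolyXE_id; apply: eq_bigr => i _; congr (_ ^+ _).
  rewrite /linear_form (bigD1 i) //= mxE eqxx scale1r big1 ?addr0 // => k ki.
  by rewrite mxE eq_sym (negPf ki) scale0r.
by rewrite mcoeffX (inj_eq expo_inj).
Qed.

End Substitution.


Section MatrixDifferentials.
Context {K : numFieldType} {V : normedModType K}.

Lemma differentiable_bigsum {W : normedModType K} I (r : seq I) (P : pred I)
    (f : I -> V -> W) x : (forall i, differentiable (f i) x) ->
  differentiable (fun y => \sum_(i <- r | P i) f i y) x.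
Proof.
move=> df; elim: r => [|i r IH].
  rewrite (_ : (fun y => _) = cst 0); first exact: differentiable_cst.
  by apply/funext => y; rewrite big_nil.
case Pi: (P i); last first.
  rewrite (_ : (fun y => _) = fun y => \sum_(i <- r | P i) f i y) //.
  by apply/funext => y; rewrite big_cons Pi.
rewrite (_ : (fun y => _) = f i + (fun y => \sum_(i <- r | P i) f i y)).
  exact: differentiableD.
by apply/funext => y; rewrite big_cons Pi.
Qed.

Lemma differentiable_prod I (r : seq I) (P : pred I) (f : I -> V -> K^o) x :
  (forall i, differentiable (f i) x) ->
  differentiable (fun y => \prod_(i <- r | P i) f i y : K^o) x.
Proof.
move=> df; elim: r => [|i r IH].
  rewrite (_ : (fun y => _) = cst (1 : K^o)); first exact: differentiable_cst.
  by apply/funext => y; rewrite big_nil.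
case Pi: (P i); last first.
  rewrite (_ : (fun y => _) = fun y => \prod_(i <- r | P i) f i y) //.
  by apply/funext => y; rewrite big_cons Pi.
rewrite (_ : (fun y => _) = f i * (fun y => \prod_(i <- r | P i) f i y)).
  exact: differentiableM.
by apply/funext => y; rewrite big_cons Pi.
Qed.

Lemma differentiable_exp (f : V -> K^o) k x :
  differentiable f x -> differentiable (fun y => f y ^+ k : K^o) x.
Proof.
move=> df; elim: k => [|k IH]; first exact: (differentiable_cst (1 : K^o)).
rewrite (_ : (fun y => _) = f * (fun y => f y ^+ k : K^o)).
  exact: differentiableM.
by apply/funext => y; rewrite exprS.
Qed.

Lemma differentiable_mx p q (F : V -> 'M[K]_(p, q)) x :
  (forall j l, differentiable (fun y => F y j l : K^o) x) -> differentiable F x.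
Proof.
move=> dF.
rewrite (_ : F = fun y => \sum_j \sum_l (F y j l : K^o) *: delta_mx j l).
  apply: differentiable_bigsum => j; apply: differentiable_bigsum => l.
  exact: differentiableZl.
by apply/funext => y; rewrite -matrix_sum_delta.
Qed.

Lemma is_derive_mx_coord p q (F : V -> 'M[K]_(p, q)) x v j l :
  differentiable F x -> is_derive x v (fun y => F y j l : K^o) (('D_v F x) j l).
Proof.
move=> /(@diff_derivable _ _ _ F x v) dF.
have H : (fun h => h^-1 *: ((F (h *: v + x) j l : K^o) - F x j l)) @ 0^' --> (('D_v F x) j l : K^o).
  rewrite (_ : (fun h => _) = (fun M : 'M[K]_(p, q) => M j l : K^o) \o
     (fun h => h^-1 *: (F (h *: v + x) - F x))); last first.
    by apply/funext => h /=; rewrite !mxE.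
  apply: continuous_cvg; last exact: dF.
  exact: coord_continuous.
split; first by apply/cvg_ex; exists (('D_v F x) j l).
exact: (@cvg_lim K^o _ _ _ _ _ _ H).
Qed.

End MatrixDifferentials.

Section LieAction.
Context {R : realType} {n d : nat}.
Local Notation C := R[i].
Local Notation N := #|exponents n d|.

Definition coef_differentiable (p : 'M[C]_n -> mpoly n C) (g : 'M[C]_n) : Prop :=
  forall m, differentiable (fun g => mcoeff m (p g) : C^o) g.

Lemma coef_differentiableM p q g : coef_differentiable p g -> coef_differentiable q g ->
  coef_differentiable (fun g => p g * q g) g.
Proof.
move=> dp dq m; rewrite (_ : (fun g => _) = fun g =>
    \sum_(k : bmultinom n (mdeg m).+1 * bmultinom n (mdeg m).+1 | m == mnm_add k.1 k.2)
      (mcoeff k.1 (p g) * mcoeff k.2 (q g) : C^o)); last first.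
  by apply/funext => g'; rewrite mcoeffM.
apply: differentiable_bigsum => k.
exact: (differentiableM (dp k.1) (dq k.2)).
Qed.

Lemma coef_differentiable_cst p g : coef_differentiable (fun=> p) g.
Proof. by move=> m; exact: differentiable_cst. Qed.

Lemma coef_differentiable_linear_form i (g : 'M[C]_n) :
  coef_differentiable (linear_form^~ i) g.
Proof.
move=> m; rewrite (_ : (fun g => _) = fun g : 'M[C]_n =>
    \sum_i' (g i i' : C^o) *: (mcoeff m (mpolyX C (mnm1 i')) : C^o)); last first.
  by apply/funext => g'; rewrite /linear_form raddf_sum; apply: eq_bigr => k _; rewrite /= mcoeffZ.
apply: differentiable_bigsum => k; apply: differentiableZl.
exact: differentiable_coord.
Qed.

Lemma coef_differentiableX p g k : coef_differentiable p g ->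
  coef_differentiable (fun g => p g ^+ k) g.
Proof.
move=> dp; elim: k => [|k IH]; first exact: coef_differentiable_cst.
rewrite (_ : (fun g => _) = fun g => p g * p g ^+ k); first exact: coef_differentiableM.
by apply/funext => y; rewrite exprS.
Qed.

Lemma subst_mx_differentiable (g : 'M[C]_n) :
  differentiable (subst_mx d : 'M[C]_n -> 'M[C]_N) g.
Proof.
apply: differentiable_mx => j l.
rewrite (_ : (fun y => _) = fun y => mcoeff (expo l) (subst_poly y (expo j)) : C^o); last first.
  by apply/funext => y; rewrite subst_mxE.
suff H : coef_differentiable (fun y => subst_poly y (expo j)) g by exact: H.
rewrite /subst_poly; elim: (index_enum _) => [|i r IH].
  rewrite (_ : (fun y => _) = fun=> 1); first exact: coef_differentiable_cst.
  by apply/funext => y; rewrite big_nil.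
rewrite (_ : (fun y => _) = fun y => linear_form y i ^+ expo j i *
    \prod_(i <- r) linear_form y i ^+ expo j i); last first.
  by apply/funext => y; rewrite big_cons.
apply: coef_differentiableM => //; apply: coef_differentiableX.
exact: coef_differentiable_linear_form.
Qed.

Local Notation lie := (lie_action (subst_mx d) : 'M[C]_n -> 'M[C]_N).

Lemma lie_action_linear (z : C) e f : lie (z *: e + f) = z *: lie e + lie f.
Proof.
by rewrite /lie_action !(deriveE _ (subst_mx_differentiable 1%:M)) linearP.
Qed.

Definition dmonomials (j : 'I_N) (l : 'I_n) (x : 'rV[C]_n) : C :=
  (expo j l)%:R * x 0 l ^+ (expo j l).-1 * \prod_(i | i != l) x 0 i ^+ expo j i.

Lemma derivation_monomials {X : Type} (D : (X -> C) -> (X -> C) -> Prop)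
    (s : X -> 'rV[C]_n) (s' : 'I_n -> X -> C) j :
  D (fun=> 1) (fun=> 0) ->
  (forall f g f' g', D f f' -> D g g' ->
    D (fun x => f x * g x) (fun x => f' x * g x + f x * g' x)) ->
  (forall l, D (fun t => s t 0 l) (s' l)) ->
  D (fun t => monomials j (s t)) (fun t => \sum_l dmonomials j l (s t) * s' l t).
Proof.
move=> D1 DM h.
have := derivation_prod D1 DM (P := predT)
  (fun l _ => derivation_exp D1 DM (expo j l) (h l)).
congr D; apply/funext => t; apply: eq_bigr => l _.
by rewrite /dmonomials mulrAC.
Qed.

Lemma is_derive_monomials_line (j : 'I_N) (x y : 'rV[C]_n) (h : C^o) :
  is_derive h (1 : C^o) (fun k : C^o => monomials j (x + k *: y) : C^o)
    (\sum_l dmonomials j l (x + h *: y) * y 0 l).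
Proof.
pose D (f f' : C -> C) := forall h : C^o, is_derive h (1 : C^o) (f : C^o -> C^o) (f' h).
have H : D (fun k : C => monomials j (x + k *: y))
    (fun k => \sum_l dmonomials j l (x + k *: y) * y 0 l).
  apply: (@derivation_monomials C D (fun k => x + k *: y) (fun l _ => y 0 l)).
  - by move=> z; exact: is_derive_cst.
  - move=> f g f' g' df dg z; have := is_deriveM (df z) (dg z).
    by rewrite /GRing.scale /= addrC (mulrC (g z)).
  move=> l z; rewrite (_ : (fun t => _) = (fun t : C^o => cst (x 0 l : C^o) t + (y 0 l : C^o) *: t)); last first.
    by apply/funext => t; rewrite !mxE mulrC.
  have := is_deriveD (is_derive_cst (x 0 l : C^o) z (1 : C^o)) (is_deriveZ (y 0 l) (is_derive_id z (1 : C^o))).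
  by rewrite add0r /GRing.scale /= mulr1.
exact: H.
Qed.

Lemma lie_action_monomial_col e x :
  lie e *m monomial_col x =
  \col_j \sum_l dmonomials j l x * (x *m e^T) 0 l.
Proof.
apply/colP => j; rewrite [RHS]mxE.
have d1 : is_derive (1%:M : 'M[C]_n) e
    (fun g => (subst_mx d g *m monomial_col x) j 0 : C^o) ((lie e *m monomial_col x) j 0).
  rewrite (_ : (fun g => _) = \sum_l (fun g => monomials l x *: (subst_mx d g j l : C^o))); last first.
    apply/funext => g; rewrite fct_sumE mxE; apply: eq_bigr => l _.
    by rewrite [monomial_col x l 0]mxE mulrC.
  rewrite mxE (eq_bigr (fun l => monomials l x *: (lie e j l : C^o))); last first.
    by move=> l _; rewrite [monomial_col x l 0]mxE mulrC.
  apply: is_derive_sum => l.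
  exact: (is_deriveZ (monomials l x) (is_derive_mx_coord e j l (subst_mx_differentiable 1%:M))).
have d2 : is_derive (1%:M : 'M[C]_n) e
    (fun g => (subst_mx d g *m monomial_col x) j 0 : C^o)
    (\sum_l dmonomials j l x * (x *m e^T) 0 l).
  apply: is_derive_line0.
  rewrite (_ : (fun k : C^o => _) = fun k : C^o => monomials j (x + k *: (x *m e^T)) : C^o); last first.
    apply/funext => k; rewrite subst_mx_monomial_col mxE; congr monomials.
    by rewrite linearD /= linearZ /= trmx1 mulmxDr mulmx1 scalemxAr.
  by have := is_derive_monomials_line j x (x *m e^T) 0; rewrite scale0r addr0.
by have [_ <-] := d1; have [_ <-] := d2.
Qed.

Lemma subst_mx_scalar (z : C) : subst_mx d (z%:M : 'M[C]_n) = (z ^+ d)%:M.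
Proof.
apply/matrixP => j l; rewrite subst_mxE mxE.
have -> : subst_poly z%:M (expo j) = z ^+ d *: mpolyX C (expo j).
  rewrite mpolyXE_id -(prod_exp_expo z j) -scaler_prod.
  rewrite /subst_poly; apply: eq_bigr => i _; rewrite -exprZn; congr (_ ^+ _).
  rewrite /linear_form (bigD1 i) //= mxE eqxx big1 ?addr0 // => k ki.
  by rewrite mxE eq_sym (negPf ki) scale0r.
by rewrite mcoeffZ mcoeffX (inj_eq expo_inj) mulr_natr.
Qed.

Lemma lie_action_scalar (hd : (0 < d)%N) : lie ((d%:R : C)^-1)%:M = 1%:M.
Proof.
have d0 : (d%:R : C) != 0 by rewrite pnatr_eq0 -lt0n.
suff H : lie 1%:M = d%:R%:M.
  have -> : ((d%:R : C)^-1)%:M = (d%:R : C)^-1 *: 1%:M + 0 :> 'M[C]_n.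
    by rewrite addr0 scalemx1.
  rewrite lie_action_linear H.
  have -> : lie 0 = 0 by rewrite /lie_action derive0.
  by rewrite addr0 scale_scalar_mx mulVf.
have fX (f : C^o -> C^o) m k : (f ^+ m) k = f k ^+ m.
  by elim: m => [|m IH]; rewrite ?expr0 // !exprS -IH.
apply/matrixP => j l.
have d1 := is_derive_mx_coord 1%:M j l (subst_mx_differentiable (1%:M : 'M[C]_n)).
have d2 : is_derive (1%:M : 'M[C]_n) 1%:M (fun g => subst_mx d g j l : C^o) ((d%:R%:M : 'M[C]_N) j l).
  apply: is_derive_line0.
  rewrite (_ : (fun k : C^o => _) = fun k : C^o => ((j == l)%:R : C^o) *: ((cst (1 : C^o) + id) ^+ d) k); last first.
    apply/funext => k; rewrite scalemx1 -raddfD /= subst_mx_scalar mxE.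
    by rewrite /GRing.scale /= fX mulr_natl.
  have := is_deriveZ ((j == l)%:R : C) (is_deriveX d (is_deriveD (is_derive_cst (1 : C^o) (0 : C^o) (1 : C^o)) (is_derive_id (0 : C^o) (1 : C^o)))).
  rewrite add0r !mxE; congr is_derive.
  by rewrite fctE /= addr0 expr1n /GRing.scale /= !mulr1 mulr_natl.
by have [_ <-] := d1; have [_ <-] := d2.
Qed.

Lemma trace_lie_action_conj (g e : 'M[C]_n) : g \in unitmx ->
  \tr (lie (g *m e *m invmx g)) = \tr (lie e).
Proof.
move=> ug.
suff -> : lie (g *m e *m invmx g) = subst_mx d g *m lie e *m subst_mx d (invmx g).
  by rewrite mxtrace_mulC mulmxA -subst_mxM mulVmx // subst_mx1 mul1mx.
apply/matrixP => j l.
have d1 := is_derive_mx_coord (g *m e *m invmx g) j l (subst_mx_differentiable (1%:M : 'M[C]_n)).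
have d2 : is_derive (1%:M : 'M[C]_n) (g *m e *m invmx g) (fun y => subst_mx d y j l : C^o)
    ((subst_mx d g *m lie e *m subst_mx d (invmx g)) j l).
  apply: is_derive_line0.
  rewrite (_ : (fun k : C^o => _) = fun k : C^o =>
     (\sum_b (fun k : C^o => subst_mx d (invmx g) b l *: ((\sum_a (fun k : C^o =>
        subst_mx d g j a *: (subst_mx d (1%:M + k *: e) a b : C^o))) k))) k); last first.
    apply/funext => k.
    have -> : 1%:M + k *: (g *m e *m invmx g) = g *m (1%:M + k *: e) *m invmx g.
      by rewrite mulmxDr mulmx1 mulmxDl mulmxV // -scalemxAr -scalemxAl.
    rewrite !subst_mxM mxE fct_sumE; apply: eq_bigr => b _.
    rewrite mulrC fct_sumE; congr (_ * _); by rewrite mxE.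
  have -> : (subst_mx d g *m lie e *m subst_mx d (invmx g)) j l =
    \sum_b (subst_mx d (invmx g) b l *: (\sum_a subst_mx d g j a *: (lie e a b : C^o)) : C^o).
    rewrite mxE; apply: eq_bigr => b _; rewrite mulrC [RHS]/GRing.scale /=.
    by congr (_ * _); rewrite mxE.
  apply: is_derive_sum => b; apply: (is_deriveZ (subst_mx d (invmx g) b l)).
  apply: is_derive_sum => a; apply: (is_deriveZ (subst_mx d g j a)).
  apply: (is_derive_line (g := fun y : 'M[C]_n => subst_mx d y a b : C^o)).
  rewrite scale0r addr0.
  exact: is_derive_mx_coord (subst_mx_differentiable _).
by have [_ <-] := d1; have [_ <-] := d2.
Qed.

Lemma trace_lie_action_comm (u e : 'M[C]_n) :
  \tr (lie (u *m e - e *m u)) = 0.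
Proof.
have lieB (x y : 'M[C]_n) : lie (x - y) = lie x - lie y.
  by rewrite addrC -scaleN1r lie_action_linear scaleN1r addrC.
have unit_case (g : 'M[C]_n) : g \in unitmx -> \tr (lie (g *m e - e *m g)) = 0.
  move=> ug; rewrite lieB raddfB /= -[X in _ - X](trace_lie_action_conj (e *m g) ug).
  by rewrite -!mulmxA mulmxV // mulmx1 subrr.
have [z zu] : exists z : C, z%:M + u \in unitmx.
  have [k hk] : exists k : 'I_n.+1, ~~ root (char_poly (- u)) (k%:R).
    apply/existsP; rewrite -negb_forall; apply/negP => /forallP h.
    have p0 : char_poly (- u) != 0 by rewrite monic_neq0 ?char_poly_monic.
    have := max_poly_roots (rs := [seq (i%:R : C) | i : 'I_n.+1]) p0.
    rewrite size_map size_enum_ord size_char_poly ltnn => H.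
    suff : false by []; apply: H.
      by apply/allP => _ /mapP[i _ ->].
    rewrite map_inj_uniq ?enum_uniq // => i i' /eqP.
    by rewrite eqr_nat => /eqP/val_inj.
  exists k%:R; move: hk; rewrite rootE /char_poly.
  rewrite unitmxE unitfE -horner_evalE -det_map_mx.
  by congr (\det _ != 0); apply/matrixP => a b; rewrite !mxE /= /horner_eval !hornerE; case: eqP; rewrite ?hornerE ?opprK //=; rewrite ?mulr1n ?mulr0n ?hornerE ?opprK.
have E : (z%:M + u) *m e - e *m (z%:M + u) = u *m e - e *m u.
  by rewrite mulmxDl mulmxDr [e *m z%:M]scalar_mxC opprD addrACA subrr add0r.
by rewrite -E; exact: unit_case.
Qed.

End LieAction.


Lemma row_vector_transitive {F : fieldType} n (x y : 'rV[F]_n) : x != 0 -> y != 0 ->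
  exists2 g : 'M[F]_n, g \in unitmx & x *m g^T = y.
Proof.
have decomp (u : 'rV[F]_n) : u != 0 ->
    exists2 a : F, a != 0 & u = a *: (pid_mx 1 *m row_ebase u).
  move=> u0; exists (col_ebase u 0 0).
    have := col_ebase_unit u; rewrite unitmxE unitfE (expand_det_row _ 0) big_ord1.
    by apply: contraNneq => ->; rewrite mul0r.
  rewrite -{1}(mulmx_ebase u) rank_rV u0 -mulmxA.
  by rewrite [X in X *m _ = _]mx11_scalar mul_scalar_mx.
move=> x0 y0; have [a a0 Ex] := decomp x x0; have [b b0 Ey] := decomp y y0.
exists ((a^-1 * b) *: (invmx (row_ebase x) *m row_ebase y))^T.
  by rewrite unitmx_tr unitmxZ ?unitfE ?mulf_neq0 ?invr_neq0 // unitmx_mul unitmx_inv !row_ebase_unit.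
rewrite trmxK -scalemxAr mulmxA {1}Ex -!scalemxAl mulmxK ?row_ebase_unit //.
by rewrite scalerA mulrC mulrA mulfV // mul1r -Ey.
Qed.

Section Veronese.
Context {R : realType} {n d : nat}.
Local Notation C := R[i].
Local Notation N := #|exponents n d|.
Local Notation rho := (subst_mx d : 'M[C]_n -> 'M[C]_N).
Local Notation mc := (@monomial_col R n d).

Lemma orbit_monomial_col x : x != 0 ->
  Defs.orbit rho (mc x) = [set mc y | y in [set y | y != 0]].
Proof.
move=> x0; apply/seteqP; split => [_ [g ug <-]|_ [y /= y0 <-]].
  exists (x *m g^T); last by rewrite subst_mx_monomial_col.
  apply: contraNneq x0 => /(congr1 (mulmx^~ (invmx g^T))).
  by rewrite mulmxK ?unitmx_tr // mul0mx => ->.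
have [g ug gxy] := row_vector_transitive x0 y0.
by exists g => //; rewrite subst_mx_monomial_col gxy.
Qed.

Lemma const_mx_monomial_col : const_mx 1 = mc (const_mx 1).
Proof.
apply/colP => j; rewrite !mxE /monomials big1 // => i _.
by rewrite mxE expr1n.
Qed.

Lemma const_mx_neq0 (hn : (0 < n)%N) : (const_mx 1 : 'rV[C]_n) != 0.
Proof.
apply/eqP => /rowP/(_ (Ordinal hn)); rewrite !mxE => /eqP.
by rewrite oner_eq0.
Qed.

Lemma differentiable_monomials (j : 'I_N) (x : 'rV[C]_n) :
  differentiable (monomials j : 'rV[C]_n -> C^o) x.
Proof.
apply: differentiable_prod => i; apply: differentiable_exp.
exact: differentiable_coord.
Qed.

Lemma closure_zero_locus {m} (A : set 'cV[C]_m) (f : 'cV[C]_m -> C^o) :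
  (forall y, differentiable f y) -> (forall y, A y -> f y = 0) ->
  forall y, closure A y -> f y = 0.
Proof.
move=> df fA y cy; apply: contrapT => fy0.
have cf : {for y, continuous f} by exact: differentiable_continuous.
have nz : nbhs (f y) [set z : C^o | z != 0].
  apply/nbhs_ballP; exists `|f y|; first by rewrite /= normr_gt0; apply/eqP.
  move=> z fz /=; apply/eqP => z0; move: fz.
  by rewrite -ball_normE /ball_ /= z0 subr0 ltxx.
have [z [Az /= fz]] := cy _ (cf _ nz).
by move: fz; rewrite fA // eqxx.
Qed.

Lemma monomial_col_in_closure (hn : (0 < n)%N) x :
  orbit_closure rho (const_mx 1) (mc x).
Proof.
rewrite /orbit_closure const_mx_monomial_col orbit_monomial_col ?const_mx_neq0 //.
have [->|x0] := eqVneq x 0; last by apply: subset_closure; exists x.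
move=> B B0.
have cm : {for (0 : 'rV[C]_n), continuous mc}.
  apply: differentiable_continuous; apply: differentiable_mx => j l.
  rewrite (_ : (fun y => _) = (monomials j : 'rV[C]_n -> C^o)).
    exact: differentiable_monomials.
  by apply/funext => y; rewrite mxE.
have [e e0 He] := nbhs_coordwise (cm _ B0).
exists (mc (const_mx (e / 2)%:C)); split.
  exists (const_mx (e / 2)%:C) => //=; apply/eqP => /rowP/(_ (Ordinal hn)).
  by rewrite !mxE => -[/eqP]; rewrite mulf_eq0 invr_eq0 (gt_eqF e0) pnatr_eq0.
apply: (He (const_mx (e / 2)%:C)) => j; rewrite !mxE subr0 cabsR gtr0_norm ?divr_gt0 //; lra.
Qed.

Lemma mixed_expo (hd : (0 < d)%N) (i k : 'I_n) : exists j : 'I_N,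
  forall x : 'rV[C]_n, monomials j x = x 0 i ^+ d.-1 * x 0 k.
Proof.
have [|j ej] := @expo_surj n d (mnm_add (mnm_muln (mnm1 i) d.-1) (mnm1 k)).
  by rewrite mdegD mdegMn !mdeg1 mul1n addn1 prednK.
exists j => x; rewrite /monomials ej.
under eq_bigr do rewrite mnmDE mulmnE !mnm1E exprD exprM.
rewrite big_split /=; congr (_ * _).
  rewrite (bigD1 i) //= eqxx big1 ?mulr1 // => l li.
  by rewrite eq_sym (negPf li) expr0 expr1n.
rewrite (bigD1 k) //= eqxx expr1 big1 ?mulr1 // => l li.
by rewrite eq_sym (negPf li) expr0.
Qed.

(* The closure is cut out by y_j^d = prod_i y_(d e_i)^(j_i) and, for every i,
   y_j y_(d e_i)^(d-1) = prod_k y_((d-1) e_i + e_k)^(j_k); when y_(d e_i) <> 0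
   these determine a point x with x_i^d = y_(d e_i). *)
Lemma closure_monomial_col (hn : (0 < n)%N) (hd : (0 < d)%N) y :
  orbit_closure rho (const_mx 1) y -> exists x, y = mc x.
Proof.
rewrite /orbit_closure const_mx_monomial_col orbit_monomial_col ?const_mx_neq0 //.
set A := [set mc x | x in _] => cy.
have [mix Hmix] : exists mix : 'I_n -> 'I_n -> 'I_N,
    forall i k (x : 'rV[C]_n), monomials (mix i k) x = x 0 i ^+ d.-1 * x 0 k.
  exists (fun i k => sval (cid (mixed_expo hd i k))) => i k x.
  by case: cid => /= j ->.
have pw i (x : 'rV[C]_n) : monomials (mix i i) x = x 0 i ^+ d.
  by rewrite Hmix -exprSr prednK.
have R1 j : y j 0 ^+ d = \prod_i y (mix i i) 0 ^+ expo j i.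
  apply/eqP; rewrite -subr_eq0; apply/eqP.
  apply: (closure_zero_locus (f := fun y : 'cV[C]_N =>
    y j 0 ^+ d - \prod_i y (mix i i) 0 ^+ expo j i)) cy.
    move=> z; apply: (differentiableB (f := fun y : 'cV[C]_N => y j 0 ^+ d : C^o)).
      by apply: differentiable_exp; exact: differentiable_coord.
    apply: differentiable_prod => i; apply: differentiable_exp.
    exact: differentiable_coord.
  move=> _ [x _ <-]; apply/eqP; rewrite subr_eq0; apply/eqP.
  rewrite mxE /monomials -prodrXl; apply: eq_bigr => i _.
  by rewrite mxE pw -!exprM mulnC.
have R2 i j : y j 0 * y (mix i i) 0 ^+ d.-1 = \prod_k y (mix i k) 0 ^+ expo j k.
  apply/eqP; rewrite -subr_eq0; apply/eqP.
  apply: (closure_zero_locus (f := fun y : 'cV[C]_N =>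
    y j 0 * y (mix i i) 0 ^+ d.-1 - \prod_k y (mix i k) 0 ^+ expo j k)) cy.
    move=> z; apply: (differentiableB
        (f := fun y : 'cV[C]_N => y j 0 * y (mix i i) 0 ^+ d.-1 : C^o)).
      apply: (differentiableM (f := fun y : 'cV[C]_N => y j 0 : C^o)
         (g := fun y : 'cV[C]_N => y (mix i i) 0 ^+ d.-1 : C^o)).
        exact: differentiable_coord.
      by apply: differentiable_exp; exact: differentiable_coord.
    apply: differentiable_prod => k; apply: differentiable_exp.
    exact: differentiable_coord.
  move=> _ [x _ <-]; apply/eqP; rewrite subr_eq0; apply/eqP.
  rewrite mxE [mc x _ _]mxE pw.
  transitivity (\prod_k (x 0 i ^+ d.-1) ^+ expo j k * \prod_k x 0 k ^+ expo j k).
    by rewrite prod_exp_expo mulrC -!exprM mulnC.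
  by rewrite -big_split; apply: eq_bigr => k _; rewrite mxE Hmix exprMn.
have [/existsP[i yi]|/existsPn h] := boolP [exists i, y (mix i i) 0 != 0]; last first.
  exists 0; apply/colP => j; rewrite mxE.
  have [i ji] : exists i, expo j i != 0%N.
    apply: contrapT => /forallNP H; have := mdeg_expo j; rewrite mdegE big1 => [d0|i _].
      by move: hd; rewrite -d0.
    by apply/eqP; apply: contrapT => /negP; exact: H.
  have -> : monomials j (0 : 'rV[C]_n) = 0.
    by rewrite /monomials (bigD1 i) //= mxE expr0n (negPf ji) mul0r.
  have := R1 j; rewrite (bigD1 i) //= (eqP (negbNE (h i))) expr0n (negPf ji) mul0r.
  by move/eqP; rewrite expf_eq0 hd /= => /eqP.
pose r := d.-root (y (mix i i) 0).
have rd : r ^+ d = y (mix i i) 0 by rewrite rootCK.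
have r0 : r != 0 by apply: contraNneq yi => r0; rewrite -rd r0 expr0n gtn_eqF.
exists (\row_k (y (mix i k) 0 / r ^+ d.-1)); apply/colP => j; rewrite mxE /monomials.
under eq_bigr do rewrite mxE expr_div_n.
rewrite big_split /= -R2 prodfV prod_exp_expo -rd -!exprM mulnC mulfK //.
by rewrite expf_neq0.
Qed.

End Veronese.


Section Cutoff.
Context {R : realType}.

Definition cutoff (u : R) : R := Num.max 0 (1 - u) ^+ 2.
Definition dcutoff (u : R) : R := - (2 * Num.max 0 (1 - u)).

Lemma is_derive_quadratic (f : R -> R) (u l : R) :
  (forall h, `|f (u + h) - f u - h * l| <= h ^+ 2) ->
  is_derive u (1 : R^o) (f : R^o -> R^o) l.
Proof.
move=> H.
suff L : (fun h : R => h^-1 *: ((f (h *: (1 : R^o) + u) : R^o) - f u)) @ 0^' --> (l : R^o).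
  split; first by apply/cvg_ex; exists l.
  exact: (@cvg_lim R^o _ _ _ _ _ _ L).
apply/cvgrPdist_le => e e0; near=> h.
have h0 : h != 0 by near: h; exact: nbhs_dnbhs_neq.
have he : `|h| <= e by near: h; exact: dnbhs0_le.
have -> : h *: (1 : R^o) + u = u + h by rewrite /GRing.scale /= mulr1 addrC.
have hn : 0 < `|h| by rewrite normr_gt0.
rewrite distrC -(ler_pM2l hn) -normrM mulrBr /GRing.scale /= mulVKf //.
apply: (le_trans (H h)); rewrite -real_normK ?num_real // expr2.
by rewrite ler_wpM2l.
Unshelve. all: by end_near. Qed.

Lemma is_derive_cutoff (u : R) :
  is_derive u (1 : R^o) (cutoff : R^o -> R^o) (dcutoff u).
Proof.
apply: is_derive_quadratic => h; rewrite /cutoff /dcutoff ler_norml.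
have [a|a] := leP 0 (1 - (u + h)); have [b|b] := leP 0 (1 - u); apply/andP; split; nra.
Qed.

Lemma continuous_dcutoff : continuous dcutoff.
Proof.
rewrite /dcutoff (_ : (fun u => _) = fun u : R => - (1 - u + `|1 - u|)).
  apply: continuous_opp; have c1 : continuous (fun u : R => 1 - u).
    apply: continuous_add; first exact: continuous_const.
    by apply: continuous_opp => u; exact: cvg_id.
  apply: continuous_add => // u; apply: cvg_norm; exact: c1.
apply/funext => u; have [a|a] := leP 0 (1 - u).
  by rewrite ger0_norm //; ring.
by rewrite ltr0_norm //; ring.
Qed.

Lemma cutoff_le (u : R) : 0 <= u -> `|1 - cutoff u| <= 2 * u.
Proof.
move=> u0; rewrite /cutoff ler_norml.
by have [b|b] := leP 0 (1 - u); apply/andP; split; nra.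
Qed.

Lemma cutoff_bound (u : R) : 0 <= u -> `|dcutoff u| <= 2.
Proof.
move=> u0; rewrite /dcutoff ler_norml.
by have [b|b] := leP 0 (1 - u); apply/andP; split; lra.
Qed.

Lemma cutoff_eq0 (u : R) : 1 <= u -> cutoff u = 0.
Proof.
move=> u1; rewrite /cutoff; have [b|b] := leP 0 (1 - u); last by rewrite expr0n.
have -> : 1 - u = 0 by lra.
by rewrite expr0n.
Qed.

End Cutoff.

Section EuclideanNorm.
Context {R : realType} {n : nat}.
Local Notation C := R[i].

Definition sqnorm (x : 'rV[C]_n) : R :=
  \sum_l (complex.Re (x 0 l) ^+ 2 + complex.Im (x 0 l) ^+ 2).

Lemma sqnormE x : sqnorm x = \sum_l cabs (x 0 l) ^+ 2.
Proof.
by apply: eq_bigr => l _; rewrite cabs_def sqr_sqrtr // addr_ge0 ?sqr_ge0.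
Qed.

Lemma sqnorm_ge0 x : 0 <= sqnorm x.
Proof. by rewrite sqnormE sumr_ge0 // => l _; rewrite sqr_ge0. Qed.

Lemma sqnorm_ball (x : 'rV[C]_n) (r : R) : 0 <= r -> sqnorm x <= r ^+ 2 ->
  `|x| <= r%:C.
Proof.
move=> r0 xr; rewrite mx_norm_R lecR; apply/ler_addgt0Pr => e e0.
suff : ball (0 : 'rV[C]_n) ((r + e)%:C) x.
  by rewrite mx_norm_ball /ball_ /= sub0r normrN mx_norm_R ltcR => /ltW.
split; first by rewrite ltcR; lra.
move=> i l; rewrite ord1; change (`|(0 : 'rV[C]_n) 0 l - x 0 l| < (r + e)%:C).
rewrite mxE sub0r normrN cabsE ltcR; apply: (@le_lt_trans _ _ r); last lra.
rewrite -(@ler_pXn2r _ 2) ?nnegrE ?cabs_ge0 //; apply: le_trans xr.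
rewrite sqnormE (bigD1 l) //= lerDl sumr_ge0 // => k _; exact: sqr_ge0.
Qed.

Variables (s : 'rV[R]_n -> 'rV[C]_n).
Hypothesis sm : smooth s.

Definition dsqnorm (j : 'I_n) (t : 'rV[R]_n) : R :=
  \sum_l 2 * (complex.Re (s t 0 l) * re_jacobian s t l j +
              complex.Im (s t 0 l) * im_jacobian s t l j).

Lemma has_partial_sum I (r : seq I) j (F F' : I -> 'rV[R]_n -> R) :
  (forall i, has_partial j (F i) (F' i)) ->
  has_partial j (fun t => \sum_(i <- r) F i t) (fun t => \sum_(i <- r) F' i t).
Proof.
move=> h; elim: r => [|i r IH].
  have := has_partial_const j (0 : R).
  by congr has_partial; apply/funext => t; rewrite big_nil.
have := has_partialD (h i) IH.
by congr has_partial; apply/funext => t; rewrite big_cons.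
Qed.

Lemma has_partial_sqnorm j : has_partial j (fun t => sqnorm (s t)) (dsqnorm j).
Proof.
apply: has_partial_sum => l; have [h1 h2] := smooth_cpartial l j sm.
have := has_partialD (has_partialM h1 h1) (has_partialM h2 h2).
by congr has_partial; apply/funext => t; rewrite !mxE /=; ring.
Qed.

Definition chi (eps : R) (x : 'rV[C]_n) : R := cutoff (eps * sqnorm x).

Definition dchi (eps : R) (j : 'I_n) (t : 'rV[R]_n) : R :=
  dcutoff (eps * sqnorm (s t)) * (eps * dsqnorm j t).

Lemma has_partial_chi eps j : has_partial j (fun t => chi eps (s t)) (dchi eps j).
Proof.
apply: (has_partial_comp continuous_dcutoff is_derive_cutoff).
have := has_partialM (has_partial_const j eps) (has_partial_sqnorm j).
by congr has_partial; apply/funext => t; rewrite mul0r add0r.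
Qed.

Lemma dchi_cofactor eps i t :
  cabs (\sum_j (dchi eps j t)%:C * cofactor (\matrix_(a, b) cell_jac s a b t) i j) <=
  `|dcutoff (eps * sqnorm (s t))| * `|eps| *
  (\sum_l 4 * cabs (s t 0 l)) * (vol_const n * volume_density s t).
Proof.
rewrite -(det_replace_row i (fun j => (dchi eps j t)%:C) (fun a b => cell_jac s a b t)).
have -> : \det (replace_row i (fun j => (dchi eps j t)%:C) (fun a b => cell_jac s a b t)) =
   (dcutoff (eps * sqnorm (s t)) * eps)%:C * \sum_l
     ((2 * complex.Re (s t 0 l))%:C * \det (replace_row i (fun j => (re_jacobian s t l j)%:C) (fun a b => cell_jac s a b t)) +
      (2 * complex.Im (s t 0 l))%:C * \det (replace_row i (fun j => (im_jacobian s t l j)%:C) (fun a b => cell_jac s a b t))).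
  set cf := cofactor (\matrix_(a, b) cell_jac s a b t) i.
  have dE j : (dchi eps j t)%:C = (dcutoff (eps * sqnorm (s t)) * eps)%:C *
      \sum_l ((2 * complex.Re (s t 0 l))%:C * (re_jacobian s t l j)%:C +
              (2 * complex.Im (s t 0 l))%:C * (im_jacobian s t l j)%:C).
    rewrite /dchi /dsqnorm mulrA rmorphM rmorph_sum; congr (_ * _).
    by apply: eq_bigr => l _; rewrite -!rmorphM -rmorphD; congr (_%:C); ring.
  rewrite det_replace_row -/cf.
  transitivity ((dcutoff (eps * sqnorm (s t)) * eps)%:C * \sum_j \sum_l
      ((2 * complex.Re (s t 0 l))%:C * ((re_jacobian s t l j)%:C * cf j) +
       (2 * complex.Im (s t 0 l))%:C * ((im_jacobian s t l j)%:C * cf j))).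
    rewrite big_distrr; apply: eq_bigr => j _; rewrite dE -mulrA; congr (_ * _).
    by rewrite big_distrl; apply: eq_bigr => l _ /=; rewrite mulrDl !mulrA.
  rewrite exchange_big; congr (_ * _); apply: eq_bigr => l _ /=.
  by rewrite !det_replace_row !big_distrr -big_split.
set V := vol_const n * volume_density s t.
rewrite cabsM cabsR normrM -!mulrA ler_wpM2l // ler_wpM2l //.
rewrite big_distrl /=; apply: (le_trans (cabs_sum _ _ _)); apply: ler_sum => l _.
apply: (le_trans (cabsD _ _)); rewrite !cabsM !cabsR !normrM.
have b1 := ler_pM (normr_ge0 _) (cabs_ge0 _) (ler_Re_cabs (s t 0 l)) (cabs_det_row_re s t i l : _ <= V).
have b2 := ler_pM (normr_ge0 _) (cabs_ge0 _) (ler_Im_cabs (s t 0 l)) (cabs_det_row_im s t i l : _ <= V).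
rewrite (ger0_norm (ler0n R 2)); lra.
Qed.

End EuclideanNorm.


Lemma csum_eventually0 {R : realType} (u : nat -> R[i]) :
  (exists M0, forall M, (M0 <= M)%N -> \sum_(0 <= k < M) u k = 0) -> csum u 0.
Proof.
move=> [M0 HM]; split; apply: cvg_near_cst; near=> M.
  by rewrite /series /= -Re_sum HM //; near: M; exact: nbhs_infty_ge.
by rewrite /series /= -Im_sum HM //; near: M; exact: nbhs_infty_ge.
Unshelve. all: by end_near. Qed.

Lemma tempered_cabs_sum {R : realType} {n d : nat} (I : Type) (r : seq I)
    (q : I -> 'rV[R[i]]_n -> R[i]) (eta : R) : 0 < eta -> (forall i, tempered d (q i)) ->
  exists2 K : R, 0 <= K &
    forall x, \sum_(i <- r) cabs (q i x) <= K * expR (eta * monomial_norm d x).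
Proof.
move=> eta0 tq; elim: r => [|i r [K K0 HK]].
  by exists 0 => // x; rewrite big_nil mul0r.
have [K' K'0 HK'] := tempered_exp_bound eta0 (tq i).
exists (K' + K); first exact: addr_ge0.
by move=> x; rewrite big_cons mulrDl lerD.
Qed.

Section LinearVectorField.
Context {R : realType} {n d : nat} (c : contour R n).
Local Notation C := R[i].
Local Notation N := #|exponents n d|.
Variables (a : 'rV[C]_N) (e : 'M[C]_n).
Implicit Types (x : 'rV[C]_n).

Definition linear_field i x : C := (x *m e^T) 0 i.
Definition dform l x : C := \sum_j a 0 j * dmonomials j l x.
Definition divergence x : C := \tr e + \sum_l dform l x * linear_field l x.

Local Notation f := (fun x => cexp (homogeneous_form a x)).

Definition dflux i l x : C := e i l * f x + linear_field i x * (dform l x * f x).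

Lemma sum_dflux x : \sum_i dflux i i x = divergence x * f x.
Proof.
rewrite /dflux big_split /= -big_distrl /= /divergence mulrDl; congr (_ + _).
by rewrite big_distrl; apply: eq_bigr => l _ /=; ring.
Qed.

Section OneCell.
Variables (s : 'rV[R]_n -> 'rV[C]_n).
Hypothesis sm : smooth s.

Lemma cpartial_form j : cpartial j (fun t => homogeneous_form a (s t))
  (fun t => \sum_l dform l (s t) * cell_jac s l j t).
Proof.
have h : cpartial j (fun t => \sum_m a 0 m * monomials m (s t))
    (fun t => \sum_m (0 * monomials m (s t) +
       a 0 m * \sum_l dmonomials m l (s t) * cell_jac s l j t)).
  apply: cpartial_sum => m _; apply: cpartialM; first exact: cpartial_const.
  apply: derivation_monomials; [exact: (cpartial_const j 1)|exact: cpartialM|].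
  by move=> l; exact: smooth_cpartial.
apply: (cpartial_eq h) => // t; rewrite /dform.
under [in RHS]eq_bigr do rewrite big_distrl.
rewrite exchange_big; apply: eq_bigr => m _ /=; rewrite mul0r add0r big_distrr /=.
by apply: eq_bigr => l _; rewrite mulrA.
Qed.

Lemma cpartial_flux i j : cpartial j (fun t => linear_field i (s t) * f (s t))
  (fun t => \sum_l dflux i l (s t) * cell_jac s l j t).
Proof.
have h1 : cpartial j (fun t => linear_field i (s t)) (fun t => \sum_l e i l * cell_jac s l j t).
  have h : cpartial j (fun t => \sum_l e i l * s t 0 l)
      (fun t => \sum_l (0 * s t 0 l + e i l * cell_jac s l j t)).
    apply: cpartial_sum => l _; apply: cpartialM; first exact: cpartial_const.
    exact: smooth_cpartial.
  apply: (cpartial_eq h) => t.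
    by rewrite /linear_field mxE; apply: eq_bigr => l _; rewrite mxE mulrC.
  by apply: eq_bigr => l _; rewrite mul0r add0r.
have := cpartialM h1 (cpartial_cexp (cpartial_form j)).
move=> /cpartial_eq; apply => // t.
rewrite !big_distrl big_distrr -big_split /=; apply: eq_bigr => l _.
by rewrite /dflux; ring.
Qed.

Variable eps : R.

Definition dcut_flux i j t : C :=
  (dchi s eps j t)%:C * (linear_field i (s t) * f (s t)) +
  (chi eps (s t))%:C * \sum_l dflux i l (s t) * cell_jac s l j t.

Lemma cpartial_cut_flux i j :
  cpartial j (fun t => (chi eps (s t))%:C * (linear_field i (s t) * f (s t))) (dcut_flux i j).
Proof.
exact: (cpartialM (cpartialR (has_partial_chi sm eps j)) (cpartial_flux i j)).
Qed.

Definition cut_density t : C :=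
  \sum_i \det (replace_row i (fun j => dcut_flux i j t) (fun b l => cell_jac s b l t)).

Lemma cut_densityE t : cut_density t =
  \sum_i (linear_field i (s t) * f (s t)) *
     (\sum_j (dchi s eps j t)%:C * cofactor (\matrix_(b, l) cell_jac s b l t) i j) +
  (chi eps (s t))%:C * (divergence (s t) * f (s t) * jac_det s t).
Proof.
rewrite -sum_dflux jac_detE big_distrl big_distrr -big_split /=; apply: eq_bigr => i _.
set M := \matrix_(b, l) _; rewrite det_replace_row -/M /dcut_flux /=.
under eq_bigr do rewrite mulrDl.
rewrite big_split /=; congr (_ + _).
  by rewrite big_distrr; apply: eq_bigr => j _ /=; ring.
transitivity (\sum_l (chi eps (s t))%:C * (dflux i l (s t) * (M *m \adj M) l i)).
  under eq_bigr do rewrite -mulrA big_distrl big_distrr /=.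
  rewrite exchange_big; apply: eq_bigr => l _ /=.
  rewrite mxE !big_distrr; apply: eq_bigr => j _ /=.
  by rewrite [M l j]mxE [(\adj M) j i]mxE; ring.
rewrite mul_mx_adj (bigD1 i) //= big1 ?addr0 ?mxE ?eqxx // => l li.
by rewrite mxE (negPf li) mulr0 mulr0.
Qed.

Lemma ccont_dcut_row i : ccont (fun t =>
  \det (replace_row i (fun j => dcut_flux i j t) (fun b l => cell_jac s b l t))).
Proof.
apply: ccont_det => b l; under eq_fun do rewrite mxE.
case: (b == i); first exact: cpartial_ccont' (cpartial_cut_flux i l).
exact: cpartial_ccont (smooth_cpartial2 b l l sm).
Qed.

Lemma ccont_cut_density : ccont cut_density.
Proof. by apply: ccont_sum => i; exact: ccont_dcut_row. Qed.

End OneCell.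

Lemma total_cut_density (eps : R) : 0 < eps ->
  total_is (mult c) (fun k => cut_density (cell c k) eps) 0.
Proof.
move=> eps0; apply: csum_eventually0.
have H (i : 'I_n) : exists M0, forall M, (M0 <= M)%N -> \sum_(0 <= k < M) (mult c k)%:~R *
    cube_integralC (fun t => \det (replace_row i (fun j => dcut_flux (cell c k) eps i j t)
       (fun b l => cell_jac (cell c k) b l t))) = 0.
  apply: (@chain_stokes _ _ c (fun x => (chi eps x)%:C * (linear_field i x * f x))
    (fun k => dcut_flux (cell c k) eps i) i (Num.sqrt eps^-1)).
    by move=> k j; exact: cpartial_cut_flux (cell_smooth c k) eps i j.
  move=> x xr; rewrite /chi cutoff_eq0 ?mul0r //.
  have [h|h] := leP (sqnorm x) (eps^-1).
    exfalso; apply: xr; apply: sqnorm_ball; first exact: sqrtr_ge0.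
    by rewrite sqr_sqrtr // invr_ge0 ltW.
  by rewrite -(mulfV (lt0r_neq0 eps0)) ler_wpM2l // ltW.
exists (\max_i sval (cid (H i))) => M HM.
transitivity (\sum_(0 <= k < M) \sum_i (mult c k)%:~R *
    cube_integralC (fun t => \det (replace_row i (fun j => dcut_flux (cell c k) eps i j t)
       (fun b l => cell_jac (cell c k) b l t)))).
  apply: eq_bigr => k _; rewrite -big_distrr /=; congr (_ * _).
  rewrite /cut_density cube_integralC_sum // => i.
  exact: ccont_dcut_row (cell_smooth c k) eps i.
rewrite exchange_big big1 //= => i _.
apply: (svalP (cid (H i))); apply: leq_trans HM.
exact: (leq_bigmax (F := fun i => sval (cid (H i)))).
Qed.

End LinearVectorField.

Section DivergenceTheorem.
Context {R : realType} {n d : nat} (c : contour R n).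
Local Notation C := R[i].
Local Notation N := #|exponents n d|.
Hypothesis hd : (0 < d)%N.

Lemma tempered_field (e : 'M[C]_n) i : tempered d (linear_field e i).
Proof.
rewrite /linear_field (_ : (fun x => _) = fun x : 'rV[C]_n => \sum_l x 0 l * e^T l i); last first.
  by apply/funext => x; rewrite mxE.
apply: tempered_sum => l; apply: temperedM; last exact: tempered_const.
exact: tempered_coord.
Qed.

Lemma tempered_dform (a : 'rV[C]_N) l : tempered d (dform a l).
Proof.
apply: tempered_sum => j; apply: temperedM; first exact: tempered_const.
apply: temperedM.
  by apply: temperedM; [exact: tempered_const|apply: tempered_exp; exact: tempered_coord].
by apply: tempered_prod => i; apply: tempered_exp; exact: tempered_coord.
Qed.

Lemma tempered_divergence (a : 'rV[C]_N) e : tempered d (divergence a e).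
Proof.
apply: temperedD; first exact: tempered_const.
apply: tempered_sum => l; apply: temperedM; last exact: tempered_field.
exact: tempered_dform.
Qed.

(* Cutting off at radius eps^(-1/2) costs an error of order eps. *)
Lemma moment_divergence (a : 'rV[C]_N) (e : 'M[C]_n) (del : R) : 0 < del ->
  admissible (mult c) (weight c del a) -> moment c (divergence a e) a = 0.
Proof.
move=> d0 adm.
have tq := tempered_divergence a e.
have t1 := total_moment_tempered d0 adm tq.
have cq k := ccont_moment_integrand c a k tq.1.
have [K1 K10 H1] := @tempered_cabs_sum R n d _ (index_enum 'I_n)
  (fun l x => 2 * (x 0 l ^+ 2 * divergence a e x)) del d0
  (fun l => temperedM (tempered_const _) (temperedM (tempered_exp 2 (tempered_coord hd l)) tq)).
have [K2 K20 H2] := @tempered_cabs_sum R n d _ (index_enum ('I_n * 'I_n)%type)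
  (fun p x => 8 * (linear_field e p.1 x * x 0 p.2)) del d0
  (fun p => temperedM (tempered_const _) (temperedM (tempered_field e p.1) (tempered_coord hd p.2))).
pose K := (K1 + K2) * vol_const n.
have K0 : 0 <= K by rewrite mulr_ge0 ?vol_const_ge0 // addr_ge0.
pose B := 4 * K * mass (mult c) (weight c del a).
have B0 : 0 <= B.
  by apply: mulr_ge0; [exact: mulr_ge0|exact: mass_ge0].
suff H (eps : R) : 0 < eps -> cabs (moment c (divergence a e) a) <= eps * B.
  apply: cabs_eq0; apply/eqP; rewrite eq_le cabs_ge0 andbT.
  apply/ler_addgt0Pr => z z0; rewrite add0r.
  have z1 : 0 < z / (B + 1) by rewrite divr_gt0 //; lra.
  apply: (le_trans (H _ z1)); rewrite mulrAC ler_pdivrMr; last lra.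
  by rewrite ler_wpM2l ?(ltW z0) //; lra.
move=> eps0.
have t2 := total_cut_density c a e eps0.
have cd k := ccont_cut_density a e (cell_smooth c k) eps.
pose g k t := moment_integrand c (divergence a e) a k t - cut_density a e (cell c k) eps t.
have dom : dominated (weight c del a) (eps * K) g.
  move=> k; split; first by apply: ccontD => //; exact: ccontN.
  move=> t _; rewrite /g cut_densityE /moment_integrand.
  set x := cell c k t; set fx := cexp (homogeneous_form a x).
  set cf := cofactor _.
  set V := vol_const n * volume_density (cell c k) t.
  have V0 : 0 <= V by rewrite mulr_ge0 ?vol_const_ge0 ?volume_density_ge0.
  have f0 := cabs_ge0 fx.
  rewrite (_ : _ - _ = (1 - chi eps x)%:C * (divergence a e x * fx * jac_det (cell c k) t) -
     \sum_i linear_field e i x * fx * (\sum_j (dchi (cell c k) eps j t)%:C * cf i j)); last first.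
    by rewrite rmorphB rmorph1; ring.
  apply: (le_trans (cabsD _ _)); rewrite cabsN.
  have es0 : 0 <= eps * sqnorm x by rewrite mulr_ge0 ?sqnorm_ge0 ?ltW.
  have b1 : cabs ((1 - chi eps x)%:C * (divergence a e x * fx * jac_det (cell c k) t)) <=
      eps * ((\sum_l cabs (2 * (x 0 l ^+ 2 * divergence a e x))) * (cabs fx * V)).
    rewrite cabsM cabsR [cabs (_ * jac_det _ _)]cabsM [cabs (_ * fx)]cabsM.
    apply: (@le_trans _ _ ((2 * (eps * sqnorm x)) * (cabs (divergence a e x) * cabs fx * V))).
      apply: ler_pM; rewrite ?normr_ge0 ?cutoff_le //.
        by rewrite !mulr_ge0 ?cabs_ge0.
      by rewrite ler_wpM2l ?mulr_ge0 ?cabs_ge0 // cabs_jac_det.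
    rewrite sqnormE le_eqVlt; apply/orP; left; apply/eqP.
    rewrite (_ : \sum_l cabs (2 * (x 0 l ^+ 2 * divergence a e x)) =
       2 * ((\sum_l cabs (x 0 l) ^+ 2) * cabs (divergence a e x))); first by ring.
    rewrite big_distrl big_distrr; apply: eq_bigr => l _ /=.
    rewrite [LHS]cabsM [X in _ * X = _]cabsM cabsX.
    by rewrite (_ : (2 : C) = (2 : R)%:C) ?cabsR ?ger0_norm // rmorph_nat.
  have b2 : cabs (\sum_i linear_field e i x * fx * (\sum_j (dchi (cell c k) eps j t)%:C * cf i j)) <=
      eps * ((\sum_p cabs (8 * (linear_field e p.1 x * x 0 p.2))) * (cabs fx * V)).
    apply: (le_trans (cabs_sum _ _ _)).
    pose F (i l : 'I_n) := cabs (8 * (linear_field e i x * x 0 l)).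
    rewrite -(pair_bigA _ F) /= big_distrl big_distrr; apply: ler_sum => i _ /=.
    rewrite [cabs (_ * \sum_j _)]cabsM [cabs (_ * fx)]cabsM.
    have h1 := dchi_cofactor (cell c k) eps i t.
    have h2 := cutoff_bound es0.
    apply: (@le_trans _ _ (cabs (linear_field e i x) * cabs fx * (2 * eps * (\sum_l 4 * cabs (x 0 l)) * V))).
      rewrite ler_wpM2l ?mulr_ge0 ?cabs_ge0 //; apply: (le_trans h1).
      rewrite ler_wpM2r // ler_wpM2r ?sumr_ge0 // => [l _|]; first by rewrite mulr_ge0 ?cabs_ge0.
      by rewrite (gtr0_norm eps0) ler_wpM2r // ltW.
    rewrite le_eqVlt; apply/orP; left; apply/eqP.
    rewrite (_ : \sum_l F i l = 2 * (cabs (linear_field e i x) * \sum_l 4 * cabs (x 0 l))); first by ring.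
    rewrite !big_distrr; apply: eq_bigr => l _ /=.
    rewrite /F [LHS]cabsM [X in _ * X = _]cabsM.
    by rewrite (_ : (8 : C) = (8 : R)%:C) ?cabsR ?ger0_norm // ?rmorph_nat //; ring.
  apply: (le_trans (lerD b1 b2)); rewrite /weight -/x -/fx.
  have w0 : 0 <= cabs fx * V by rewrite mulr_ge0.
  have := ler_wpM2r w0 (H1 x); have := ler_wpM2r w0 (H2 x) => s2 s1.
  rewrite -mulrDr; apply: (@le_trans _ _ (eps * (K1 * expR (del * monomial_norm d x) * (cabs fx * V) +
      K2 * expR (del * monomial_norm d x) * (cabs fx * V)))).
    by rewrite ler_wpM2l ?(ltW eps0) // lerD.
  rewrite le_eqVlt; apply/orP; left; apply/eqP; rewrite /K /V; ring.
have [L tL bL] := total_exists adm dom.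
have E : moment c (divergence a e) a = L.
  apply: (csum_unique t1).
  have T := totalD _ cd tL t2; rewrite addr0 in T.
  apply: (total_eq (T _)); first by move=> k; have [] := dom k.
  by move=> k t _; rewrite /g subrK.
by rewrite E; apply: (le_trans bL); rewrite le_eqVlt; apply/orP; left; apply/eqP; rewrite /B; ring.
Qed.

End DivergenceTheorem.


Section Datum.
Context {R : realType} {n d : nat}.
Local Notation C := R[i].
Local Notation N := #|exponents n d|.
Local Notation lie := (lie_action (subst_mx d) : 'M[C]_n -> 'M[C]_N).
Hypotheses (hn : (0 < n)%N) (hd : (0 < d)%N).

Lemma exponents_gt0 : (0 < N)%N.
Proof. by have [j _] := @pure_power_expo n d (Ordinal hn); exact: leq_ltn_trans (ltn_ord j). Qed.

Lemma subst_mx_datum : hypergeometric_datum (@subst_mx R n d) (const_mx 1).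
Proof.
split.
- split; first exact: subst_mx1.
    by move=> g h _ _; exact: subst_mxM.
  by move=> g _; exact: subst_mx_differentiable.
- by exists ((d%:R : C)^-1)%:M; exact: lie_action_scalar.
- apply/eqP => /colP/(_ (Ordinal exponents_gt0)); rewrite !mxE => /eqP.
  by rewrite oner_eq0.
apply: (@sub_finite_set _ _ [set Defs.orbit (@subst_mx R n d) (const_mx 1);
   Defs.orbit (@subst_mx R n d) (monomial_col 0)]); last exact: finite_set2.
move=> _ [w cw <-]; have [x ->] := closure_monomial_col hn hd cw.
have [->|x0] := eqVneq x 0; [by right|left].
by rewrite const_mx_monomial_col !orbit_monomial_col // const_mx_neq0.
Qed.

Definition lie_weight (e : 'M[C]_n) : C := \tr (lie e) - \tr e.

Lemma lie_weight_scalar : scalar lie_weight.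
Proof.
move=> z u v; rewrite /lie_weight lie_action_linear.
by move: (lie u) (lie v) => A B; rewrite !mxtraceD !mxtraceZ /=; ring.
Qed.

HB.instance Definition _ :=
  GRing.isLinear.Build C 'M[C]_n C _ lie_weight lie_weight_scalar.

Lemma lie_weight_character : lie_character (lie_weight : {scalar 'M[C]_n}).
Proof.
move=> u v; rewrite /= /lie_weight trace_lie_action_comm sub0r raddfB /= mxtrace_mulC.
by rewrite subrr oppr0.
Qed.

Lemma sum_dform_field (a : 'rV[C]_N) e x :
  \sum_l dform a l x * linear_field e l x = \sum_j (a *m lie e) 0 j * monomials j x.
Proof.
transitivity ((a *m (lie e *m monomial_col x)) 0 0).
  rewrite lie_action_monomial_col mxE /dform.
  under eq_bigr do rewrite big_distrl /=.
  rewrite exchange_big; apply: eq_bigr => j _ /=; rewrite mxE big_distrr.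
  by apply: eq_bigr => l _ /=; rewrite mulrA.
by rewrite mulmxA mxE; apply: eq_bigr => j _; rewrite [monomial_col x j 0]mxE.
Qed.

End Datum.

Theorem theorem4 (R : realType) (n d : nat) (hn : (0 < n)%N) (hd : (0 < d)%N)
    (c : contour R n) (U : set 'rV[R[i]]_#|exponents n d|)
    (hU : open U)
    (hdec : forall a, U a -> rapidly_decreasing c (fun x => cexp (homogeneous_form a x)))
    (hint : forall a, U a -> absolutely_integrable c (fun x => cexp (homogeneous_form a x))) :
  GL_hypergeometric (@subst_mx R n d) (const_mx 1) U (J c).
Proof.
have adm a (Ua : U a) := admissible_weight (exponents_gt0 hn) hU Ua hint.
pose one := fun _ : 'rV[R[i]]_n => 1 : R[i].
have t1 : tempered d one by exact: tempered_const.
have JE a : U a -> (J c : 'rV[R[i]]_#|exponents n d| -> (R[i])^o) a = moment c one a.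
  move=> _; rewrite /J /moment; congr (contour_integral c _).
  by apply/funext => x; rewrite mul1r.
have dJ := derive_eq_moment hU adm t1 JE.
split; [exact: subst_mx_datum|exact: hU|by move=> w /dJ[]|].
exists (@lie_weight R n d); first exact: lie_weight_character.
split=> [f f0 w Uw|e w Uw].
  apply: (box_eq0 hU adm t1 JE) => // x.
  have := f0 _ (@monomial_col_in_closure R n d hn x).
  by rewrite (_ : (fun j => monomial_col x j 0) = fun j => monomials j x) //; apply/funext => j; rewrite mxE.
have [del d0 aw] := adm w Uw.
rewrite /lie_derivative (dJ w Uw).2 JE // /= /lie_weight.
set A := w *m lie_action (subst_mx d) e.
have tm (j : 'I_#|exponents n d|) : tempered d (fun x : 'rV[R[i]]_n => one x * monomials j x).
  by apply: temperedM => //; exact: tempered_monomials.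
have tz (z : R[i]) (j : 'I_#|exponents n d|) :
    tempered d (fun x : 'rV[R[i]]_n => z * (one x * monomials j x)).
  by apply: temperedM => //; exact: tempered_const.
have div0 : \tr e * moment c one w +
    \sum_j A 0 j * moment c (fun x => one x * monomials j x) w = 0.
  rewrite -[RHS](moment_divergence hd e d0 aw).
  transitivity (\tr e * moment c one w + moment c (fun x => \sum_j A 0 j * (one x * monomials j x)) w).
    rewrite (moment_sum (q := fun j x => A 0 j * (one x * monomials j x)) _ d0 aw) //.
    congr (_ + _); apply: eq_bigr => j _.
    by rewrite (momentZ (q := fun x => one x * monomials j x) _ d0 aw).
  rewrite -(momentZ (q := one) _ d0 aw) // -(momentD d0 aw); last 2 first.
  - by apply: temperedM => //; exact: tempered_const.
  - exact: tempered_sum.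
  apply: eq_moment => x; rewrite /divergence sum_dform_field mulr1; congr (_ + _).
  by apply: eq_bigr => j _; rewrite mul1r.
rewrite (eq_bigr (fun j => - (A 0 j * moment c (fun x => one x * monomials j x) w))); last first.
  by move=> j _; rewrite mxE mulNr.
rewrite sumrN; move/eqP: div0; rewrite addr_eq0 => /eqP <-.
ring.
Qed.
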